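(* The existence of a Taylor expansion is preserved under field extensions, finite products and coproducts, split injections, nilpotent quotients, and solvable quotients of groups. That is, let $\Bbbk$ be a field of characteristic $0$ and let $G, G_1,\dots,G_n$ be finitely generated groups. (a) If $G$ has a Taylor expansion over $\Bbbk$ and $\mathbb K$ is a field extension of $\Bbbk$, then $G$ has a Taylor expansion over $\mathbb K$. (b) If $G_1,\dots,G_n$ have Taylor expansions over $\Bbbk$, then so do the direct product $G_1\times\cdots\times G_n$ and the free product $G_1*\cdots *G_n$. (c) If $G$ has a Taylor expansion over $\Bbbk$ and $\iota\colon K\to G$ is a split monomorphism of groups (i.e. there is a homomorphism $\rho\colon G\to K$ with $\rho\circ\iota=\mathrm{id}_K$), then $K$ has a Taylor expansion over $\Bbbk$. (d) If $G$ has a Taylor expansion over $\Bbbk$, then so does each nilpotent quotient $G/\Gamma_iG$, $i\ge 1$. (e) If $G$ has a Taylor expansion over $\Bbbk$, then so does each solvable quotient $G/G^{(i)}$, $i\ge 1$.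
   Context: For a finitely generated group $G$ and a field $\Bbbk$ of characteristic $0$, $\Bbbk G$ is the group algebra, a Hopf algebra with $\Delta(g)=g\otimes g$ and counit $\varepsilon(g)=1$ for $g\in G$; $I=\ker\varepsilon$ and $I^0=\Bbbk G$. The associated graded algebra is $\mathrm{gr}(\Bbbk G)=\bigoplus_{k\ge 0} I^k/I^{k+1}$, and its degree completion is $\widehat{\mathrm{gr}}(\Bbbk G)=\prod_{k\ge 0} I^k/I^{k+1}$, filtered by $\widehat{\mathcal F}_k=\prod_{j\ge k} I^j/I^{j+1}$; it is a complete Hopf algebra with comultiplication $\bar\Delta=\widehat{\mathrm{gr}}(\Delta)\colon \widehat{\mathrm{gr}}(\Bbbk G)\to \widehat{\mathrm{gr}}(\Bbbk G)\,\hat\otimes\,\widehat{\mathrm{gr}}(\Bbbk G)$. The associated graded algebra of $\widehat{\mathrm{gr}}(\Bbbk G)$ is canonically identified with $\mathrm{gr}(\Bbbk G)$. A (multiplicative) expansion of $G$ over $\Bbbk$ is a map $E\colon G\to\widehat{\mathrm{gr}}(\Bbbk G)$ whose linear extension $\bar E\colon \Bbbk G\to\widehat{\mathrm{gr}}(\Bbbk G)$ is an algebra morphism with $\bar E(I^k)\subseteq\widehat{\mathcal F}_k$ for all $k$ and with $\mathrm{gr}(\bar E)=\mathrm{id}$ on $\mathrm{gr}(\Bbbk G)$. It is a Taylor expansion if $\bar\Delta(E(g))=E(g)\,\hat\otimes\,E(g)$ for all $g\in G$. The lower central series is $\Gamma_1G=G$, $\Gamma_{k+1}G=[\Gamma_kG,G]$;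 the derived series is $G^{(0)}=G$, $G^{(i+1)}=[G^{(i)},G^{(i)}]$. *)

(* Defs.v *)
From HB Require Import structures.
Set Warnings "-notation-overridden,-ambiguous-paths,-notation-incompatible-prefix".
Set Warnings "-redundant-canonical-projection,-projection-no-head-constant".
From mathcomp Require Import all_boot all_algebra finmap.
From mathcomp Require Import boolp classical_sets.
From mathcomp Require Import monalg.

Set Implicit Arguments.
Unset Strict Implicit.
Unset Printing Implicit Defensive.

Import GRing.Theory.
Local Open Scope classical_set_scope.
Local Open Scope ring_scope.
Local Open Scope quotient_scope.

Section Subgroups.
Variable G : groupType.
Implicit Types (S H K : set G).

Definition is_subgroup H : Prop :=
  H 1%g /\ forall x y, H x -> H y -> H (x * y^-1)%g.

Definition is_normal H : Prop :=
  is_subgroup H /\ forall x y, H x -> H (x ^ y)%g.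

Definition generated S : set G :=
  [set x | forall H, is_subgroup H -> S `<=` H -> H x].

Definition finitely_generated : Prop :=
  exists s : seq G, generated [set` s] = [set: G].

Definition commutator_subgroup H K : set G :=
  generated [set [~ x, y]%g | x in H & y in K].

Fixpoint derived_series n : set G :=
  if n is m.+1 then commutator_subgroup (derived_series m) (derived_series m)
  else [set: G].

(* The lower central series is indexed from 1; the value at 0 is immaterial. *)
Definition lower_central_series n : set G :=
  iter n.-1 (fun H => commutator_subgroup H [set: G]) [set: G].

Lemma subgroup_mul H : is_subgroup H ->
  forall x y, H x -> H y -> H (x * y)%g.
Proof.
move=> [H1 HM] x y Hx Hy; rewrite -[y]invgK; apply: (HM) => //.
by rewrite -[y^-1%g]mul1g; apply: HM.
Qed.

Lemma subgroup_inv H : is_subgroup H -> forall x, H x -> H (x^-1)%g.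
Proof. by move=> [H1 HM] x Hx; rewrite -[x^-1%g]mul1g; apply: HM. Qed.

Lemma generated_subgroup S : is_subgroup (generated S).
Proof.
split=> [H [] //|x y Sx Sy H sH SH].
by apply: sH.2; [apply: Sx | apply: Sy].
Qed.

Lemma sub_generated S : S `<=` generated S.
Proof. by move=> x Sx H _; apply. Qed.

Lemma generated_normal S :
  (forall x y, S x -> S (x ^ y)%g) -> is_normal (generated S).
Proof.
move=> SJ; split=> [|x y Sx]; first exact: generated_subgroup.
apply: (Sx [set z | generated S (z ^ y)%g]) => [|z Sz] /=.
  have [g1 gM] := generated_subgroup S.
  by split=> [|a b ga gb] /=; [rewrite conj1g|rewrite conjMg conjVg; apply: (gM)].
by apply: sub_generated; apply: SJ.
Qed.

Lemma commutator_normal H K :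
  is_normal H -> is_normal K -> is_normal (commutator_subgroup H K).
Proof.
move=> [_ nH] [_ nK]; apply: generated_normal => _ y [a Ha [b Kb <-]].
by exists (a ^ y)%g; [apply: nH | exists (b ^ y)%g; [apply: nK|rewrite conjRg]].
Qed.

Lemma setT_normal : is_normal [set: G].
Proof. by []. Qed.

Lemma derived_series_normal n : is_normal (derived_series n).
Proof. by elim: n => [|n IHn] /=; [|apply: commutator_normal]. Qed.

Lemma lower_central_series_normal n : is_normal (lower_central_series n).
Proof.
rewrite /lower_central_series.
by elim: n.-1 => [|m IHm] /=; [|apply: commutator_normal].
Qed.

Record normal_subgroup := NormalSubgroup {
  normal_set : set G;
  normal_setP : is_normal normal_set }.

Definition derived_subgroup n := NormalSubgroup (derived_series_normal n).
Definition lower_central_subgroup n :=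
  NormalSubgroup (lower_central_series_normal n).

End Subgroups.

Section QuotientGroup.
Variables (G : groupType) (N : normal_subgroup G).

Definition coset_equiv (x y : G) : bool := `[< normal_set N (x^-1 * y)%g >].

Lemma coset_equivP : equiv_class_of coset_equiv.
Proof.
have [sN _] := normal_setP N; split=> [x|x y|y x z].
- by apply/asboolP; rewrite mulVg; case: sN.
- by apply/asboolP/asboolP => /(subgroup_inv sN); rewrite invgM invgK.
- move=> /asboolP Nxy /asboolP Nyz; apply/asboolP.
  by have := subgroup_mul sN Nxy Nyz; rewrite mulgA mulgK.
Qed.

Canonical coset_equiv_equiv := EquivRelPack coset_equivP.
Canonical coset_equiv_encModRel := defaultEncModRel coset_equiv.

Definition quotient_group := {eq_quot coset_equiv}.
HB.instance Definition _ := Choice.on quotient_group.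
HB.instance Definition _ : EqQuotient G coset_equiv quotient_group :=
  EqQuotient.on quotient_group.

Definition qg_one : quotient_group := \pi_quotient_group 1%g.
Definition qg_mul (x y : quotient_group) : quotient_group :=
  \pi_quotient_group (repr x * repr y)%g.
Definition qg_inv (x : quotient_group) : quotient_group :=
  \pi_quotient_group ((repr x)^-1)%g.

Lemma qg_pi_eq (x y : G) :
  (\pi_quotient_group x = \pi y :> quotient_group) <-> normal_set N (x^-1 * y)%g.
Proof.
split=> [/eqP|Nxy]; first by rewrite piE => /asboolP.
by apply/eqP; rewrite piE; apply/asboolP.
Qed.

Lemma qg_reprP (x : G) : normal_set N ((repr (\pi_quotient_group x : quotient_group))^-1 * x)%g.
Proof. by apply/qg_pi_eq; rewrite reprK. Qed.

Lemma qg_pi_mul (x y : G) :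
  qg_mul (\pi_quotient_group x) (\pi_quotient_group y) =
  \pi_quotient_group (x * y)%g.
Proof.
have [sN nN] := normal_setP N; apply/qg_pi_eq; rewrite invgM.
have := subgroup_mul sN (qg_reprP y) (nN _ y (qg_reprP x)).
by rewrite /conjg !mulgA mulgK.
Qed.

Lemma qg_pi_inv (x : G) :
  qg_inv (\pi_quotient_group x) = \pi_quotient_group (x^-1)%g.
Proof.
have [sN nN] := normal_setP N; apply/qg_pi_eq.
have := nN _ (repr (\pi_quotient_group x))^-1%g (subgroup_inv sN (qg_reprP x)).
by rewrite /conjg invgM !invgK !mulgA mulgK.
Qed.

Fact qg_mulA : associative qg_mul.
Proof.
move=> x y z; rewrite -[x]reprK -[y]reprK -[z]reprK.
rewrite (qg_pi_mul (repr y) (repr z)) (qg_pi_mul (repr x) (repr y)).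
by apply: etrans (qg_pi_mul _ _) _; apply: etrans _ (esym (qg_pi_mul _ _));
  rewrite mulgA.
Qed.
Fact qg_mul1 : left_id qg_one qg_mul.
Proof. by move=> x; rewrite -[x]reprK qg_pi_mul mul1g. Qed.
Fact qg_1mul : right_id qg_one qg_mul.
Proof. by move=> x; rewrite -[x]reprK qg_pi_mul mulg1. Qed.
Fact qg_mulV : left_inverse qg_one qg_inv qg_mul.
Proof. by move=> x; rewrite -[x]reprK qg_pi_inv qg_pi_mul mulVg. Qed.
Fact qg_Vmul : right_inverse qg_one qg_inv qg_mul.
Proof. by move=> x; rewrite -[x]reprK qg_pi_inv qg_pi_mul mulgV. Qed.

HB.instance Definition _ := isGroup.Build quotient_group
  qg_mulA qg_mul1 qg_1mul qg_mulV qg_Vmul.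

End QuotientGroup.

Section DirectProduct.
Variables (I : Type) (G : I -> groupType).

Definition direct_product := forall i, G i.
HB.instance Definition _ := Choice.on direct_product.

Implicit Types x y z : direct_product.
Definition dp_one : direct_product := fun i => 1%g.
Definition dp_mul x y : direct_product := fun i => (x i * y i)%g.
Definition dp_inv x : direct_product := fun i => ((x i)^-1)%g.

Fact dp_mulA : associative dp_mul.
Proof. by move=> x y z; apply/functional_extensionality_dep => i; rewrite /dp_mul mulgA. Qed.
Fact dp_mul1 : left_id dp_one dp_mul.
Proof. by move=> x; apply/functional_extensionality_dep => i; rewrite /dp_mul mul1g. Qed.
Fact dp_1mul : right_id dp_one dp_mul.
Proof. by move=> x; apply/functional_extensionality_dep => i; rewrite /dp_mul mulg1. Qed.
Fact dp_mulV : left_inverse dp_one dp_inv dp_mul.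
Proof. by move=> x; apply/functional_extensionality_dep => i; rewrite /dp_mul mulVg. Qed.
Fact dp_Vmul : right_inverse dp_one dp_inv dp_mul.
Proof. by move=> x; apply/functional_extensionality_dep => i; rewrite /dp_mul mulgV. Qed.

HB.instance Definition _ := isGroup.Build direct_product
  dp_mulA dp_mul1 dp_1mul dp_mulV dp_Vmul.

End DirectProduct.

Section FreeProduct.
Variables (I : choiceType) (G : I -> groupType).

Definition letter := {i : I & G i}.
Definition lett i (a : G i) : letter := existT _ i a.
Definition word := seq letter.
Implicit Types u v w : word.

Inductive word_equiv : word -> word -> Prop :=
| word_refl u : word_equiv u u
| word_sym u v : word_equiv u v -> word_equiv v u
| word_trans u v w : word_equiv u v -> word_equiv v w -> word_equiv u w
| word_cat u u' v v' :
    word_equiv u u' -> word_equiv v v' -> word_equiv (u ++ v) (u' ++ v')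
| word_one i : word_equiv [:: lett (1%g : G i)] [::]
| word_mul i (a b : G i) :
    word_equiv [:: lett a; lett b]
               [:: lett (a * b)%g].

Definition word_equivb u v : bool := `[< word_equiv u v >].

Lemma word_equivbP : equiv_class_of word_equivb.
Proof.
split=> [x|x y|y x z].
- by apply/asboolP/word_refl.
- by apply/asboolP/asboolP; apply: word_sym.
- by move=> /asboolP xy /asboolP yz; apply/asboolP/(word_trans xy yz).
Qed.

Canonical word_equiv_equiv := EquivRelPack word_equivbP.
Canonical word_equiv_encModRel := defaultEncModRel word_equivb.

Definition free_product := {eq_quot word_equivb}.
HB.instance Definition _ := Choice.on free_product.
HB.instance Definition _ : EqQuotient word word_equivb free_product :=
  EqQuotient.on free_product.

Definition word_inv u : word :=
  rev [seq lett ((tagged x)^-1)%g | x : letter <- u].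

Definition fp_one : free_product := \pi_free_product [::].
Definition fp_mul (x y : free_product) : free_product :=
  \pi_free_product (repr x ++ repr y).
Definition fp_inv (x : free_product) : free_product :=
  \pi_free_product (word_inv (repr x)).

Definition fp_inj i (a : G i) : free_product :=
  \pi_free_product [:: lett a].

Lemma fp_pi_eq u v : (\pi_free_product u = \pi v :> free_product) <-> word_equiv u v.
Proof.
split=> [/eqP|uv]; first by rewrite piE => /asboolP.
by apply/eqP; rewrite piE; apply/asboolP.
Qed.

Lemma fp_reprP u : word_equiv (repr (\pi_free_product u : free_product)) u.
Proof. by apply/fp_pi_eq; rewrite reprK. Qed.

Lemma fp_pi_mul u v : fp_mul (\pi_free_product u) (\pi v) = \pi_free_product (u ++ v).
Proof. by apply/fp_pi_eq/word_cat; apply: fp_reprP. Qed.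

Lemma word_inv_cat u v : word_inv (u ++ v) = word_inv v ++ word_inv u.
Proof. by rewrite /word_inv map_cat rev_cat. Qed.

Lemma word_inv_equiv u v : word_equiv u v -> word_equiv (word_inv u) (word_inv v).
Proof.
elim=> {u v} [u|u v _|u v w _ uv _|u u' v v' _ uu' _ vv'|i|i a b].
- exact: word_refl.
- exact: word_sym.
- exact: word_trans.
- by rewrite !word_inv_cat; apply: word_cat.
- by rewrite /word_inv /= invg1; apply: word_one.
- by rewrite /word_inv /rev /= invgM; apply: word_mul.
Qed.

Lemma word_invl u : word_equiv (word_inv u ++ u) [::].
Proof.
elim: u => [|[i a] u IHu]; first exact: word_refl.
rewrite -cat1s word_inv_cat -catA (catA (word_inv [:: _])).
have E : word_equiv (word_inv [:: lett a] ++
            [:: lett a]) [::].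
  apply: (@word_trans _ [:: lett (a^-1 * a)%g]).
    exact: word_mul.
  by rewrite mulVg; apply: word_one.
apply: word_trans (IHu); apply: word_cat; first exact: word_refl.
by rewrite -[X in word_equiv _ X]cat0s; apply: word_cat (word_refl _).
Qed.

Lemma word_invK : involutive word_inv.
Proof.
move=> u; rewrite /word_inv map_rev revK -map_comp -[RHS]map_id.
by apply: eq_map => -[i a] /=; rewrite invgK.
Qed.

Lemma word_invr u : word_equiv (u ++ word_inv u) [::].
Proof. by have := word_invl (word_inv u); rewrite word_invK. Qed.

Lemma fp_pi_inv u : fp_inv (\pi_free_product u) = \pi_free_product (word_inv u).
Proof. by apply/fp_pi_eq/word_inv_equiv/fp_reprP. Qed.

Fact fp_mulA : associative fp_mul.
Proof.
move=> x y z; rewrite -[x]reprK -[y]reprK -[z]reprK.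
rewrite (fp_pi_mul (repr y) (repr z)) (fp_pi_mul (repr x) (repr y)).
by apply: etrans (fp_pi_mul _ _) _; apply: etrans _ (esym (fp_pi_mul _ _));
  rewrite catA.
Qed.
Fact fp_mul1 : left_id fp_one fp_mul.
Proof. by move=> x; rewrite -[x]reprK fp_pi_mul. Qed.
Fact fp_1mul : right_id fp_one fp_mul.
Proof. by move=> x; rewrite -[x]reprK fp_pi_mul cats0. Qed.
Fact fp_mulV : left_inverse fp_one fp_inv fp_mul.
Proof.
by move=> x; rewrite -[x]reprK fp_pi_inv fp_pi_mul; apply/fp_pi_eq/word_invl.
Qed.
Fact fp_Vmul : right_inverse fp_one fp_inv fp_mul.
Proof.
by move=> x; rewrite -[x]reprK fp_pi_inv fp_pi_mul; apply/fp_pi_eq/word_invr.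
Qed.

HB.instance Definition _ := isGroup.Build free_product
  fp_mulA fp_mul1 fp_1mul fp_mulV fp_Vmul.

End FreeProduct.

Section Submodules.
Variables (k : fieldType) (V : lmodType k).

(* Membership is decided classically, so that every subspace can be presented
   as a [submodClosed]. *)
Definition span (S : set V) : {pred V} := fun x =>
  `[< forall U : submodClosed V, (forall y, S y -> y \in U) -> x \in U >].

Fact span_submod S : GRing.subsemimod_closed (span S).
Proof.
split; [split|] => [|x y|c x].
- by apply/asboolP => U _; apply: rpred0.
- by move=> /asboolP xS /asboolP yS; apply/asboolP => U SU; rewrite rpredD ?xS ?yS.
- by move=> /asboolP xS; apply/asboolP => U SU; rewrite rpredZ ?xS.
Qed.
HB.instance Definition _ S := GRing.isSubmodClosed.Build k V (span S) (span_submod S).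

Lemma sub_span (S : set V) x : S x -> x \in span S.
Proof. by move=> Sx; apply/asboolP => U; apply. Qed.

Lemma span_sub (S : set V) (U : submodClosed V) :
  (forall y, S y -> y \in U) -> {subset span S <= U}.
Proof. by move=> SU x /asboolP; apply. Qed.

Definition closed_pred (P : V -> Prop) (_ : P 0)
    (_ : forall x y, P x -> P y -> P (x + y)) (_ : forall c x, P x -> P (c *: x)) :
  {pred V} := fun x => `[< P x >].
Fact closed_predP P P0 PD PZ : GRing.subsemimod_closed (@closed_pred P P0 PD PZ).
Proof.
split; [split|] => [|x y|c x]; first by apply/asboolP.
- by move=> /asboolP Px /asboolP Py; apply/asboolP/PD.
- by move=> /asboolP Px; apply/asboolP/PZ.
Qed.
HB.instance Definition _ P P0 PD PZ := GRing.isSubmodClosed.Build k V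
  (@closed_pred P P0 PD PZ) (@closed_predP P P0 PD PZ).

Lemma span_ind (S : set V) (P : V -> Prop) :
  P 0 -> (forall x y, P x -> P y -> P (x + y)) ->
  (forall c x, P x -> P (c *: x)) -> (forall x, S x -> P x) ->
  forall x, x \in span S -> P x.
Proof.
move=> P0 PD PZ SP x xS.
suff /asboolP : x \in closed_pred P0 PD PZ by [].
by apply: span_sub xS => y /SP Py; apply/asboolP.
Qed.

Variable U : submodClosed V.

Record submod := Submod { submod_val :> V; _ : submod_val \in U }.
HB.instance Definition _ := [isSub for submod_val].
HB.instance Definition _ := [Choice of submod by <:].
Fact submod_closedP : GRing.subsemimod_closed (mem U : pred V).
Proof. by split; [split; [apply: rpred0|apply: rpredD]|apply: rpredZ]. Qed.
HB.instance Definition _ :=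
  GRing.SubChoice_isSubLmodule.Build k V _ submod submod_closedP.

Definition submod_pred : {pred V} := fun x => x \in U.
Fact submod_predP : zmod_closed submod_pred.
Proof.
split=> [|x y xU yU]; first exact: (rpred0 U).
by rewrite -scaleN1r; apply: (@rpredD _ U) => //; apply: (@rpredZ _ _ U).
Qed.
HB.instance Definition _ := GRing.isZmodClosed.Build V submod_pred submod_predP.

Definition quotient_mod := Quotient.quot submod_pred.
HB.instance Definition _ := EqQuotient.on quotient_mod.
HB.instance Definition _ := GRing.Zmodule.on quotient_mod.

Definition qm_pi (x : V) : quotient_mod := \pi_quotient_mod x.

Lemma qm_pi_eq x y : qm_pi x = qm_pi y <-> x - y \in U.
Proof.
split=> [/eqP|xy].
  by rewrite -[_ == _]/(\pi_quotient_mod x == \pi_quotient_mod y) eqmodE.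
by apply/eqP; rewrite -[_ == _]/(\pi_quotient_mod x == \pi_quotient_mod y) eqmodE.
Qed.

Lemma qm_reprK : cancel (fun q : quotient_mod => repr q : V) qm_pi.
Proof. exact: reprK. Qed.

Lemma qm_repr x : repr (qm_pi x) - x \in U.
Proof. by apply/qm_pi_eq/qm_reprK. Qed.

Lemma qm_piB : {morph qm_pi : x y / x - y}.
Proof. by move=> x y; rewrite /qm_pi !piE. Qed.

Definition qm_scale (c : k) (q : quotient_mod) : quotient_mod :=
  qm_pi (c *: repr q).

Lemma qm_piZ c x : qm_scale c (qm_pi x) = qm_pi (c *: x).
Proof. by apply/qm_pi_eq; rewrite -scalerBr rpredZ ?qm_repr. Qed.

Lemma qm_piD : {morph qm_pi : x y / x + y}.
Proof. by move=> x y; rewrite /qm_pi !piE. Qed.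

Fact qm_scaleA a b q : qm_scale a (qm_scale b q) = qm_scale (a * b) q.
Proof. by rewrite -[q]qm_reprK !qm_piZ scalerA. Qed.
Fact qm_scale1 : left_id 1 qm_scale.
Proof. by move=> q; rewrite -[q]qm_reprK qm_piZ scale1r. Qed.
Fact qm_scaleDr : right_distributive qm_scale +%R.
Proof.
move=> a p q; rewrite -[p]qm_reprK -[q]qm_reprK.
set x : V := repr p; set y : V := repr q.
by rewrite -qm_piD (qm_piZ a (x + y)) (qm_piZ a x) (qm_piZ a y) -qm_piD scalerDr.
Qed.
Fact qm_scaleDl q : {morph qm_scale^~ q : a b / a + b}.
Proof.
move=> a b; rewrite -[q]qm_reprK; set x : V := repr q.
by rewrite (qm_piZ (a + b) x) (qm_piZ a x) (qm_piZ b x) -qm_piD scalerDl.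
Qed.
HB.instance Definition _ := GRing.Zmodule_isLmodule.Build k quotient_mod
  qm_scaleA qm_scale1 qm_scaleDr qm_scaleDl.

Fact qm_pi_linear : linear qm_pi.
Proof. by move=> c x y; rewrite qm_piD -(qm_piZ c x). Qed.
HB.instance Definition _ :=
  GRing.isLinear.Build k V quotient_mod _ qm_pi qm_pi_linear.

End Submodules.

Section Filtrations.
Variables (k : fieldType).

Record filtration (V : lmodType k) := Filtration {
  fil :> nat -> submodClosed V;
  fil0 : forall x, x \in fil 0;
  filS : forall n, {subset fil n.+1 <= fil n} }.

Section Graded.
Variables (V : lmodType k) (F : filtration V).

Definition fil_next n : {pred submod (F n)} := fun u => val u \in F n.+1.
Fact fil_nextP n : GRing.subsemimod_closed (@fil_next n).
Proof.
split; [split|] => [|u v|c u].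
- exact: (rpred0 (F n.+1)).
- exact: (@rpredD _ (F n.+1)).
- exact: (@rpredZ _ _ (F n.+1)).
Qed.
HB.instance Definition _ n :=
  GRing.isSubmodClosed.Build k (submod (F n)) (@fil_next n) (fil_nextP n).

Definition gr n := quotient_mod (@fil_next n).
HB.instance Definition _ n := GRing.Lmodule.on (gr n).

(* The class in F_n / F_(n+1) of an element of F_n, and 0 outside F_n. *)
Definition gr_class n (x : V) : gr n := qm_pi _ (insubd 0 x).

Definition gr_lift n (u : gr n) : V := val (repr u : submod (F n)).

Lemma gr_lift_fil n (u : gr n) : gr_lift u \in F n.
Proof. exact: (valP (repr u : submod (F n))). Qed.

Lemma gr_liftK n : cancel (@gr_lift n) (@gr_class n).
Proof. by move=> u; rewrite /gr_class /gr_lift valKd qm_reprK. Qed.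

Lemma gr_class_eq n x y : x \in F n -> y \in F n ->
  gr_class n x = gr_class n y <-> x - y \in F n.+1.
Proof.
move=> xF yF; rewrite qm_pi_eq -topredE /= /fil_next.
by rewrite raddfB /= !insubdK.
Qed.

Lemma gr_classK n x : x \in F n -> gr_lift (gr_class n x) - x \in F n.+1.
Proof. by move=> xF; apply/gr_class_eq; rewrite ?gr_lift_fil ?gr_liftK. Qed.

Lemma gr_classZD n c x y : x \in F n -> y \in F n ->
  gr_class n (c *: x + y) = c *: gr_class n x + gr_class n y.
Proof.
move=> xF yF; rewrite /gr_class -linearP; congr qm_pi; apply: val_inj.
by rewrite linearP /= !insubdK ?rpredD ?rpredZ.
Qed.

Lemma gr_class0 n : gr_class n 0 = 0.
Proof.
have := gr_classZD (-1) (rpred0 (F n)) (rpred0 (F n)).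
by rewrite scaler0 addr0 scaleN1r addNr.
Qed.

(* The degree completion of the associated graded space. *)
Definition cgr := forall n, gr n.
HB.instance Definition _ := Choice.on cgr.

Implicit Types x y z : cgr.
Definition cgr_zero : cgr := fun n => 0.
Definition cgr_opp x : cgr := fun n => - x n.
Definition cgr_add x y : cgr := fun n => x n + y n.
Definition cgr_scale (c : k) x : cgr := fun n => c *: x n.

Lemma cgrP x y : (forall n, x n = y n) -> x = y.
Proof. exact: functional_extensionality_dep. Qed.

Fact cgr_addA : associative cgr_add.
Proof. by move=> x y z; apply: cgrP => n; apply: addrA. Qed.
Fact cgr_addC : commutative cgr_add.
Proof. by move=> x y; apply: cgrP => n; apply: addrC. Qed.
Fact cgr_add0 : left_id cgr_zero cgr_add.
Proof. by move=> x; apply: cgrP => n; apply: add0r. Qed.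
Fact cgr_addN : left_inverse cgr_zero cgr_opp cgr_add.
Proof. by move=> x; apply: cgrP => n; apply: addNr. Qed.
HB.instance Definition _ := GRing.isZmodule.Build cgr
  cgr_addA cgr_addC cgr_add0 cgr_addN.

Fact cgr_scaleA a b x : cgr_scale a (cgr_scale b x) = cgr_scale (a * b) x.
Proof. by apply: cgrP => n; apply: scalerA. Qed.
Fact cgr_scale1 : left_id 1 cgr_scale.
Proof. by move=> x; apply: cgrP => n; apply: scale1r. Qed.
Fact cgr_scaleDr : right_distributive cgr_scale +%R.
Proof. by move=> a x y; apply: cgrP => n; apply: scalerDr. Qed.
Fact cgr_scaleDl x : {morph cgr_scale^~ x : a b / a + b}.
Proof. by move=> a b; apply: cgrP => n; apply: scalerDl. Qed.
HB.instance Definition _ := GRing.Zmodule_isLmodule.Build k cgr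
  cgr_scaleA cgr_scale1 cgr_scaleDr cgr_scaleDl.

Definition cfil_pred n : {pred cgr} :=
  fun x => `[< forall j, (j < n)%N -> x j = 0 >].
Fact cfil_submod n : GRing.subsemimod_closed (cfil_pred n).
Proof.
split; [split|] => [|x y|c x].
- by apply/asboolP.
- move=> /asboolP xF /asboolP yF; apply/asboolP => j ltjn.
  by rewrite -[LHS]/(x j + y j) xF ?yF ?addr0.
- move=> /asboolP xF; apply/asboolP => j ltjn.
  by rewrite -[LHS]/(c *: x j) xF ?scaler0.
Qed.
HB.instance Definition _ n :=
  GRing.isSubmodClosed.Build k cgr (cfil_pred n) (cfil_submod n).

Fact cfil_fil0 (x : cgr) : x \in cfil_pred 0.
Proof. by apply/asboolP. Qed.
Fact cfil_filS n : {subset cfil_pred n.+1 <= cfil_pred n}.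
Proof. by move=> x /asboolP xF; apply/asboolP => j /ltnW/xF. Qed.

Definition cfil : filtration cgr :=
  @Filtration cgr (fun n => cfil_pred n) cfil_fil0 cfil_filS.

End Graded.

(* The canonical identification of the associated graded space of the degree
   completion, for the filtration [cfil], with the original graded space. *)
Definition gr_cgr_id (V : lmodType k) (F : filtration V) n
  (u : gr (cfil F) n) : gr F n := gr_lift u n.

Section Functoriality.
Variables (V W : lmodType k) (F : filtration V) (F' : filtration W).

Definition filtered (f : V -> W) : Prop :=
  forall n x, x \in F n -> f x \in F' n.

(* Induced maps; meaningful when f is linear and filtered. *)
Definition gr_map (f : V -> W) n (u : gr F n) : gr F' n :=
  gr_class F' n (f (gr_lift u)).

Definition cgr_map (f : V -> W) (x : cgr F) : cgr F' := fun n => gr_map f (x n).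

End Functoriality.
End Filtrations.


Section LinearExtension.
Variables (k : fieldType) (T : choiceType) (V : lmodType k).
Implicit Types (f : T -> V) (a b : {malg k[T]}).

Definition linext f a : V := \sum_(x <- msupp a) a@_x *: f x.

Lemma linextw f a (d : {fset T}) : (msupp a `<=` d)%fset ->
  linext f a = \sum_(x <- d) a@_x *: f x.
Proof.
move=> sad; rewrite /linext; apply: big_fset_incl => // x _ /mcoeff_outdom ->.
by rewrite scale0r.
Qed.

Fact linext_linear f : linear (linext f).
Proof.
move=> c a b; set d := (msupp a `|` msupp b)%fset.
have sd : (msupp (c *: a + b) `<=` d)%fset.
  apply: fsubset_trans (msuppD_le _ _) _; apply: fsetSU; exact: msuppZ_le.
rewrite (linextw _ sd) (linextw _ (fsubsetUl (msupp a) (msupp b))).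
rewrite (linextw _ (fsubsetUr (msupp a) (msupp b))) scaler_sumr -big_split /=.
by apply: eq_bigr => x _; rewrite mcoeffD mcoeffZ scalerDl scalerA.
Qed.
HB.instance Definition _ f :=
  GRing.isLinear.Build k {malg k[T]} V _ (linext f) (linext_linear f).

Lemma linextU f x : linext f << x >> = f x.
Proof. by rewrite (linextw _ msuppU_le) big_seq_fset1 mcoeffUU scale1r. Qed.

End LinearExtension.

Lemma malg_span (k : fieldType) (T : choiceType) (U : submodClosed {malg k[T]}) :
  (forall x, << x >> \in U) -> forall a, a \in U.
Proof.
move=> UT a; rewrite [a]monalgE; apply: rpred_sum => x _.
have -> : << a@_x *g x >> = a@_x *: << x >> :> {malg k[T]}.
  by apply/malgP => y; rewrite mcoeffZ !mcoeffU mulr_natr.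
by rewrite rpredZ.
Qed.

Section Tensor.
Variables (k : fieldType) (V W : lmodType k).

Definition bilinear_relations : set {malg k[(V * W)%type]} :=
  [set z | (exists v v' w, z = << (v + v', w) >> - << (v, w) >> - << (v', w) >>)
        \/ (exists v w w', z = << (v, w + w') >> - << (v, w) >> - << (v, w') >>)
        \/ (exists c v w, z = << (c *: v, w) >> - c *: << (v, w) >>)
        \/ (exists c v w, z = << (v, c *: w) >> - c *: << (v, w) >>)].

Definition tensor := quotient_mod (span bilinear_relations).
HB.instance Definition _ := GRing.Lmodule.on tensor.

Definition tens (v : V) (w : W) : tensor := qm_pi _ << (v, w) >>.

(* The linear map induced on the tensor product by a bilinear map. *)
Definition tensor_lift (X : lmodType k) (b : V -> W -> X) (t : tensor) : X :=
  linext (fun p => b p.1 p.2) (repr t).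

Lemma tensor_span (U : submodClosed tensor) :
  (forall v w, tens v w \in U) -> forall t, t \in U.
Proof.
move=> Ut t; rewrite -[t]qm_reprK; move: (repr t) => a.
rewrite [X in qm_pi _ X]monalgE raddf_sum; apply: rpred_sum => -[v w] _ /=.
have -> : << a@_(v, w) *g (v, w) >> = a@_(v, w) *: << (v, w) >>
    :> {malg k[(V * W)%type]}.
  by apply/malgP => y; rewrite mcoeffZ !mcoeffU mulr_natr.
by rewrite linearZ rpredZ //; apply: Ut.
Qed.

Section Filtration.
Variables (F : filtration V) (F' : filtration W).

Definition tfil_gen n : set tensor :=
  [set t | exists i j v w,
     [/\ (i + j)%N = n, v \in F i, w \in F' j & t = tens v w]].

Fact tfil_fil0 (t : tensor) : t \in span (tfil_gen 0).
Proof.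
apply: tensor_span => v w; apply: sub_span.
by exists 0%N, 0%N, v, w; split; rewrite ?fil0.
Qed.

Fact tfil_filS n : {subset span (tfil_gen n.+1) <= span (tfil_gen n)}.
Proof.
apply: span_sub => _ [i [j [v [w [ijn vF wF ->]]]]]; apply: sub_span.
case: i ijn vF => [|i] ijn vF.
  exists 0%N, n, v, w; split=> //; apply: filS.
  by rewrite add0n in ijn; rewrite -ijn.
by exists i, j, v, w; split=> //; [case: ijn|apply: filS].
Qed.

(* The filtration on the tensor product: the n-th piece is the sum of the
   images of the tensor products of F i and F' j over i + j = n. *)
Definition tfil : filtration tensor :=
  @Filtration k tensor (fun n => span (tfil_gen n)) tfil_fil0 tfil_filS.

End Filtration.
End Tensor.

Section CompletedTensor.
Variables (k : fieldType) (V W : lmodType k).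
Variables (F : filtration V) (F' : filtration W).

(* The completed tensor product of [cgr F] and [cgr F'] is the degree completion
   of the tensor product of the two graded spaces, that is, the product over n
   of the direct sums over i + j = n of the [gr F i] tensor [gr F' j]; these
   sums are finite, so it is the product over all pairs (i, j). *)
Definition ctensor := forall i j, tensor (gr F i) (gr F' j).

Definition ctens (x : cgr F) (y : cgr F') : ctensor :=
  fun i j => tens (x i) (y j).

(* The canonical map to the degree completion for the tensor product
   filtration. It sends the tensor product of the classes of v in F i and of
   w in F' j to the class of the tensor product of v and w; it is bijective. *)
Definition ctensor_cgr (t : ctensor) : cgr (tfil F F') := fun n =>
  \sum_(i < n.+1) tensor_lift
    (fun u u' => gr_class (tfil F F') n (tens (gr_lift u) (gr_lift u')))
    (t i (n - i)%N).

(* The inverse of the bijection [ctensor_cgr]. *)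
Definition cgr_ctensor (x : cgr (tfil F F')) : ctensor :=
  xget (fun _ _ => 0) [set t | ctensor_cgr t = x].

End CompletedTensor.

Section FilteredAlgebra.
Variables (k : fieldType) (A : algType k).

Record alg_filtration := AlgFiltration {
  afil :> filtration A;
  afilM : forall i j x y, x \in afil i -> y \in afil j -> x * y \in afil (i + j);
  afil1 : 1 \notin afil 1 }.

Variable F : alg_filtration.

(* The degree completion [cgr F], with its algebra structure. *)
Definition cgra := cgr F.
HB.instance Definition _ := GRing.Lmodule.on cgra.
Implicit Types x y z : cgra.

Definition cgra_one : cgra :=
  fun n => if n is 0 then gr_class F 0 1 else 0.
Definition cgra_mul x y : cgra := fun n =>
  gr_class F n (\sum_(i < n.+1) gr_lift (x i) * gr_lift (y (n - i)%N)).

(* [represents X x]: the coefficients of the polynomial X lift the components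
   of x up to degree n. *)
Let represents n (X : {poly A}) x := forall i, (i <= n)%N ->
  X`_i \in F i /\ x i = gr_class F i X`_i.

Let cls_eq n X Y : X \in F n -> X - Y \in F n.+1 ->
  gr_class F n X = gr_class F n Y.
Proof.
move=> XF XY; apply/gr_class_eq => //.
by rewrite -[Y](subKr X) -scaleN1r rpredD // rpredZ // (filS XY).
Qed.

Let rep_lift n x : represents n (\poly_(i < n.+1) gr_lift (x i)) x.
Proof. by move=> i lein; rewrite coef_poly ltnS lein gr_lift_fil gr_liftK. Qed.

Let conv_fil n m X Y x y : (m <= n)%N ->
  represents n X x -> represents n Y y -> (X * Y)`_m \in F m.
Proof.
move=> lemn Xx Yy; rewrite coefM; apply: rpred_sum => i _.
have leim : (i <= m)%N by rewrite -ltnS.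
rewrite -[m in F m](subnKC leim); apply: afilM.
  by case: (Xx i) => //; apply: leq_trans lemn.
by case: (Yy (m - i)%N) => //; apply: leq_trans lemn; apply: leq_subr.
Qed.

Let rep_mul n X Y x y :
  represents n X x -> represents n Y y -> represents n (X * Y) (cgra_mul x y).
Proof.
move=> Xx Yy m lemn; split; first exact: conv_fil Xx Yy.
rewrite /cgra_mul; symmetry; apply: cls_eq; first exact: conv_fil Xx Yy.
rewrite coefM -sumrB; apply: rpred_sum => i _.
have leim : (i <= m)%N by rewrite -ltnS.
move: (nat_of_ord i) leim => {}i leim.
have [XF xE] := Xx _ (leq_trans leim lemn).
have [YF yE] := Yy _ (leq_trans (leq_subr i m) lemn).
have dX : gr_lift (x i) - X`_i \in F i.+1 by rewrite xE gr_classK.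
have dY : gr_lift (y (m - i)%N) - Y`_(m - i) \in F (m - i).+1.
  by rewrite yE gr_classK.
set a := gr_lift _ in dX *; set b := gr_lift _ in dY *.
have -> : X`_i * Y`_(m - i) - a * b =
    - 1 *: ((a - X`_i) * Y`_(m - i) + a * (b - Y`_(m - i))).
  rewrite scaleN1r mulrBl mulrBr opprD !opprB.
  by rewrite subrKA.
apply: rpredZ; apply: rpredD.
  have -> : m.+1 = (i.+1 + (m - i))%N by rewrite addSn subnKC.
  exact: (@afilM F i.+1 (m - i) _ _ dX YF).
have -> : m.+1 = (i + (m - i).+1)%N by rewrite addnS subnKC.
by apply: afilM => //; apply: gr_lift_fil.
Qed.

Let repP n X Y x y : represents n X x -> represents n Y y ->
  X`_n - Y`_n \in F n.+1 -> x n = y n.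
Proof.
move=> Xx Yy XY; have [XF ->] := Xx _ (leqnn n); have [_ ->] := Yy _ (leqnn n).
exact: cls_eq.
Qed.

Let rep_linear n c X Y x y : represents n X x -> represents n Y y ->
  represents n (c%:A *: X + Y) (c *: x + y).
Proof.
move=> Xx Yy i lein; rewrite coefD coefZ mulr_algl.
have [XF xE] := Xx _ lein; have [YF yE] := Yy _ lein.
split; first by rewrite rpredD ?rpredZ.
by rewrite gr_classZD // -xE -yE.
Qed.

Let rep_one n : represents n 1 cgra_one.
Proof.
move=> [|i] _; rewrite coef1 /= ?fil0 // rpred0; split=> //.
by rewrite gr_class0.
Qed.

Fact cgra_mulA : associative cgra_mul.
Proof.
move=> x y z; apply: cgrP => n.
have [Xx Yy Zz] := And3 (@rep_lift n x) (@rep_lift n y) (@rep_lift n z).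
apply: (repP (rep_mul Xx (rep_mul Yy Zz)) (rep_mul (rep_mul Xx Yy) Zz)).
by rewrite mulrA subrr rpred0.
Qed.
Fact cgra_mul1 : left_id cgra_one cgra_mul.
Proof.
move=> x; apply: cgrP => n; have Xx := @rep_lift n x.
by apply: (repP (rep_mul (@rep_one n) Xx) Xx); rewrite mul1r subrr rpred0.
Qed.
Fact cgra_1mul : right_id cgra_one cgra_mul.
Proof.
move=> x; apply: cgrP => n; have Xx := @rep_lift n x.
by apply: (repP (rep_mul Xx (@rep_one n)) Xx); rewrite mulr1 subrr rpred0.
Qed.

Let rep_add n X Y x y : represents n X x -> represents n Y y ->
  represents n (X + Y) (x + y).
Proof. by move=> Xx Yy; have := rep_linear 1 Xx Yy; rewrite !scale1r. Qed.

Fact cgra_mulDl : left_distributive cgra_mul +%R.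
Proof.
move=> x y z; apply: cgrP => n.
have [Xx Yy Zz] := And3 (@rep_lift n x) (@rep_lift n y) (@rep_lift n z).
apply: (repP (rep_mul (rep_add Xx Yy) Zz) (rep_add (rep_mul Xx Zz) (rep_mul Yy Zz))).
by rewrite mulrDl subrr rpred0.
Qed.
Fact cgra_mulDr : right_distributive cgra_mul +%R.
Proof.
move=> x y z; apply: cgrP => n.
have [Xx Yy Zz] := And3 (@rep_lift n x) (@rep_lift n y) (@rep_lift n z).
apply: (repP (rep_mul Xx (rep_add Yy Zz)) (rep_add (rep_mul Xx Yy) (rep_mul Xx Zz))).
by rewrite mulrDr subrr rpred0.
Qed.
Fact cgra_1neq0 : cgra_one != 0.
Proof.
apply/eqP => /(congr1 (fun x : cgra => x 0%N)) /= E.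
have /gr_class_eq : gr_class F 0 1 = gr_class F 0 0 by rewrite E gr_class0.
by rewrite !fil0 subr0 (negPf (afil1 F)) => /(_ isT isT).
Qed.
HB.instance Definition _ := GRing.Zmodule_isNzRing.Build cgra
  cgra_mulA cgra_mul1 cgra_1mul cgra_mulDl cgra_mulDr cgra_1neq0.

Let rep_0 n : represents n 0 0.
Proof. by move=> i _; rewrite coef0 gr_class0 rpred0. Qed.

Let rep_scale n c X x : represents n X x -> represents n (c%:A *: X) (c *: x).
Proof. by move=> Xx; have := rep_linear c Xx (@rep_0 n); rewrite !addr0. Qed.

Fact cgra_scaleAl (c : k) x y : c *: (x * y) = (c *: x) * y.
Proof.
apply: cgrP => n; have [Xx Yy] := conj (@rep_lift n x) (@rep_lift n y).
apply: (repP (rep_scale c (rep_mul Xx Yy)) (rep_mul (rep_scale c Xx) Yy)).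
by rewrite scalerAl subrr rpred0.
Qed.
HB.instance Definition _ := GRing.Lmodule_isLalgebra.Build k cgra cgra_scaleAl.
Fact cgra_scaleAr (c : k) x y : c *: (x * y) = x * (c *: y).
Proof.
apply: cgrP => n; have [Xx Yy] := conj (@rep_lift n x) (@rep_lift n y).
apply: (repP (rep_scale c (rep_mul Xx Yy)) (rep_mul Xx (rep_scale c Yy))).
suff -> : forall P Q : {poly A}, c%:A *: (P * Q) = P * (c%:A *: Q).
  by rewrite subrr rpred0.
move=> P Q; apply/polyP => i; rewrite coefZ !coefM mulr_sumr.
by apply: eq_bigr => j _; rewrite coefZ !mulr_algl scalerAr.
Qed.
HB.instance Definition _ := GRing.Lalgebra_isAlgebra.Build k cgra cgra_scaleAr.

End FilteredAlgebra.

Section LinearExtensionTheory.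
Variables (k : fieldType) (T : choiceType) (V : lmodType k).
Implicit Types (f g : T -> V) (a : {malg k[T]}).

Lemma eq_linext f g : f =1 g -> linext f =1 linext g.
Proof. by move=> fg a; apply: eq_bigr => x _; rewrite fg. Qed.

Lemma linext_fun c f g a :
  linext (fun x => c *: f x + g x) a = c *: linext f a + linext g a.
Proof.
rewrite /linext scaler_sumr -big_split; apply: eq_bigr => x _ /=.
by rewrite scalerDr !scalerA mulrC.
Qed.

Lemma linext_comp (W : lmodType k) (h : {linear V -> W}) f a :
  h (linext f a) = linext (fun x => h (f x)) a.
Proof. by rewrite linear_sum; apply: eq_bigr => x _; rewrite linearZ. Qed.

Lemma linext_id a : linext (fun x => << x >>) a = a :> {malg k[T]}.
Proof.
rewrite [RHS]monalgE; apply: eq_bigr => x _.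
by apply/malgP => y; rewrite mcoeffZ !mcoeffU mulr_natr.
Qed.

End LinearExtensionTheory.

Section GroupAlgebra.
Variables (k : fieldType) (G : groupType).

(* A copy of the free k-module on G: multinomials equips [{malg k[M]}] with a
   product only for monoids M without nontrivial units. *)
Definition group_algebra := {malg k[G]}.
HB.instance Definition _ := GRing.Lmodule.on group_algebra.
Implicit Types a b c : group_algebra.

Definition ga_one : group_algebra := << 1%g >>.
Definition ga_mul a b : group_algebra :=
  linext (fun g : G => linext (fun h : G => << (g * h)%g >>) b) a.

Fact ga_mulA : associative ga_mul.
Proof.
move=> a b c; symmetry; rewrite /ga_mul [LHS]linext_comp.
apply: eq_linext => g; rewrite [LHS]linext_comp [RHS]linext_comp.
apply: eq_linext => h /=; rewrite [LHS]linextU [RHS]linext_comp.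
by apply: eq_linext => l /=; rewrite linextU mulgA.
Qed.
Fact ga_mul1 : left_id ga_one ga_mul.
Proof.
move=> a; rewrite /ga_mul linextU -[RHS]linext_id.
by apply: eq_linext => h; rewrite mul1g.
Qed.
Fact ga_1mul : right_id ga_one ga_mul.
Proof.
move=> a; rewrite -[RHS]linext_id; apply: eq_linext => h.
by rewrite linextU mulg1.
Qed.
Fact ga_mulDl : left_distributive ga_mul +%R.
Proof. by move=> a b c; rewrite /ga_mul linearD. Qed.
Fact ga_mul_linear a : linear (ga_mul a).
Proof.
move=> c b b'; rewrite /ga_mul -linext_fun; apply: eq_linext => g.
exact: linearP.
Qed.
Fact ga_mulDr : right_distributive ga_mul +%R.
Proof.
by move=> a b c; have := ga_mul_linear a 1 b c; rewrite !scale1r.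
Qed.
Fact ga_1neq0 : ga_one != 0.
Proof. by rewrite /ga_one monalgU_eq0 oner_neq0. Qed.
HB.instance Definition _ := GRing.Zmodule_isNzRing.Build group_algebra
  ga_mulA ga_mul1 ga_1mul ga_mulDl ga_mulDr ga_1neq0.

Fact ga_scaleAl (c : k) a b : c *: (a * b) = (c *: a) * b.
Proof. by symmetry; apply: (linearZ_LR (linext _)). Qed.
HB.instance Definition _ :=
  GRing.Lmodule_isLalgebra.Build k group_algebra ga_scaleAl.
Fact ga_scaleAr (c : k) a b : c *: (a * b) = a * (c *: b).
Proof.
have := ga_mul_linear a c b 0.
by rewrite -[ga_mul a 0]/(a * 0) mulr0 !addr0 => /esym.
Qed.
HB.instance Definition _ :=
  GRing.Lalgebra_isAlgebra.Build k group_algebra ga_scaleAr.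

Definition augmentation (a : group_algebra) : k^o := linext (fun _ : G => 1) a.

Definition augmentation_ideal : {pred group_algebra} :=
  fun a => augmentation a == 0.
Fact augmentation_ideal_submod : GRing.subsemimod_closed augmentation_ideal.
Proof.
split; [split|] => [|a b /eqP a0 /eqP b0|c a /eqP a0]; apply/eqP.
- exact: (linear0 (linext _)).
- apply: etrans (linearD (linext _) a b) _.
  exact: etrans (congr2 +%R a0 b0) (addr0 _).
- apply: etrans (linearZ_LR (linext _) c a) _.
  exact: etrans (congr1 ( *:%R c) a0) (scaler0 _ _).
Qed.
HB.instance Definition _ := GRing.isSubmodClosed.Build k group_algebra
  augmentation_ideal augmentation_ideal_submod.

Fixpoint augmentation_power n : submodClosed group_algebra :=
  if n is m.+1 then
    span [set a * b | a in [set` augmentation_power m] & b in [set` augmentation_ideal]]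
  else span [set: group_algebra].

Lemma augmentationM a b : augmentation (a * b) = augmentation a * augmentation b.
Proof.
have E (g : G) :
    augmentation (linext (fun h : G => << (g * h)%g >>) b) = augmentation b.
  apply: etrans (linext_comp (linext (fun _ : G => 1 : k^o)) _ _) _.
  by apply: eq_linext => h; exact: linextU.
apply: etrans (linext_comp (linext (fun _ : G => 1 : k^o)) _ _) _.
apply: etrans (eq_linext E a) _; rewrite /augmentation /linext mulr_suml.
by apply: eq_bigr => g _; rewrite -scalerAl mul1r.
Qed.

Lemma augmentation1 : augmentation 1 = 1.
Proof. exact: linextU. Qed.

Lemma augmentation_idealMr a b :
  b \in augmentation_ideal -> a * b \in augmentation_ideal.
Proof.
by move=> /eqP b0; apply/eqP; rewrite augmentationM b0 mulr0.
Qed.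

Lemma augmentation_idealMl a b :
  a \in augmentation_ideal -> a * b \in augmentation_ideal.
Proof.
by move=> /eqP a0; apply/eqP; rewrite augmentationM a0 mul0r.
Qed.

Lemma augmentation_power_fil0 a : a \in augmentation_power 0.
Proof. exact: sub_span. Qed.

Lemma augmentation_powerMl n a b :
  a \in augmentation_power n -> a * b \in augmentation_power n.
Proof.
case: n => [|n] /=; first by move=> _; exact: sub_span.
move: a; apply: span_ind => [|a a' aI a'I|c a aI|].
- by rewrite mul0r rpred0.
- by rewrite mulrDl rpredD.
- by rewrite -scalerAl rpredZ.
move=> _ [a aI [d dI <-]]; apply: sub_span; exists a => //; exists (d * b).
  exact: augmentation_idealMl.
by rewrite mulrA.
Qed.

Lemma augmentation_power_filS n :
  {subset augmentation_power n.+1 <= augmentation_power n}.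
Proof.
apply: span_sub => _ [a aI [b bI <-]]; exact: augmentation_powerMl.
Qed.

Lemma augmentation_powerM i j a b :
  a \in augmentation_power i -> b \in augmentation_power j ->
  a * b \in augmentation_power (i + j).
Proof.
elim: j a b => [|j IHj] a b aI.
  by rewrite addn0 => _; exact: augmentation_powerMl.
rewrite addnS; move: b; apply: span_ind => [|b b' bI b'I|c b bI|].
- by rewrite mulr0 rpred0.
- by rewrite mulrDr rpredD.
- by rewrite -scalerAr rpredZ.
move=> _ [b bI [d dI <-]]; apply: sub_span; exists (a * b); first exact: IHj.
by exists d; rewrite ?mulrA.
Qed.

Lemma augmentation_power1 : 1 \notin augmentation_power 1.
Proof.
apply/negP => /(@span_sub _ _ _ augmentation_ideal) I1.
suff /I1 /eqP : forall y, [set a * b | a in [set` augmentation_power 0] &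
    b in [set` augmentation_ideal]] y -> y \in augmentation_ideal.
  by rewrite augmentation1 => /eqP; rewrite oner_eq0.
by move=> _ [a _ [b bI <-]]; exact: augmentation_idealMr.
Qed.
End GroupAlgebra.

Section Expansions.
Variables (k : fieldType) (G : groupType).

Definition augmentation_filtration : alg_filtration (group_algebra k G) :=
  @AlgFiltration k (group_algebra k G)
    (@Filtration k (group_algebra k G) (@augmentation_power k G)
      (@augmentation_power_fil0 k G) (@augmentation_power_filS k G))
    (@augmentation_powerM k G) (@augmentation_power1 k G).
Local Notation I := augmentation_filtration.

Definition completed_gr := cgra I.
HB.instance Definition _ := GRing.Algebra.on completed_gr.

Definition comultiplication :
    group_algebra k G -> tensor (group_algebra k G) (group_algebra k G) :=
  linext (fun g : G =>
    tens (<< g >> : group_algebra k G) (<< g >> : group_algebra k G)).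

Definition completed_comultiplication (x : completed_gr) : ctensor I I :=
  cgr_ctensor (cgr_map (tfil I I) comultiplication x).

Definition linear_extension (E : G -> completed_gr) :
  group_algebra k G -> completed_gr := linext E.

(* [linear_extension E] is linear by construction, so it is an algebra morphism
   as soon as it is a monoid morphism. *)
Definition is_expansion (E : G -> completed_gr) : Prop :=
  [/\ GRing.monoid_morphism (linear_extension E),
      filtered I (cfil I) (linear_extension E) &
      forall n (u : gr I n),
        gr_cgr_id (gr_map (cfil I) (linear_extension E) u) = u].

Definition is_Taylor_expansion (E : G -> completed_gr) : Prop :=
  is_expansion E /\
  forall g, completed_comultiplication (E g) = ctens (E g) (E g).

Definition has_Taylor_expansion : Prop :=
  exists E : G -> completed_gr, is_Taylor_expansion E.

End Expansions.

(* Main.v *)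
From HB Require Import structures.
Require Import Defs.
Set Warnings "-notation-overridden,-ambiguous-paths,-notation-incompatible-prefix".
Set Warnings "-redundant-canonical-projection,-projection-no-head-constant".
From mathcomp Require Import all_boot all_algebra.
From mathcomp Require Import boolp classical_sets.
From mathcomp Require Import monalg.

Set Implicit Arguments.
Unset Strict Implicit.
Unset Printing Implicit Defensive.

Import Defs GRing.Theory.

(** Let I be the augmentation ideal of the group algebra of G. The powers of I
    are spanned by products of elements g - 1, so a multiplicative map E from G
    to the completed graded algebra is an expansion as soon as E(g) has
    components 1 and the class of g - 1 in degrees 0 and 1
    ([expansion_degree_le1]). Over a field the completed tensor square is the
    completion of the tensor square for the product filtration
    ([ctensor_cgr_inj], [ctensor_cgr_surj]); hence E(g) is group-like exactly
    when its components X_n satisfy, for all n,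
    Delta(X_n) = X_0 (x) X_n + ... + X_n (x) X_0 modulo the next piece of the
    filtration ([grouplikeE]). In this form group-like series are closed under
    products ([grouplikeM]) and under the maps induced by group homomorphisms
    and field extensions ([completed_map_grouplike]).

    This functoriality gives (a) and (c) at once. For (b) the expansions of the
    factors are transported to the product and multiplied: for the direct product
    the factors commute, for the free product one multiplies along words.

    For (d) and (e) let Q = G/N and let e(x) be the image of E(x) in the
    completion for Q. It must be shown that e(x) = 1 for x in N
    ([quotient_Taylor]). Let Y be the derivation that multiplies degree n by n.
    If S is the antipode, then a group-like series u satisfies
    u^-1 Y(u) = (S * Y)(u), and the convolution S * Y is the Dynkin operator,
    which sends a product of n elements g_i - 1 to their iterated bracket
    ([Dynkin]). So dlog x = e(x)^-1 Y(e(x)) is a Lie series: its component of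
    degree n is a combination of classes of y - 1 for y in the n-th term of the
    lower central series of Q ([log_derivative]). In characteristic 0, dlog x = 0
    implies e(x) = 1.

    For N the i-th term of the lower central series, dlog x vanishes in degrees
    at least i since these terms of the lower central series of Q are trivial,
    and in degrees less than i since e(x) - 1 has order at least i ([nilpotent_kernel]). For N the i-th
    derived subgroup one shows, by induction on j, that for x in the j-th derived
    subgroup of G the components of dlog x are combinations of classes of y - 1
    for y in the j-th derived subgroup of Q ([dlog_derived]). Indeed
    dlog (xy) = e(y)^-1 (dlog x) e(y) + dlog y, and conjugation by e(y), for
    dlog y in a Lie algebra M of series, moves an element of M by an element of
    [M, M]; this is read off from the differential equation that the conjugate
    satisfies ([conj_congr]). So dlog is additive modulo [M, M] and kills
    commutators. As the i-th derived subgroup of Q is trivial, dlog x = 0 for x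
    in N ([solvable_kernel]). *)

(** * Linear retractions onto subspaces *)

Section Retraction.
Local Open Scope ring_scope.
Local Open Scope classical_set_scope.
Variables (k : fieldType) (V : lmodType k) (U : submodClosed V).

Let meets_trivially (C : set V) : Prop :=
  (forall c x y, C x -> C y -> C (c *: x + y)) /\
  (forall x, C x -> x \in U -> x = 0).

Let complement_exists : exists C : set V,
  [/\ C 0, meets_trivially C & forall v, exists2 u, u \in U & C (v - u)].
Proof.
have [F FP Ftot|C [[CP CU] Cmax]] := @Zorn_bigcup V meets_trivially.
  split=> [c x y [A FA Ax] [B FB By]|x [A FA Ax] xU]; last exact: (FP _ FA).2.
  have [AB|BA] := Ftot _ _ FA FB.
    by exists B => //; apply: (FP _ FB).1 => //; apply: AB.
  by exists A => //; apply: (FP _ FA).1 => //; apply: BA.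
have C0 : C 0.
  apply: contrapT => nC0; have nC x : ~ C x.
    by move=> Cx; apply: nC0; rewrite -(addNr x) -scaleN1r; apply: CP.
  apply: (Cmax [set 0]).
    by split=> [x /nC|/(_ 0)] //= /(_ erefl) /nC.
  by split=> [c x y -> ->|x -> //]; rewrite scaler0 addr0.
exists C; split=> // v; apply: contrapT => nv.
have Cv : ~ C v by move=> Cv; apply: nv; exists 0; rewrite ?rpred0 ?subr0.
pose B := [set x | exists c, C (x - c *: v)].
apply: (Cmax B).
  split=> [x Cx|/(_ v)]; first by exists 0; rewrite scale0r subr0.
  by move=> BC; apply/Cv/BC; exists 1; rewrite scale1r subrr.
split=> [c x y [a Ca] [b Cb]|x [a Ca] xU].
  exists (c * a + b).
  have -> : c *: x + y - (c * a + b) *: v = c *: (x - a *: v) + (y - b *: v).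
    by rewrite scalerBr scalerA scalerDl opprD addrACA.
  exact: CP.
have [a0|an0] := eqVneq a 0; first by apply: CU xU; rewrite a0 scale0r subr0 in Ca.
case: nv; exists (a^-1 *: x); first by rewrite rpredZ.
have -> : v - a^-1 *: x = - a^-1 *: (x - a *: v) + 0.
  by rewrite scalerBr scalerA mulNr mulVf // scaleNr addr0 scaleN1r opprK addrC.
exact: CP.
Qed.

(** A complement of [U] exists by Zorn's lemma, and the projection along it is
    a linear retraction. *)
Lemma retraction_exists : exists r : {linear V -> V},
  (forall x, r x \in U) /\ (forall x, x \in U -> r x = x).
Proof.
have [C [C0 [CP CU] CV]] := complement_exists.
pose r v := xget 0 [set u | u \in U /\ C (v - u)].
have rP v : r v \in U /\ C (v - r v).
  rewrite /r; case: xgetP => [u _ []//|nu]; have [u uU Cu] := CV v.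
  by case: (nu u).
have rE v u : u \in U -> C (v - u) -> r v = u.
  move=> uU Cu; have [rU Cr] := rP v; apply/eqP; rewrite -subr_eq0; apply/eqP.
  apply: CU; last by rewrite -scaleN1r rpredD ?rpredZ.
  have -> : r v - u = -1 *: (v - r v) + (v - u).
    by rewrite scaleN1r opprB addrA subrK.
  exact: CP.
have rL : linear r.
  move=> c x y; have [[xU Cx] [yU Cy]] := (rP x, rP y).
  apply: rE; first by rewrite rpredD ?rpredZ.
  have -> : c *: x + y - (c *: r x + r y) = c *: (x - r x) + (y - r y).
    by rewrite scalerBr opprD addrACA.
  exact: CP.
pose rM := GRing.isLinear.Build k V V *:%R r rL.
pose rl : {linear V -> V} := HB.pack r rM.
exists rl; split=> x; first exact: (rP x).1.
by move=> xU; apply: rE; rewrite ?subrr.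
Qed.

Definition retraction : V -> V := projT1 (cid retraction_exists).
HB.instance Definition _ :=
  GRing.Linear.copy retraction (projT1 (cid retraction_exists)).

Lemma retraction_in x : retraction x \in U.
Proof. exact: (projT2 (cid retraction_exists)).1. Qed.

Lemma retraction_id x : x \in U -> retraction x = x.
Proof. exact: (projT2 (cid retraction_exists)).2. Qed.

End Retraction.

(** * Tensor products *)

Section TensorUniversal.
Local Open Scope ring_scope.
Variables (k : fieldType).

Record bilinear_map (V W X : lmodType k) := BilinearMap {
  bilin :> V -> W -> X;
  bilin_l : forall w, linear (bilin^~ w);
  bilin_r : forall v, linear (bilin v) }.

Variables (V W X : lmodType k).
Implicit Type b : bilinear_map V W X.

Definition tensor_map b : tensor V W -> X := tensor_lift b.

Let kernel b : {pred {malg k[(V * W)%type]}} :=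
  fun a => linext (fun p : V * W => b p.1 p.2) a == 0.
Fact kernel_submod b : GRing.subsemimod_closed (kernel b).
Proof.
split; [split|] => [|x y /eqP x0 /eqP y0|c x /eqP x0]; apply/eqP.
- exact: linear0.
- by rewrite linearD /= x0 y0 addr0.
- by rewrite linearZ_LR /= x0; apply: scaler0.
Qed.
HB.instance Definition _ b := GRing.isSubmodClosed.Build k _ (kernel b) (kernel_submod b).

Let relations_kernel b a : a \in span (@bilinear_relations k V W) ->
  linext (fun p : V * W => b p.1 p.2) a = 0.
Proof.
move=> aS; suff: a \in kernel b by move/eqP.
apply: span_sub aS => y [|[|[|]]].
- move=> [v [v' [w ->]]]; apply/eqP; rewrite !linearB /= !linextU /=.
  by have := bilin_l b w 1 v v'; rewrite !scale1r => ->; rewrite addrAC addrK subrr.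
- move=> [v [w [w' ->]]]; apply/eqP; rewrite !linearB /= !linextU /=.
  by have := bilin_r b v 1 w w'; rewrite !scale1r => ->; rewrite addrAC addrK subrr.
- move=> [c [v [w ->]]]; apply/eqP; rewrite linearB linearZ_LR /= !linextU /=.
  have b0 : b 0 w = 0.
    by have := bilin_l b w (-1) 0 0; rewrite scaler0 addr0 scaleN1r addNr.
  by have := bilin_l b w c v 0; rewrite addr0 b0 addr0 => ->; rewrite subrr.
- move=> [c [v [w ->]]]; apply/eqP; rewrite linearB linearZ_LR /= !linextU /=.
  have b0 : b v 0 = 0.
    by have := bilin_r b v (-1) 0 0; rewrite scaler0 addr0 scaleN1r addNr.
  by have := bilin_r b v c w 0; rewrite addr0 b0 addr0 => ->; rewrite subrr.
Qed.

Let tensor_map_pi b a :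
  tensor_map b (qm_pi _ a) = linext (fun p : V * W => b p.1 p.2) a.
Proof.
apply/eqP; rewrite -subr_eq0 -linearB; apply/eqP/relations_kernel.
exact: qm_repr.
Qed.

Fact tensor_map_linear b : linear (tensor_map b).
Proof.
move=> c s t; rewrite -[s]qm_reprK -[t]qm_reprK -linearP !tensor_map_pi.
exact: linearP.
Qed.
HB.instance Definition _ b := GRing.isLinear.Build k (tensor V W) X _
  (tensor_map b) (tensor_map_linear b).

Lemma tensor_mapE b v w : tensor_map b (tens v w) = b v w.
Proof. by rewrite tensor_map_pi linextU. Qed.

Lemma tensor_liftE b (g : V -> W -> X) t : (forall v w, g v w = b v w) ->
  tensor_lift g t = tensor_map b t.
Proof. by move=> gb; apply: eq_linext => p; apply: gb. Qed.

Lemma tensor_ind (P : tensor V W -> Prop) :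
  P 0 -> (forall s t, P s -> P t -> P (s + t)) ->
  (forall c t, P t -> P (c *: t)) -> (forall v w, P (tens v w)) ->
  forall t, P t.
Proof.
move=> P0 PD PZ Pt t; suff /asboolP : t \in closed_pred P0 PD PZ by [].
by apply: tensor_span => v w; apply/asboolP.
Qed.

Lemma tensor_ext (f g : {linear tensor V W -> X}) :
  (forall v w, f (tens v w) = g (tens v w)) -> f =1 g.
Proof.
move=> fg; apply: tensor_ind => [|s t sE tE|c t tE|//].
- by rewrite (linear0 f) (linear0 g).
- by rewrite (linearD f) (linearD g) sE tE.
- by rewrite (linearZ_LR f) (linearZ_LR g) /= tE.
Qed.

Lemma tensor_extZD (c : k) (f g h : {linear tensor V W -> X}) :
  (forall v w, f (tens v w) = c *: g (tens v w) + h (tens v w)) ->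
  forall t, f t = c *: g t + h t.
Proof.
move=> fgh; apply: tensor_ind => [|s t sE tE|d t tE|//].
- by rewrite (linear0 f) (linear0 g) (linear0 h) scaler0 addr0.
- by rewrite (linearD f) (linearD g) (linearD h) sE tE scalerDr addrACA.
- rewrite (linearZ_LR f) (linearZ_LR g) (linearZ_LR h) /= tE scalerDr !scalerA.
  by rewrite [d * c]mulrC.
Qed.

Lemma tensZl c v w : tens (c *: v) w = c *: tens v w :> tensor V W.
Proof.
rewrite /tens -linearZ; apply/qm_pi_eq; apply: sub_span.
by right; right; left; exists c, v, w.
Qed.
Lemma tensZr c v w : tens v (c *: w) = c *: tens v w :> tensor V W.
Proof.
rewrite /tens -linearZ; apply/qm_pi_eq; apply: sub_span.
by right; right; right; exists c, v, w.
Qed.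
Lemma tensDl v v' w : tens (v + v') w = tens v w + tens v' w :> tensor V W.
Proof.
rewrite /tens -linearD; apply/qm_pi_eq; rewrite opprD addrA.
by apply: sub_span; left; exists v, v', w.
Qed.
Lemma tensDr v w w' : tens v (w + w') = tens v w + tens v w' :> tensor V W.
Proof.
rewrite /tens -linearD; apply/qm_pi_eq; rewrite opprD addrA.
by apply: sub_span; right; left; exists v, w, w'.
Qed.

Lemma tens_linear_l w : linear ((@tens k V W)^~ w).
Proof. by move=> c v v'; rewrite tensDl tensZl. Qed.
Lemma tens_linear_r v : linear (@tens k V W v).
Proof. by move=> c w w'; rewrite tensDr tensZr. Qed.

Lemma tens0l w : tens 0 w = 0 :> tensor V W.
Proof. by rewrite -[0](scale0r 0) tensZl scale0r. Qed.
Lemma tens0r v : tens v 0 = 0 :> tensor V W.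
Proof. by rewrite -[X in tens v X](scale0r 0) tensZr scale0r. Qed.
Lemma tensBl v v' w : tens (v - v') w = tens v w - tens v' w :> tensor V W.
Proof. by rewrite -scaleN1r tensDl tensZl scaleN1r. Qed.
Lemma tensBr v w w' : tens v (w - w') = tens v w - tens v w' :> tensor V W.
Proof. by rewrite -scaleN1r tensDr tensZr scaleN1r. Qed.

Lemma tens_suml (I : Type) (r : seq I) (f : I -> V) w :
  tens (\sum_(i <- r) f i) w = \sum_(i <- r) tens (f i) w :> tensor V W.
Proof.
elim: r => [|i r IH]; first by rewrite !big_nil tens0l.
by rewrite !big_cons tensDl IH.
Qed.
Lemma tens_sumr (I : Type) (r : seq I) (f : I -> W) v :
  tens v (\sum_(i <- r) f i) = \sum_(i <- r) tens v (f i) :> tensor V W.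
Proof.
elim: r => [|i r IH]; first by rewrite !big_nil tens0r.
by rewrite !big_cons tensDr IH.
Qed.

End TensorUniversal.

Section TensorFunctoriality.
Local Open Scope ring_scope.
Variables (k : fieldType) (V W V' W' : lmodType k).
Variables (f : {linear V -> V'}) (g : {linear W -> W'}).

Let tens2 (v : V) (w : W) : tensor V' W' := tens (f v) (g w).
Fact tens2_l w : linear (tens2^~ w).
Proof. by move=> c v v'; rewrite /tens2 linearP tens_linear_l. Qed.
Fact tens2_r v : linear (tens2 v).
Proof. by move=> c w w'; rewrite /tens2 linearP tens_linear_r. Qed.

Definition tensor_hom := tensor_map (BilinearMap tens2_l tens2_r).
HB.instance Definition _ := GRing.Linear.on tensor_hom.

Lemma tensor_homE v w : tensor_hom (tens v w) = tens (f v) (g w).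
Proof. exact: tensor_mapE. Qed.

End TensorFunctoriality.

(** * Filtered spaces and their graded quotients *)

Section FiltrationTheory.
Local Open Scope ring_scope.
Variables (k : fieldType) (V : lmodType k) (F : filtration V).

Lemma fil_le m n x : (m <= n)%N -> x \in F n -> x \in F m.
Proof.
move=> /subnKC <-; elim: (n - m)%N => [|d IH]; first by rewrite addn0.
by rewrite addnS => /filS.
Qed.

Lemma fil_sym n x y : x - y \in F n -> y - x \in F n.
Proof. by move=> xy; rewrite -opprB -scaleN1r rpredZ. Qed.

Lemma filB n x y : x \in F n -> y \in F n -> x - y \in F n.
Proof. by move=> xF yF; rewrite -scaleN1r rpredD ?rpredZ. Qed.

Lemma fil_trans n x y z : x - y \in F n -> y - z \in F n -> x - z \in F n.
Proof. by move=> xy yz; rewrite -(subrKA y) rpredD. Qed.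

Lemma filD_congr n x x' y y' : x - x' \in F n -> y - y' \in F n ->
  x + y - (x' + y') \in F n.
Proof. by move=> xF yF; rewrite opprD addrACA rpredD. Qed.

Lemma filB_congr n x x' y y' : x - x' \in F n -> y - y' \in F n ->
  x - y - (x' - y') \in F n.
Proof. by move=> xF yF; rewrite opprD addrACA -opprD filB. Qed.

Lemma gr_class_congr n x y : x \in F n -> x - y \in F n.+1 ->
  gr_class F n x = gr_class F n y.
Proof.
move=> xF xy; apply/gr_class_eq => //.
by rewrite -[y](subKr x) filB // (filS xy).
Qed.

Lemma gr_class_next n x : x \in F n.+1 -> gr_class F n x = 0.
Proof.
move=> xF; rewrite (gr_class_congr (filS xF) (y := 0)) ?gr_class0 //.
by rewrite subr0.
Qed.

Lemma gr_classD n x y : x \in F n -> y \in F n ->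
  gr_class F n (x + y) = gr_class F n x + gr_class F n y.
Proof. by move=> xF yF; rewrite -[x]scale1r gr_classZD // !scale1r. Qed.

Lemma gr_classZ n c x : x \in F n -> gr_class F n (c *: x) = c *: gr_class F n x.
Proof.
by move=> xF; rewrite -[c *: x]addr0 gr_classZD ?rpred0 // gr_class0 addr0.
Qed.

Lemma gr_class_sum (I : Type) (r : seq I) n (f : I -> V) :
  (forall i, f i \in F n) ->
  gr_class F n (\sum_(i <- r) f i) = \sum_(i <- r) gr_class F n (f i).
Proof.
move=> fF; elim: r => [|i r IH]; first by rewrite !big_nil gr_class0.
by rewrite !big_cons gr_classD ?IH // rpred_sum.
Qed.

Lemma gr_liftZD n c (u v : gr F n) :
  gr_lift (c *: u + v) - (c *: gr_lift u + gr_lift v) \in F n.+1.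
Proof.
apply/gr_class_eq; rewrite ?rpredD ?rpredZ ?gr_lift_fil //.
by rewrite gr_classZD ?gr_lift_fil ?gr_liftK.
Qed.

Lemma gr_lift0 n : gr_lift (0 : gr F n) \in F n.+1.
Proof.
by rewrite -[gr_lift _]subr0 -(gr_class0 F n); apply: gr_classK; apply: rpred0.
Qed.

(** The map [gr_class F n] is linear on F n only; the retraction extends it to
    a linear map on the whole space. *)
Definition gr_proj n (x : V) : gr F n := gr_class F n (retraction (F n) x).
Fact gr_proj_linear n : linear (gr_proj n).
Proof. by move=> c x y; rewrite /gr_proj linearP gr_classZD ?retraction_in. Qed.
HB.instance Definition _ n := GRing.isLinear.Build k V (gr F n) _
  (gr_proj n) (gr_proj_linear n).

Lemma gr_projE n x : x \in F n -> gr_proj n x = gr_class F n x.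
Proof. by move=> xF; rewrite /gr_proj retraction_id. Qed.

Lemma gr_proj_next n x : x \in F n.+1 -> gr_proj n x = 0.
Proof. by move=> xF; rewrite gr_projE ?gr_class_next //; apply: filS. Qed.

End FiltrationTheory.

(** * The graded quotients of a tensor product *)

Section TensorFiltration.
Local Open Scope ring_scope.
Variables (k : fieldType) (V W : lmodType k).
Variables (F : filtration V) (F' : filtration W).
Local Notation T := (tfil F F').

Lemma tens_fil i j v w : v \in F i -> w \in F' j -> tens v w \in T (i + j)%N.
Proof. by move=> vF wF; apply: sub_span; exists i, j, v, w. Qed.

Lemma tens_fil_le n i j v w : (n <= i + j)%N -> v \in F i -> w \in F' j ->
  tens v w \in T n.
Proof. by move=> leij vF wF; apply: (fil_le leij); apply: tens_fil. Qed.

Lemma tfil_ind n (P : tensor V W -> Prop) :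
  P 0 -> (forall s t, P s -> P t -> P (s + t)) ->
  (forall c t, P t -> P (c *: t)) ->
  (forall i j v w, (i + j = n)%N -> v \in F i -> w \in F' j -> P (tens v w)) ->
  forall t, t \in T n -> P t.
Proof.
move=> P0 PD PZ Pt; apply: span_ind => // _ [i [j [v [w [ijn vF wF ->]]]]].
exact: Pt ijn vF wF.
Qed.

Lemma tens_congr i j v v' w w' : v \in F i -> w' \in F' j ->
  v - v' \in F i.+1 -> w - w' \in F' j.+1 ->
  tens v w - tens v' w' \in T (i + j).+1.
Proof.
move=> vF wF dv dw; rewrite -(subrKA (tens v w')) -tensBr -tensBl rpredD //.
  by apply: (tens_fil_le _ vF dw); rewrite addnS.
by apply: (tens_fil_le _ dv wF); rewrite addSn.
Qed.

Lemma tfil_map n (X : lmodType k) (U : submodClosed X)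
    (f : {linear tensor V W -> X}) :
  (forall i j v w, (i + j = n)%N -> v \in F i -> w \in F' j ->
     f (tens v w) \in U) ->
  forall t, t \in T n -> f t \in U.
Proof.
move=> fU; apply: tfil_ind fU => [|s t sU tU|c t tU].
- by rewrite linear0 rpred0.
- by rewrite linearD rpredD.
- by rewrite linearZ_LR rpredZ.
Qed.

Lemma tfil_map0 n (X : lmodType k) (f : {linear tensor V W -> X}) :
  (forall i j v w, (i + j = n)%N -> v \in F i -> w \in F' j ->
     f (tens v w) = 0) ->
  forall t, t \in T n -> f t = 0.
Proof.
move=> f0; apply: tfil_ind f0 => [|s t s0 t0|c t t0].
- by rewrite linear0.
- by rewrite linearD s0 t0 addr0.
- by rewrite linearZ_LR t0 scaler0.
Qed.

Definition component i j := tensor_hom (gr_proj F i) (gr_proj F' j).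
HB.instance Definition _ i j := GRing.Linear.on (component i j).

Let component_tens i j v w :
  component i j (tens v w) = tens (gr_proj F i v) (gr_proj F' j w).
Proof. exact: tensor_homE. Qed.

Let component_next n i j t : (i + j < n)%N -> t \in T n -> component i j t = 0.
Proof.
move=> ltn; apply: tfil_map0 => a b v w abn vF wF.
rewrite -[LHS]/(component i j (tens v w)) component_tens; have [ltia|leai] := ltnP i a.
  by rewrite gr_proj_next ?tens0l // (fil_le ltia).
rewrite [X in tens _ X]gr_proj_next ?tens0r // (fil_le _ wF) //.
by rewrite -(ltn_add2l i) (leq_trans ltn) // -abn leq_add2r.
Qed.

Let inject i j n (u : gr F i) (u' : gr F' j) : gr T n :=
  gr_proj T n (tens (gr_lift u) (gr_lift u')).

Let inject_l i j n (ijn : (i + j = n)%N) u' : linear ((@inject i j n)^~ u').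
Proof.
move=> c u v; rewrite /inject -linearP -tensZl -tensDl.
apply/eqP; rewrite -subr_eq0 -linearB /= -tensBl gr_proj_next //.
rewrite -ijn -addSn; apply: tens_fil (gr_liftZD _ _ _) (gr_lift_fil _).
Qed.
Let inject_r i j n (ijn : (i + j = n)%N) u : linear (@inject i j n u).
Proof.
move=> c v w; rewrite /inject -linearP -tensZr -tensDr.
apply/eqP; rewrite -subr_eq0 -linearB /= -tensBr gr_proj_next //.
rewrite -ijn -addnS; apply: tens_fil (gr_lift_fil _) (gr_liftZD _ _ _).
Qed.
Definition inject_map i j n (ijn : (i + j = n)%N) :=
  tensor_map (BilinearMap (inject_l ijn) (inject_r ijn)).
HB.instance Definition _ i j n (ijn : (i + j = n)%N) :=
  GRing.Linear.on (inject_map ijn).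

Let inject_tens i j n (ijn : (i + j = n)%N) u u' :
  inject_map ijn (tens u u') = gr_class T n (tens (gr_lift u) (gr_lift u')).
Proof.
rewrite /inject_map tensor_mapE /= /inject gr_projE //.
by rewrite -ijn; apply: tens_fil; apply: gr_lift_fil.
Qed.

Let ctensor_cgrE t n : ctensor_cgr t n =
  \sum_(i < n.+1) inject_map (subnKC (leq_ord i)) (t i (n - i)%N).
Proof.
apply: eq_bigr => i _; apply: tensor_liftE => u u' /=; rewrite /inject.
rewrite gr_projE // -[n in T n](subnKC (leq_ord i)).
by apply: tens_fil; apply: gr_lift_fil.
Qed.

Definition gr_component i j n (ijn : (i + j = n)%N) (x : gr T n) :=
  component i j (gr_lift x).
Fact gr_component_linear i j n (ijn : (i + j = n)%N) :
  linear (gr_component ijn).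
Proof.
move=> c x y; apply/eqP; rewrite -linearP -subr_eq0 -linearB /=.
by rewrite (component_next _ (gr_liftZD c x y)) // ijn.
Qed.
HB.instance Definition _ i j n (ijn : (i + j = n)%N) :=
  GRing.isLinear.Build k _ _ _ _ (gr_component_linear ijn).

Let component_inject i j n (ijn : (i + j = n)%N) a b (abn : (a + b = n)%N) u u' :
  gr_component ijn (inject_map abn (tens u u')) =
  tens (gr_proj F i (gr_lift u)) (gr_proj F' j (gr_lift u')).
Proof.
rewrite /gr_component inject_tens -component_tens; apply/eqP.
rewrite -subr_eq0 -linearB /= (@component_next n.+1) ?ijn //; apply: gr_classK.
by rewrite -abn; apply: tens_fil; apply: gr_lift_fil.
Qed.

Let component_diag i j n (ijn ijn' : (i + j = n)%N) t :
  gr_component ijn (inject_map ijn' t) = t.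
Proof.
pose f : {linear _ -> _} := gr_component ijn \o inject_map ijn.
rewrite -[LHS]/(f t) -[RHS]/(idfun t); move: t.
apply: (tensor_ext (f := f) (g := idfun)) => u u'.
rewrite -[LHS]/(gr_component ijn (inject_map ijn' (tens u u'))) component_inject.
by rewrite !gr_projE ?gr_lift_fil ?gr_liftK.
Qed.

Let component_off i j n (ijn : (i + j = n)%N) a b (abn : (a + b = n)%N) t :
  a != i -> gr_component ijn (inject_map abn t) = 0.
Proof.
move=> nai.
pose f : {linear _ -> _} := gr_component ijn \o inject_map abn.
rewrite -[LHS]/(f t); move: t; apply: (tensor_ext (f := f) (g := \0)) => u u'.
rewrite -[LHS]/(gr_component ijn (inject_map abn (tens u u'))) component_inject.
rewrite -[RHS]/0; have [ltia|ltai|aEi] := ltngtP i a.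
- by rewrite gr_proj_next ?tens0l // (fil_le ltia) ?gr_lift_fil.
- rewrite [X in tens _ X]gr_proj_next ?tens0r //.
  apply: (fil_le _ (gr_lift_fil u')).
  by rewrite -(ltn_add2l i) ijn -abn ltn_add2r.
- by rewrite aEi eqxx in nai.
Qed.

Lemma ctensor_cgr_ctens (x : cgr F) (y : cgr F') n :
  ctensor_cgr (ctens x y) n =
  gr_class T n (\sum_(i < n.+1) tens (gr_lift (x i)) (gr_lift (y (n - i)%N))).
Proof.
rewrite ctensor_cgrE gr_class_sum => [|i].
  by apply: eq_bigr => i _; apply: inject_tens.
by rewrite -[n in T n](subnKC (leq_ord i)); apply: tens_fil; apply: gr_lift_fil.
Qed.

(** The linear maps [component i j] separate the components: such a map kills
    the tensor product of the pieces a and b for a + b = i + j unless a = i, and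
    it kills the next piece of the filtration of the tensor product. *)
Lemma ctensor_cgr_inj : injective (@ctensor_cgr k V W F F').
Proof.
have compE t i n (lein : (i <= n)%N) :
    gr_component (subnKC lein) (ctensor_cgr t n) = t i (n - i)%N.
  rewrite ctensor_cgrE (linear_sum (gr_component (subnKC lein))).
  rewrite (bigD1 (Ordinal (lein : (i < n.+1)%N))) //=.
  rewrite component_diag big1 ?addr0 // => a nai.
  exact: (component_off (subnKC lein) (subnKC (leq_ord a)) (t a (n - a)%N) nai).
move=> t t' tt'.
apply: functional_extensionality_dep => i; apply: functional_extensionality_dep => j.
have := compE t i _ (leq_addr j i); rewrite tt' compE addKn.
by move=> ->.
Qed.

(** In each degree the n-th piece of the tensor product is spanned by the
    tensors of elements of complementary degrees, which come from a single
    component. *)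
Lemma ctensor_cgr_surj x : exists t, ctensor_cgr (F := F) (F' := F') t = x.
Proof.
have xP n : exists s : ctensor F F',
    \sum_(i < n.+1) inject_map (subnKC (leq_ord i)) (s i (n - i)%N) = x n.
  rewrite -[x n]gr_liftK.
  pose P z := z \in T n /\ exists s : ctensor F F',
    \sum_(i < n.+1) inject_map (subnKC (leq_ord i)) (s i (n - i)%N) =
    gr_class T n z.
  suff: P (gr_lift (x n)) by case.
  apply: tfil_ind (gr_lift_fil (x n)) => [|z z' [zT [s sE]] [zT' [s' sE']]||].
  - split; first exact: rpred0.
    by exists (fun _ _ => 0); rewrite gr_class0 big1 // => i _; rewrite linear0.
  - split; first by rewrite rpredD.
    exists (fun i j => s i j + s' i j); rewrite gr_classD // -sE -sE' -big_split.
    by apply: eq_bigr => i _; rewrite linearD.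
  - move=> c z [zT [s sE]]; split; first by rewrite rpredZ.
    exists (fun i j => c *: s i j); rewrite gr_classZ // -sE scaler_sumr.
    by apply: eq_bigr => i _; rewrite linearZ_LR.
  move=> a b v w abn vF wF; split; first by rewrite -abn tens_fil.
  exists (fun i j => if i == a then tens (gr_class F i v) (gr_class F' j w) else 0).
  have lta : (a < n.+1)%N by rewrite ltnS -abn leq_addr.
  rewrite (bigD1 (Ordinal lta)) //= big1 => [|i /negPf ia]; last first.
    by rewrite (_ : (i == a :> nat) = false) ?linear0.
  rewrite addr0 eqxx inject_tens; have bE : (n - a)%N = b by rewrite -abn addKn.
  apply: gr_class_congr.
    rewrite -[n in T n](subnKC (lta : (a <= n)%N)).
    by apply: tens_fil; apply: gr_lift_fil.
  rewrite -[n in T n.+1](subnKC (lta : (a <= n)%N)); apply: tens_congr.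
  - exact: gr_lift_fil.
  - by rewrite bE.
  - exact: gr_classK.
  - by apply: gr_classK; rewrite bE.
have [s sP] := choice xP.
exists (fun i j => s (i + j)%N i j).
apply: functional_extensionality_dep => n; rewrite ctensor_cgrE -sP.
by apply: eq_bigr => i _; rewrite subnKC ?leq_ord.
Qed.

Lemma cgr_ctensorE (x : cgr T) (t : ctensor F F') :
  cgr_ctensor x = t <-> x = ctensor_cgr t.
Proof.
rewrite /cgr_ctensor; case: xgetP => [s _ /= <-|nx].
  by split=> [->//|/ctensor_cgr_inj].
by have [s sE] := ctensor_cgr_surj x; case: (nx s).
Qed.

End TensorFiltration.

(** * The completed graded algebra *)

Section CompletedGradedAlgebra.
Local Open Scope ring_scope.
Variables (k : fieldType) (A : algType k) (F : alg_filtration A).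
Implicit Types (x y z : cgra F) (X Y : nat -> A).

Lemma cgraDE x y n : (x + y) n = x n + y n. Proof. by []. Qed.
Lemma cgraNE x n : (- x) n = - x n. Proof. by []. Qed.
Lemma cgraZE c x n : (c *: x) n = c *: x n. Proof. by []. Qed.
Lemma cgra1E0 : (1 : cgra F) 0%N = gr_class F 0 1. Proof. by []. Qed.
Lemma cgra1ES n : (1 : cgra F) n.+1 = 0. Proof. by []. Qed.

(** Identities in the completion are checked on such sequences in A, degree by
    degree and modulo the next piece of the filtration. *)
Definition lifts X x := forall n, X n \in F n /\ x n = gr_class F n (X n).

Lemma gr_lift_lifts x : lifts (fun n => gr_lift (x n)) x.
Proof. by move=> n; rewrite gr_lift_fil gr_liftK. Qed.

Lemma lifts_congr X x n : lifts X x -> gr_lift (x n) - X n \in F n.+1.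
Proof. by move=> /(_ n)[XF ->]; apply: gr_classK. Qed.

Lemma lifts_inj X Y x y : lifts X x -> lifts Y y ->
  (forall n, X n - Y n \in F n.+1) -> x = y.
Proof.
move=> Xx Yy XY; apply: cgrP => n; have [XF ->] := Xx n; have [_ ->] := Yy n.
exact: gr_class_congr.
Qed.

Lemma filM_congr i j a a' b b' : a \in F i -> b' \in F j ->
  a - a' \in F i.+1 -> b - b' \in F j.+1 -> a * b - a' * b' \in F (i + j)%N.+1.
Proof.
move=> aF bF da db; rewrite -(subrKA (a * b')) -mulrBr -mulrBl rpredD //.
  by rewrite -addnS; apply: afilM.
by rewrite -addSn; apply: (@afilM k A F i.+1 j).
Qed.

Definition convolution X Y n := \sum_(i < n.+1) X i * Y (n - i)%N.

Lemma lifts_mul X Y x y : lifts X x -> lifts Y y ->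
  lifts (convolution X Y) (x * y).
Proof.
move=> Xx Yy n; have XYF Z T z t : lifts Z z -> lifts T t ->
    \sum_(i < n.+1) Z i * T (n - i)%N \in F n.
  move=> Zz Tt; apply: rpred_sum => i _; rewrite -[n in F n](subnKC (leq_ord i)).
  by apply: afilM; [case: (Zz i)|case: (Tt (n - i)%N)].
split; first exact: XYF Xx Yy.
apply: gr_class_congr; first exact: XYF (gr_lift_lifts x) (gr_lift_lifts y).
rewrite -sumrB; apply: rpred_sum => i _.
rewrite -[n in F n.+1](subnKC (leq_ord i)); apply: filM_congr.
- exact: gr_lift_fil.
- by case: (Yy (n - i)%N).
- exact: lifts_congr.
- exact: lifts_congr.
Qed.

Lemma lifts1 : lifts (fun n => if n is 0 then 1 else 0) 1.
Proof. by case=> [|n]; rewrite ?fil0 ?rpred0 ?gr_class0. Qed.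

Lemma liftsD X Y x y : lifts X x -> lifts Y y ->
  lifts (fun n => X n + Y n) (x + y).
Proof.
move=> Xx Yy n; have [[XF xE] [YF yE]] := (Xx n, Yy n).
by rewrite rpredD // cgraDE xE yE gr_classD.
Qed.

Lemma liftsZ c X x : lifts X x -> lifts (fun n => c *: X n) (c *: x).
Proof.
by move=> Xx n; have [XF xE] := Xx n; rewrite rpredZ // cgraZE xE gr_classZ.
Qed.

Lemma cfilP n x : x \in cfil F n <-> forall j, (j < n)%N -> x j = 0.
Proof. by split=> [/asboolP|/asboolP]. Qed.

Lemma cfil_lifts n x : x \in cfil F n ->
  lifts (fun j => if (j < n)%N then 0 else gr_lift (x j)) x.
Proof.
move=> /cfilP x0 j; case: ifP => [/x0 ->|_]; first by rewrite rpred0 gr_class0.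
exact: gr_lift_lifts.
Qed.

Lemma cfilM n m x y : x \in cfil F n -> y \in cfil F m ->
  x * y \in cfil F (n + m)%N /\
  (x * y) (n + m)%N = gr_class F (n + m) (gr_lift (x n) * gr_lift (y m)).
Proof.
move=> xF yF; have xyE := lifts_mul (cfil_lifts xF) (cfil_lifts yF).
split=> [|].
  apply/cfilP => j ltj; rewrite (xyE j).2 /convolution big1 ?gr_class0 // => i _.
  case: ifP => [_|/negbT]; first by rewrite mul0r.
  rewrite -leqNgt => leni; rewrite ifT ?mulr0 //.
  rewrite ltn_subLR ?leq_ord //; apply: leq_trans ltj _.
  by rewrite leq_add2r.
have ltn : (n < (n + m).+1)%N by rewrite ltnS leq_addr.
rewrite (xyE (n + m)%N).2 /convolution (bigD1 (Ordinal ltn)) //= addKn !ltnn.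
rewrite big1 ?addr0 // => i ni.
have [lti|lein] := ltnP; first by rewrite mul0r.
rewrite ifT ?mulr0 // ltn_subLR ?leq_ord // ltn_add2r ltn_neqAle lein andbT.
by rewrite eq_sym.
Qed.

Lemma cfilMl n x y : y \in cfil F n -> x * y \in cfil F n.
Proof. by move=> yF; case: (cfilM (cfil_fil0 x) yF). Qed.

Lemma cfilMr n x y : x \in cfil F n -> x * y \in cfil F n.
Proof. by move=> xF; case: (cfilM xF (cfil_fil0 y)); rewrite addn0. Qed.

Lemma cfilM_class n m x y a b : x \in cfil F n -> y \in cfil F m ->
  a \in F n -> b \in F m -> x n = gr_class F n a -> y m = gr_class F m b ->
  (x * y) (n + m)%N = gr_class F (n + m) (a * b).
Proof.
move=> xF yF aF bF xa yb; have [_ ->] := cfilM xF yF.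
rewrite xa yb; apply: gr_class_congr; first by apply: afilM; apply: gr_lift_fil.
by apply: filM_congr; rewrite ?gr_lift_fil ?gr_classK.
Qed.

End CompletedGradedAlgebra.

(** * The tensor square of an algebra *)

Section ConvolutionSums.
Local Open Scope ring_scope.
Variable V : nmodType.

Lemma convolution_sumE N m (g : nat -> nat -> V) : (m < N)%N ->
  \sum_(i < m.+1) g i (m - i)%N =
  \sum_(i < N) \sum_(j < N | (i + j == m)%N) g i j.
Proof.
move=> ltmN; rewrite (big_ord_widen N (fun i => g i (m - i)%N)) //.
rewrite big_mkcond; apply: eq_bigr => i _; case: ifP => [leim|/negbT gtim].
  have ltN : (m - i < N)%N by apply: leq_ltn_trans ltmN; apply: leq_subr.
  rewrite (big_pred1 (Ordinal ltN)) // => j /=.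
  by rewrite -val_eqE /= -[in RHS](eqn_add2l i) subnKC.
rewrite big_pred0 // => j; apply/negbTE; apply: contra gtim => /eqP <-.
by rewrite ltnS leq_addr.
Qed.

(** Both sides sum f over the decompositions n = a + c + b + d. *)
Lemma convolution_sum_interchange n (f : nat -> nat -> nat -> nat -> V) :
  \sum_(i < n.+1) \sum_(a < i.+1) \sum_(b < (n - i).+1)
     f a (i - a)%N b (n - i - b)%N =
  \sum_(m < n.+1) \sum_(a < m.+1) \sum_(c < (n - m).+1)
     f a c (m - a)%N (n - m - c)%N.
Proof.
pose N := n.+1.
pose total (p q r s : 'I_N) := (p + q + r + s == n)%N.
have quad (h : nat -> nat -> nat -> nat -> V) :
  \sum_(i < n.+1) \sum_(a < i.+1) \sum_(b < (n - i).+1)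
     h a (i - a)%N b (n - i - b)%N =
  \sum_(p < N) \sum_(q < N) \sum_(r < N) \sum_(s < N | total p q r s) h p q r s.
  transitivity (\sum_(i < N) \sum_(p < N) \sum_(q < N | (p + q == i)%N)
      \sum_(r < N) \sum_(s < N | total p q r s) h p q r s).
    apply: eq_bigr => i _; rewrite -(@convolution_sumE N i (fun p q =>
      \sum_(r < N) \sum_(s < N | (p + q + r + s == n)%N) h p q r s)) //.
    apply: eq_bigr => a _; rewrite subnKC ?leq_ord //.
    rewrite (@convolution_sumE N (n - i) (fun r s => h a (i - a)%N r s)) //;
      last by rewrite ltnS leq_subr.
    apply: eq_bigr => r _; apply: eq_bigl => s.
    by rewrite -[LHS](eqn_add2l i) subnKC ?leq_ord // addnA.
  rewrite exchange_big /=; apply: eq_bigr => p _.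
  under eq_bigr do rewrite big_mkcond /=.
  rewrite exchange_big /=; apply: eq_bigr => q _; rewrite -big_mkcond /=.
  have [ltpq|lepq] := ltnP (p + q) N.
    by rewrite (big_pred1 (Ordinal ltpq)) // => i; rewrite -val_eqE /= eq_sym.
  rewrite big_pred0 => [|i]; last first.
    by apply/negbTE; rewrite neq_ltn (leq_trans (ltn_ord i) lepq) orbT.
  symmetry; apply: big1 => r _; apply: big_pred0 => s; apply/negbTE.
  by rewrite neq_ltn (leq_trans lepq) ?orbT // -addnA leq_addr.
rewrite quad (quad (fun a b c d => f a c b d)); apply: eq_bigr => p _.
rewrite exchange_big /=; apply: eq_bigr => q _; apply: eq_bigr => r _.
by apply: eq_bigl => s; rewrite /total [(p + r + q)%N]addnAC.
Qed.

End ConvolutionSums.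

Section TensorSquare.
Local Open Scope ring_scope.
Variables (k : fieldType) (A : algType k).

Definition rmul (a : A) (x : A) : A := x * a.
Fact rmul_linear a : linear (rmul a).
Proof. by move=> c x y; rewrite /rmul mulrDl scalerAl. Qed.
HB.instance Definition _ a := GRing.isLinear.Build k A A _ (rmul a) (rmul_linear a).

Definition lmul (a : A) (x : A) : A := a * x.
Fact lmul_linear a : linear (lmul a).
Proof. by move=> c x y; rewrite /lmul mulrDr scalerAr. Qed.
HB.instance Definition _ a := GRing.isLinear.Build k A A _ (lmul a) (lmul_linear a).

(** The product of the algebra A (x) A: right multiplication by c (x) d is the
    tensor product of two right multiplications, and it is bilinear in c and d. *)
Let tmul_raw (s : tensor A A) (c d : A) : tensor A A :=
  tensor_hom (rmul c) (rmul d) s.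
Fact tmul_l s d : linear ((tmul_raw s)^~ d).
Proof.
move=> c x y; move: s; apply: (tensor_extZD (f := tensor_hom _ _)) => v w.
rewrite /= !tensor_homE -tensZl -tensDl; congr tens.
by rewrite -[LHS]/(v * (c *: x + y)) mulrDr -scalerAr.
Qed.
Fact tmul_r s c : linear (tmul_raw s c).
Proof.
move=> e x y; move: s; apply: (tensor_extZD (f := tensor_hom _ _)) => v w.
rewrite /= !tensor_homE -tensZr -tensDr; congr tens.
by rewrite -[LHS]/(w * (e *: x + y)) mulrDr -scalerAr.
Qed.
Definition tmul s := tensor_map (BilinearMap (tmul_l s) (tmul_r s)).
HB.instance Definition _ s := GRing.Linear.on (tmul s).

Lemma tmulE a b c d : tmul (tens a b) (tens c d) = tens (a * c) (b * d).
Proof. by rewrite /tmul tensor_mapE /= /tmul_raw tensor_homE. Qed.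

Lemma tmul_tens s c d : tmul s (tens c d) = tensor_hom (rmul c) (rmul d) s.
Proof. exact: tensor_mapE. Qed.

Lemma tmul_linear_l t : linear (tmul^~ t).
Proof.
move=> e s s'; move: t; apply: (tensor_extZD (f := tmul _)) => c d.
by rewrite /= !tmul_tens linearP.
Qed.

Lemma tmulBl s s' t : tmul (s - s') t = tmul s t - tmul s' t.
Proof.
have := tmul_linear_l t (-1) s' s; rewrite /= !scaleN1r (addrC (- s')) => ->.
exact: addrC.
Qed.

Lemma tmul_suml (I : Type) (r : seq I) (f : I -> tensor A A) t :
  tmul (\sum_(i <- r) f i) t = \sum_(i <- r) tmul (f i) t.
Proof.
have D s s' : tmul (s + s') t = tmul s t + tmul s' t.
  by rewrite -[s]scale1r tmul_linear_l !scale1r.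
elim: r => [|i r IH]; last by rewrite !big_cons D IH.
by rewrite !big_nil; apply: (addrI (tmul 0 t)); rewrite -D !addr0.
Qed.

Lemma tmul_sumr (I : Type) (r : seq I) (f : I -> tensor A A) s :
  tmul s (\sum_(i <- r) f i) = \sum_(i <- r) tmul s (f i).
Proof. exact: (linear_sum (tmul s)). Qed.

Lemma tmulBr s t t' : tmul s (t - t') = tmul s t - tmul s t'.
Proof. exact: (linearB (tmul s)). Qed.

Variable F : alg_filtration A.
Local Notation T := (tfil F F).

Lemma tmul_fil m n s t : s \in T m -> t \in T n -> tmul s t \in T (m + n)%N.
Proof.
move=> sT; apply: tfil_map => c d v w cdn vF wF.
rewrite -[X in X \in _]/(tmul s (tens v w)) tmul_tens; move: s sT.
apply: tfil_map => a b v' w' abm vF' wF'.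
rewrite -[X in X \in _]/(tensor_hom (rmul v) (rmul w) (tens v' w')) tensor_homE.
rewrite /rmul -abm -cdn addnACA; apply: tens_fil; exact: afilM.
Qed.

End TensorSquare.


(** * Group algebras and group-like series *)

Section FilteredGroupAlgebra.
Local Open Scope ring_scope.
Variables (k : fieldType) (G : groupType).

(** The group algebra of G with its augmentation filtration, known through its
    universal properties: it is free on G as a vector space, and its n-th piece
    is spanned by the products with n factors of the form g - 1. *)
Record filtered_group_algebra := FilteredGroupAlgebra {
  fga :> algType k;
  fga_fil : alg_filtration fga;
  gel : G -> fga;
  gel1 : gel 1%g = 1;
  gelM : forall g h, gel g * gel h = gel (g * h)%g;
  gext : forall X : lmodType k, (G -> X) -> {linear fga -> X};
  gextE : forall (X : lmodType k) (f : G -> X) g, gext f (gel g) = f g;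
  fga_ind : forall P : fga -> Prop, P 0 ->
    (forall a b, P a -> P b -> P (a + b)) ->
    (forall c a, P a -> P (c *: a)) -> (forall g, P (gel g)) -> forall a, P a;
  gel_sub1 : forall g, gel g - 1 \in fga_fil 1%N;
  fga_fil_ind : forall n (P : fga -> Prop), P 0 ->
    (forall a b, P a -> P b -> P (a + b)) ->
    (forall c a, P a -> P (c *: a)) ->
    (forall a g, a \in fga_fil n -> P (a * (gel g - 1))) ->
    forall a, a \in fga_fil n.+1 -> P a }.

End FilteredGroupAlgebra.
Arguments gel {k G} _ _.
Arguments gext {k G} _ {X} _.

Section GroupAlgebraTheory.
Local Open Scope ring_scope.
Variables (k : fieldType) (G : groupType) (A : filtered_group_algebra k G).
Local Notation I := (fga_fil A).
Local Notation T := (tfil I I).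
Local Notation gel := (gel A).

Lemma fga_ext (X : lmodType k) (f g : {linear A -> X}) :
  (forall x, f (gel x) = g (gel x)) -> f =1 g.
Proof.
move=> fg; apply: fga_ind => [|a b aE bE|c a aE|//].
- by rewrite (linear0 f) (linear0 g).
- by rewrite (linearD f) (linearD g) aE bE.
- by rewrite (linearZ_LR f) (linearZ_LR g) /= aE.
Qed.

Definition Delta : {linear A -> tensor A A} :=
  gext A (fun g => tens (gel g) (gel g)).

Lemma Delta_gel g : Delta (gel g) = tens (gel g) (gel g).
Proof. exact: gextE. Qed.

Lemma DeltaM a b : Delta (a * b) = tmul (Delta a) (Delta b).
Proof.
pose f : {linear A -> tensor A A} := Delta \o lmul a.
pose f' : {linear A -> tensor A A} := tmul (Delta a) \o Delta.
rewrite -[LHS]/(f b) -[RHS]/(f' b); move: b; apply: fga_ext => g.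
pose h : {linear A -> tensor A A} := Delta \o rmul (gel g).
pose h' : {linear A -> tensor A A} :=
  tensor_hom (rmul (gel g)) (rmul (gel g)) \o Delta.
have -> : f' (gel g) = h' a.
  by rewrite -[LHS]/(tmul (Delta a) (Delta (gel g))) Delta_gel tmul_tens.
rewrite -[LHS]/(h a); move: a {f f'}; apply: fga_ext => x.
have -> : h (gel x) = Delta (gel x * gel g) by [].
have -> : h' (gel x) = tmul (Delta (gel x)) (Delta (gel g)).
  by rewrite (Delta_gel g) tmul_tens.
by rewrite gelM !Delta_gel tmulE gelM.
Qed.

(** Multiplying by y - 1 raises the filtration degree, through the identity
    vy (x) wy - v (x) w = v(y-1) (x) wy + v (x) w(y-1). *)
Lemma tmul_gel_sub n s g : s \in T n ->
  tmul s (tens (gel g) (gel g)) - s \in T n.+1.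
Proof.
pose f : {linear tensor A A -> _} :=
  tensor_hom (rmul (gel g)) (rmul (gel g)) \- idfun.
move=> sT; rewrite tmul_tens -[X in X \in _]/(f s); move: s sT.
apply: tfil_map => i j v w ijn vF wF; 
rewrite -[X in X \in _]/(tensor_hom (rmul (gel g)) (rmul (gel g)) (tens v w) - tens v w).
rewrite tensor_homE -(subrKA (tens v (rmul (gel g) w))) -tensBl -tensBr.
have dE x : rmul (gel g) x - x = x * (gel g - 1) by rewrite mulrBr mulr1.
rewrite !dE -ijn rpredD //.
- rewrite -addSn; apply: (tens_fil (i := i.+1)).
    by rewrite -addn1; apply: (@afilM _ _ I i 1%N) vF (gel_sub1 A g).
  by rewrite -[j]addn0; apply: (@afilM _ _ I j 0%N) wF (fil0 _ _).
- rewrite -addnS; apply: (tens_fil (j := j.+1)) => //.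
  by rewrite -addn1; apply: (@afilM _ _ I j 1%N) wF (gel_sub1 A g).
Qed.

Lemma Delta_fil n a : a \in I n -> Delta a \in T n.
Proof.
elim: n a => [|n IH] a; first by move=> _; apply: fil0.
move: a; apply: fga_fil_ind => [|a b aT bT|c a aT|a g aI].
- by rewrite (linear0 Delta) rpred0.
- by rewrite (linearD Delta) rpredD.
- by rewrite (linearZ_LR Delta) rpredZ.
rewrite mulrBr mulr1 (linearB Delta) DeltaM Delta_gel.
by apply: tmul_gel_sub; apply: IH.
Qed.

(** The group-like series: in degree n the condition is a congruence in the
    tensor square of the group algebra itself, before completion. *)
Definition grouplike (x : cgra I) := forall n,
  Delta (gr_lift (x n)) -
    \sum_(i < n.+1) tens (gr_lift (x i)) (gr_lift (x (n - i)%N)) \in T n.+1.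

(** The two forms agree because the completed tensor product is the completion
    of the tensor square. *)
Lemma grouplikeE (x : cgra I) :
  cgr_ctensor (cgr_map T Delta x) = ctens x x <-> grouplike x.
Proof.
have sumT n : \sum_(i < n.+1) tens (gr_lift (x i)) (gr_lift (x (n - i)%N)) \in T n.
  apply: rpred_sum => i _; rewrite -[n in T n](subnKC (leq_ord i)).
  by apply: tens_fil; apply: gr_lift_fil.
rewrite cgr_ctensorE; split=> [xE n|gx].
  have := congr1 (fun z => z n) xE; rewrite ctensor_cgr_ctens.
  by move=> /gr_class_eq; apply; [apply/Delta_fil/gr_lift_fil|].
apply: cgrP => n; rewrite ctensor_cgr_ctens; apply: gr_class_congr (gx n).
exact/Delta_fil/gr_lift_fil.
Qed.

Lemma grouplike_lifts X x : lifts X x ->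
  (grouplike x <-> forall n,
     Delta (X n) - \sum_(i < n.+1) tens (X i) (X (n - i)%N) \in T n.+1).
Proof.
move=> Xx; have dX n : Delta (gr_lift (x n)) - Delta (X n) \in T n.+1.
  by rewrite -(linearB Delta); apply: Delta_fil; apply: lifts_congr.
have dS n : \sum_(i < n.+1) tens (gr_lift (x i)) (gr_lift (x (n - i)%N)) -
    \sum_(i < n.+1) tens (X i) (X (n - i)%N) \in T n.+1.
  rewrite -sumrB; apply: rpred_sum => i _.
  rewrite -[n in T n.+1](subnKC (leq_ord i)); apply: tens_congr.
  - exact: gr_lift_fil.
  - by case: (Xx (n - i)%N).
  - exact: lifts_congr.
  - exact: lifts_congr.
split=> gx n.
  exact: fil_trans (fil_trans (fil_sym (dX n)) (gx n)) (dS n).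
exact: fil_trans (fil_trans (dX n) (gx n)) (fil_sym (dS n)).
Qed.

Lemma grouplikeM x y : grouplike x -> grouplike y -> grouplike (x * y).
Proof.
move=> gx gy; pose X n := gr_lift (x n); pose Y n := gr_lift (y n).
apply/(grouplike_lifts (lifts_mul (gr_lift_lifts x) (gr_lift_lifts y))) => n.
pose XX m : tensor A A := \sum_(a < m.+1) tens (X a) (X (m - a)%N).
pose YY m : tensor A A := \sum_(a < m.+1) tens (Y a) (Y (m - a)%N).
have YT m : YY m \in T m.
  apply: rpred_sum => i _; rewrite -[m in T m](subnKC (leq_ord i)).
  by apply: tens_fil; apply: gr_lift_fil.
have -> : \sum_(i < n.+1) tens (convolution X Y i) (convolution X Y (n - i)) =
    \sum_(m < n.+1) tmul (XX m) (YY (n - m)%N).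
  transitivity (\sum_(i < n.+1) \sum_(a < i.+1) \sum_(b < (n - i).+1)
      tens (X a * Y (i - a)%N) (X b * Y (n - i - b)%N)).
    by apply: eq_bigr => i _; rewrite tens_suml; apply: eq_bigr => a _; rewrite tens_sumr.
  rewrite (convolution_sum_interchange n (fun a c b d => tens (X a * Y c) (X b * Y d))).
  apply: eq_bigr => m _; rewrite tmul_suml; apply: eq_bigr => a _.
  by rewrite tmul_sumr; apply: eq_bigr => c _; rewrite tmulE.
rewrite (linear_sum Delta) -sumrB; apply: rpred_sum => m _.
rewrite DeltaM -[n in T n.+1](subnKC (leq_ord m)).
rewrite -(subrKA (tmul (Delta (X m)) (YY (n - m)%N))) rpredD //.
  rewrite -tmulBr -addnS; apply: tmul_fil (gy _).
  exact/Delta_fil/gr_lift_fil.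
by rewrite -tmulBl -addSn; apply: tmul_fil (gx _) (YT _).
Qed.

End GroupAlgebraTheory.

(** * Expansions in low degrees *)

Section Expansions.
Local Open Scope ring_scope.
Variables (k : fieldType) (H : groupType) (B : filtered_group_algebra k H).
Local Notation I := (fga_fil B).

Lemma grouplike1 : grouplike (1 : cgra I).
Proof.
apply/(grouplike_lifts (@lifts1 _ _ I)) => -[|n].
  by rewrite big_ord1 -(gel1 B) Delta_gel subrr rpred0.
rewrite (linear0 (Delta B)) big1 ?subr0 ?rpred0 // => -[[|i] ltin] _ /=.
  exact: tens0r.
exact: tens0l.
Qed.

(** For h the identity this is a Taylor expansion; the general notion is what
    remains of it after applying a functorial map, or restricting to a factor of
    a product. *)
Definition Taylor_along (G : groupType) (h : G -> H) (E : G -> cgra I) : Prop :=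
  [/\ E 1%g = 1, {morph E : x y / (x * y)%g >-> x * y},
      forall g, E g 0%N = gr_class I 0 1,
      forall g, E g 1%N = gr_class I 1 (gel B (h g) - 1) &
      forall g, grouplike (E g)].

Variable E : H -> cgra I.

Let ext_morphism : E 1%g = 1 -> {morph E : x y / (x * y)%g >-> x * y} ->
  GRing.monoid_morphism (gext B E).
Proof.
move=> E1 EM; split=> [|a b]; first by rewrite -(gel1 B) gextE.
move: b; apply: fga_ind => [|b c bE cE|c b bE|g].
- by rewrite mulr0 (linear0 (gext B E)) mulr0.
- by rewrite mulrDr !(linearD (gext B E)) bE cE mulrDr.
- by rewrite -scalerAr !(linearZ_LR (gext B E)) /= bE scalerAr.
move: a; apply: fga_ind => [|b c bE cE|c b bE|h].
- by rewrite mul0r (linear0 (gext B E)) mul0r.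
- by rewrite mulrDl !(linearD (gext B E)) bE cE mulrDl.
- by rewrite -scalerAl !(linearZ_LR (gext B E)) /= bE scalerAl.
by rewrite gelM !gextE EM.
Qed.

(** Since the augmentation ideal is spanned by the g - 1, the associated graded
    map of an algebra morphism is the identity as soon as it is so in degree
    at most 1. *)
Lemma expansion_degree_le1 :
  [/\ GRing.monoid_morphism (gext B E), filtered I (cfil I) (gext B E) &
    forall n (u : gr I n), gr_cgr_id (gr_map (cfil I) (gext B E) u) = u] <->
  [/\ E 1%g = 1, {morph E : x y / (x * y)%g >-> x * y},
      forall g, E g 0%N = gr_class I 0 1 &
      forall g, E g 1%N = gr_class I 1 (gel B g - 1)].
Proof.
have gr_idE n (u : gr I n) : filtered I (cfil I) (gext B E) ->
    gr_cgr_id (gr_map (cfil I) (gext B E) u) = gext B E (gr_lift u) n.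
  move=> Efil; have := gr_classK (Efil n _ (gr_lift_fil u)).
  move=> /cfilP/(_ n (ltnSn n)) /eqP; rewrite cgraDE cgraNE subr_eq0 => /eqP.
  by [].
split=> [[[E1 EM] Efil Eid]|[E1 EM E0 E1d]].
  have Ecls n x : x \in I n -> gext B E x n = gr_class I n x.
    move=> xI; rewrite -[RHS]Eid gr_idE //; have := Efil _ _ (gr_classK xI).
    rewrite (linearB (gext B E)) => /cfilP/(_ n (ltnSn n))/eqP.
    by rewrite cgraDE cgraNE subr_eq0 => /eqP.
  split=> [|x y|g|g].
  - by rewrite -E1 -(gel1 B) gextE.
  - by rewrite -!(gextE B E) -EM gelM.
  - rewrite -(gextE B E) Ecls ?fil0 //.
    by apply: gr_class_congr; [apply: fil0|apply: gel_sub1].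
  - rewrite -Ecls ?gel_sub1 // (linearB (gext B E)) cgraDE cgraNE E1.
    by rewrite cgra1ES subr0 gextE.
have [Eb1 EbM] := ext_morphism E1 EM.
have Ecls n x : x \in I n -> gext B E x \in cfil I n /\
    gext B E x n = gr_class I n x.
  elim: n x => [x _|n IH].
    split; first exact: fil0.
    move: x; apply: fga_ind => [|a b aE bE|c a aE|g].
    - by rewrite (linear0 (gext B E)) gr_class0.
    - by rewrite (linearD (gext B E)) cgraDE aE bE gr_classD ?fil0.
    - by rewrite (linearZ_LR (gext B E)) cgraZE aE gr_classZ ?fil0.
    rewrite gextE E0; apply: gr_class_congr; first exact: fil0.
    exact/fil_sym/gel_sub1.
  suff: forall x, x \in I n.+1 -> x \in I n.+1 /\ gext B E x \in cfil I n.+1 /\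
      gext B E x n.+1 = gr_class I n.+1 x.
    by move=> Ex x /Ex[].
  apply: fga_fil_ind => [|a b [aI [aF aE]] [bI [bF bE]]|c a [aI [aF aE]]|a g aI].
  - by rewrite (linear0 (gext B E)) gr_class0 !rpred0.
  - by rewrite (linearD (gext B E)) cgraDE aE bE gr_classD ?rpredD.
  - by rewrite (linearZ_LR (gext B E)) cgraZE aE gr_classZ ?rpredZ.
  have dI := gel_sub1 B g; have [aF aE] := IH _ aI.
  have agI : a * (gel B g - 1) \in I n.+1 by rewrite -addn1; apply: afilM.
  have dE : gext B E (gel B g - 1) = E g - 1.
    by rewrite (linearB (gext B E)) gextE Eb1.
  have dF : gext B E (gel B g - 1) \in cfil I 1.
    by apply/cfilP => -[|//] _; rewrite dE cgraDE cgraNE E0 cgra1E0 subrr.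
  have dE1 : gext B E (gel B g - 1) 1%N = gr_class I 1 (gel B g - 1).
    by rewrite dE cgraDE cgraNE cgra1ES E1d subr0.
  split=> //; rewrite EbM -addn1; split; first by case: (cfilM aF dF).
  exact: cfilM_class.
have Efil : filtered I (cfil I) (gext B E) by move=> n x /Ecls[].
split=> [||n u] //; rewrite gr_idE //.
by have [_ ->] := Ecls _ _ (gr_lift_fil u); rewrite gr_liftK.
Qed.

End Expansions.

(** * Functoriality in the group and the field *)

Lemma linearB_sum (k : pzRingType) (V W : lmodType k) (L : {linear V -> W})
    (J : Type) (r : seq J) v (F : J -> V) :
  (L (v - \sum_(i <- r) F i) = L v - \sum_(i <- r) L (F i))%R.
Proof. by rewrite linearB linear_sum. Qed.

Section RestrictionOfScalars.
Local Open Scope ring_scope.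

(** Over this space a semilinear map is linear, so that the universal properties
    of group algebras and of tensor products produce it. *)
Definition restrict_scalars (k K : fieldType) (f : {rmorphism k -> K})
  (V : lmodType K) : Type := V.

Variables (k K : fieldType) (f : {rmorphism k -> K}) (V : lmodType K).
Local Notation V_k := (restrict_scalars f V).
HB.instance Definition _ := GRing.Zmodule.on V_k.

Let scale (c : k) (v : V_k) : V_k := f c *: (v : V).
Fact restrict_scalarsA a b v : scale a (scale b v) = scale (a * b) v.
Proof. by rewrite /scale scalerA rmorphM. Qed.
Fact restrict_scalars1 : left_id 1 scale.
Proof. by move=> v; rewrite /scale rmorph1 scale1r. Qed.
Fact restrict_scalarsDr : right_distributive scale +%R.
Proof. by move=> a u v; apply: scalerDr. Qed.
Fact restrict_scalarsDl v : {morph scale^~ v : a b / a + b}.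
Proof. by move=> a b; rewrite /scale rmorphD; apply: scalerDl. Qed.
HB.instance Definition _ := GRing.Zmodule_isLmodule.Build k V_k
  restrict_scalarsA restrict_scalars1 restrict_scalarsDr restrict_scalarsDl.

Definition restrict_sub (U : submodClosed V) : {pred V_k} :=
  fun v => (v : V) \in U.
Fact restrict_sub_submod U : GRing.subsemimod_closed (restrict_sub U).
Proof.
split; [split|] => [|u v uU vU|c v vU].
- exact: (rpred0 U).
- exact: (rpredD (S := U)).
- exact: (rpredZ (s := U)).
Qed.
HB.instance Definition _ U := GRing.isSubmodClosed.Build k V_k
  (restrict_sub U) (restrict_sub_submod U).

End RestrictionOfScalars.

Section RestrictionOfLinearMaps.
Local Open Scope ring_scope.
Variables (k K : fieldType) (f : {rmorphism k -> K}) (V W : lmodType K).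
Variable (g : {linear V -> W}).
Local Notation V_k := (restrict_scalars f V).
Definition restrict_lin : V_k -> restrict_scalars f W := g.
Fact restrict_lin_linear : linear restrict_lin.
Proof. by move=> c u v; apply: (linearP g). Qed.
HB.instance Definition _ := GRing.isLinear.Build k V_k (restrict_scalars f W) _
  restrict_lin restrict_lin_linear.

End RestrictionOfLinearMaps.

Section Functoriality.
Local Open Scope ring_scope.
Variables (k K : fieldType) (f : {rmorphism k -> K}).
Variables (G H : groupType) (h : G -> H).
Hypothesis hM : {morph h : x y / (x * y)%g}.
Variables (A : filtered_group_algebra k G) (B : filtered_group_algebra K H).

Let base_lin : {linear A -> restrict_scalars f B} :=
  gext A (fun g => gel B (h g) : restrict_scalars f B).
Definition base_map (a : A) : B := base_lin a.
Local Notation phi := base_map.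

Lemma base_map_gel g : phi (gel A g) = gel B (h g).
Proof. exact: (@gextE k G A (restrict_scalars f B)). Qed.
Lemma base_map0 : phi 0 = 0.
Proof. exact: (linear0 base_lin). Qed.
Lemma base_mapD a b : phi (a + b) = phi a + phi b.
Proof. exact: (linearD base_lin). Qed.
Lemma base_mapZ c a : phi (c *: a) = f c *: phi a.
Proof. exact: (linearZ_LR base_lin). Qed.
Lemma base_mapB a b : phi (a - b) = phi a - phi b.
Proof. exact: (linearB base_lin). Qed.
Lemma base_map_sum (J : Type) (r : seq J) (F : J -> A) :
  phi (\sum_(i <- r) F i) = \sum_(i <- r) phi (F i).
Proof.
elim: r => [|i r IH]; first by rewrite !big_nil base_map0.
by rewrite !big_cons base_mapD IH.
Qed.

Lemma base_mapM a b : phi (a * b) = phi a * phi b.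
Proof.
move: b; apply: fga_ind => [|b c bE cE|c b bE|g].
- by rewrite mulr0 base_map0 mulr0.
- by rewrite mulrDr !base_mapD bE cE mulrDr.
- by rewrite -scalerAr !base_mapZ bE scalerAr.
move: a; apply: fga_ind => [|b c bE cE|c b bE|x].
- by rewrite mul0r base_map0 mul0r.
- by rewrite mulrDl !base_mapD bE cE mulrDl.
- by rewrite -scalerAl !base_mapZ bE scalerAl.
by rewrite gelM !base_map_gel gelM hM.
Qed.

Lemma base_map1 : phi 1 = 1.
Proof.
rewrite -(gel1 A) base_map_gel -(gel1 B); congr gel.
by apply: (mulIg (h 1%g)); rewrite -hM !mul1g.
Qed.

Lemma base_map_fil n a : a \in fga_fil A n -> phi a \in fga_fil B n.
Proof.
elim: n a => [a _|n IH]; first exact: fil0.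
apply: fga_fil_ind => [|a b aF bF|c a aF|a g aF].
- by rewrite base_map0 rpred0.
- by rewrite base_mapD rpredD.
- by rewrite base_mapZ rpredZ.
rewrite base_mapM base_mapB base_map1 base_map_gel -addn1.
by apply: afilM; [apply: IH|apply: gel_sub1].
Qed.

Definition completed_map (x : cgra (fga_fil A)) : cgra (fga_fil B) :=
  fun n => gr_class (fga_fil B) n (phi (gr_lift (x n))).

Lemma completed_map_lifts X x : lifts X x ->
  lifts (fun n => phi (X n)) (completed_map x).
Proof.
move=> Xx n; have [XF _] := Xx n; split; first exact: base_map_fil.
apply: gr_class_congr; first exact/base_map_fil/gr_lift_fil.
by rewrite -base_mapB; apply/base_map_fil/lifts_congr.
Qed.

Lemma completed_map1 : completed_map 1 = 1.
Proof.
apply: (lifts_inj (completed_map_lifts (@lifts1 _ _ _)) (@lifts1 _ _ _)).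
by case=> [|n]; rewrite ?base_map1 ?base_map0 subrr rpred0.
Qed.

Lemma completed_mapM x y :
  completed_map (x * y) = completed_map x * completed_map y.
Proof.
have [Xx Yy] := (gr_lift_lifts x, gr_lift_lifts y).
apply: (lifts_inj (completed_map_lifts (lifts_mul Xx Yy))
  (lifts_mul (completed_map_lifts Xx) (completed_map_lifts Yy))) => n.
rewrite /convolution base_map_sum -sumrB rpred_sum // => i _.
by rewrite base_mapM subrr rpred0.
Qed.

Let tens_phi (v w : A) : restrict_scalars f (tensor B B) := tens (phi v) (phi w).
Fact tens_phi_l w : linear (tens_phi^~ w).
Proof.
by move=> c v v'; rewrite /tens_phi base_mapD base_mapZ tensDl tensZl.
Qed.
Fact tens_phi_r v : linear (tens_phi v).
Proof.
by move=> c w w'; rewrite /tens_phi base_mapD base_mapZ tensDr tensZr.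
Qed.
Let base_lin2 := tensor_map (BilinearMap tens_phi_l tens_phi_r).
Definition base_map2 (t : tensor A A) : tensor B B := base_lin2 t.

Lemma base_map2_tens v w : base_map2 (tens v w) = tens (phi v) (phi w).
Proof. exact: (tensor_mapE (BilinearMap tens_phi_l tens_phi_r)). Qed.
Lemma base_map2B_sum (J : Type) (r : seq J) s (F : J -> tensor A A) :
  base_map2 (s - \sum_(i <- r) F i) = base_map2 s - \sum_(i <- r) base_map2 (F i).
Proof. by have E := linearB_sum base_lin2 r s F; exact: E. Qed.

Lemma base_map2_fil n t : t \in tfil (fga_fil A) (fga_fil A) n ->
  base_map2 t \in tfil (fga_fil B) (fga_fil B) n.
Proof.
pose U : submodClosed (tensor B B) := tfil (fga_fil B) (fga_fil B) n.
move=> tT; suff: base_lin2 t \in restrict_sub U by [].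
move: t tT; apply: tfil_map => i j v w ijn vF wF.
rewrite -[_ \in _]/(base_map2 (tens v w) \in U) base_map2_tens /U -ijn.
by apply: tens_fil; apply: base_map_fil.
Qed.

Lemma base_map_Delta a : Delta B (base_map a) = base_map2 (Delta A a).
Proof.
pose L : {linear A -> restrict_scalars f (tensor B B)} :=
  @restrict_lin k K f _ _ (Delta B) \o base_lin.
pose L' : {linear A -> restrict_scalars f (tensor B B)} := base_lin2 \o Delta A.
rewrite -[LHS]/(L a) -[RHS]/(L' a); move: a.
apply: (@fga_ext k G A (restrict_scalars f (tensor B B)) L L') => g.
rewrite -[LHS]/(Delta B (phi (gel A g))) -[RHS]/(base_map2 (Delta A (gel A g))).
by rewrite base_map_gel !Delta_gel base_map2_tens base_map_gel.
Qed.

(** The comultiplications are intertwined by [base_map] and [base_map2], and the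
    latter respects the filtrations, so the congruences that define group-like
    series are preserved. *)
Lemma completed_map_grouplike x : grouplike x -> grouplike (completed_map x).
Proof.
move=> gx; apply/(grouplike_lifts (completed_map_lifts (gr_lift_lifts x))) => n.
have := base_map2_fil (gx n); rewrite base_map2B_sum base_map_Delta.
by under eq_bigr do rewrite base_map2_tens.
Qed.

Lemma Taylor_along_map E : Taylor_along (B := A) id E ->
  Taylor_along (B := B) h (fun g => completed_map (E g)).
Proof.
move=> [E1 EM E0 E1d Eg]; split=> [|x y|g|g|g].
- by rewrite E1 completed_map1.
- by rewrite EM completed_mapM.
- rewrite /completed_map E0; apply: gr_class_congr; rewrite ?fil0 //.
  by rewrite -base_map1 -base_mapB; apply/base_map_fil/gr_classK/fil0.
- rewrite /completed_map E1d; apply: gr_class_congr.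
    exact/base_map_fil/gr_lift_fil.
  rewrite -base_map_gel -base_map1 -!base_mapB.
  exact/base_map_fil/gr_classK/gel_sub1.
- exact/completed_map_grouplike/Eg.
Qed.

End Functoriality.

(** * Direct products and free products *)

Section LowDegrees.
Local Open Scope ring_scope.
Variables (k : fieldType) (H : groupType) (B : filtered_group_algebra k H).
Local Notation I := (fga_fil B).

Lemma cgraM0 (x y : cgra I) : x 0%N = gr_class I 0 1 -> y 0%N = gr_class I 0 1 ->
  (x * y) 0%N = gr_class I 0 1.
Proof.
move=> x0 y0; rewrite -[X in gr_class _ _ X]mulr1.
by apply: (cfilM_class (n := 0) (m := 0)); rewrite ?fil0.
Qed.

Lemma cgraM1 (x y : cgra I) : x 0%N = gr_class I 0 1 -> y 0%N = gr_class I 0 1 ->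
  (x * y) 1%N = x 1%N + y 1%N.
Proof.
move=> x0 y0; have Xx n := gr_lift_lifts x n; have Yy n := gr_lift_lifts y n.
rewrite (lifts_mul Xx Yy 1%N).2 /convolution !big_ord_recl big_ord0 addr0 /=.
rewrite /bump /= add1n subn0 subnn -[y 1%N in RHS]gr_liftK -[x 1%N in RHS]gr_liftK.
have cls0 (z : cgra I) : z 0%N = gr_class I 0 1 -> gr_lift (z 0%N) - 1 \in I 1%N.
  by move=> ->; apply: gr_classK; apply: fil0.
rewrite addrC -gr_classD ?gr_lift_fil //.
have IxI a b : a \in I 1%N -> b - 1 \in I 1%N -> a * b - a \in I 2.
  by move=> aI bI; rewrite -{2}[a]mulr1 -mulrBr; apply: (@afilM _ _ I 1 1).
have IxI' a b : a \in I 1%N -> b - 1 \in I 1%N -> b * a - a \in I 2.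
  by move=> aI bI; rewrite -{2}[a]mul1r -mulrBl; apply: (@afilM _ _ I 1 1).
have [x1 y1] := (gr_lift_fil (x 1%N), gr_lift_fil (y 1%N)).
apply: gr_class_congr.
  by rewrite rpredD //; [apply: (@afilM _ _ I 1 0)|apply: (@afilM _ _ I 0 1)];
    rewrite ?fil0.
rewrite opprD addrACA rpredD //; first by apply: IxI (cls0 _ y0).
by apply: IxI' (cls0 _ x0).
Qed.

(** The difference (gh - 1) - (g - 1) - (h - 1) = (g - 1)(h - 1) lies in the
    square of the augmentation ideal. *)
Lemma gel_class1M g h : gr_class I 1 (gel B (g * h)%g - 1) =
  gr_class I 1 (gel B g - 1) + gr_class I 1 (gel B h - 1).
Proof.
have [gI hI] := (gel_sub1 B g, gel_sub1 B h).
rewrite -gr_classD //; symmetry; apply: gr_class_congr; first by rewrite rpredD.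
rewrite -gelM; apply: fil_sym.
have -> : gel B g * gel B h - 1 - (gel B g - 1 + (gel B h - 1)) =
    (gel B g - 1) * (gel B h - 1).
  rewrite mulrBl mul1r mulrBr mulr1 opprD addrA; congr (_ - _).
  by rewrite opprB subrKA.
exact: (@afilM _ _ I 1 1).
Qed.

Lemma gel_class1_1 : gr_class I 1 (gel B 1%g - 1) = 0.
Proof. by rewrite gel1 subrr gr_class0. Qed.

End LowDegrees.

Section CommutingImages.
Local Open Scope ring_scope.
Variables (k : fieldType) (G G' H : groupType) (h : G -> H) (h' : G' -> H).
Hypothesis hM : {morph h : x y / (x * y)%g}.
Hypothesis h'M : {morph h' : x y / (x * y)%g}.
Hypothesis hC : forall x y, (h x * h' y = h' y * h x)%g.
Variables (A : filtered_group_algebra k G) (A' : filtered_group_algebra k G').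
Variable B : filtered_group_algebra k H.
Let f : {rmorphism k -> k} := idfun.

Let base_map_comm (a : A) (a' : A') :
  base_map f h B a * base_map f h' B a' = base_map f h' B a' * base_map f h B a.
Proof.
move: a; apply: fga_ind => [|a b aE bE|c a aE|g].
- by rewrite base_map0 mul0r mulr0.
- by rewrite base_mapD mulrDl mulrDr aE bE.
- by rewrite base_mapZ -scalerAl aE scalerAr.
move: a'; apply: fga_ind => [|a b aE bE|c a aE|g'].
- by rewrite base_map0 mul0r mulr0.
- by rewrite base_mapD mulrDl mulrDr aE bE.
- by rewrite base_mapZ -scalerAr aE scalerAl.
by rewrite !base_map_gel !gelM hC.
Qed.

Lemma completed_map_comm (x : cgra (fga_fil A)) (y : cgra (fga_fil A')) :
  GRing.comm (completed_map f h B x) (completed_map f h' B y).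
Proof.
have Xx := completed_map_lifts f hM B (gr_lift_lifts x).
have Yy := completed_map_lifts f h'M B (gr_lift_lifts y).
apply: (lifts_inj (lifts_mul Xx Yy) (lifts_mul Yy Xx)) => n.
rewrite /convolution (reindex_inj rev_ord_inj) -sumrB rpred_sum // => i _ /=.
by rewrite subSS subKn ?leq_ord // base_map_comm subrr rpred0.
Qed.

End CommutingImages.

Section DirectProductExpansion.
Local Open Scope ring_scope.
Variables (k : fieldType) (n : nat) (G : 'I_n -> groupType).
Local Notation P := (direct_product G).

Definition dp_inj i (a : G i) : P := dfwith (fun j => 1%g : G j) a.
Arguments dp_inj : clear implicits.

Lemma dp_inj_id i a : dp_inj i a i = a.
Proof. exact: dfwith_in. Qed.

Lemma dp_inj_neq i a j : i != j -> dp_inj i a j = 1%g.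
Proof. by move=> ij; rewrite /dp_inj dfwith_out. Qed.

Lemma dp_injM i : {morph dp_inj i : x y / (x * y)%g}.
Proof.
move=> x y; apply: functional_extensionality_dep => j.
rewrite -[RHS]/(dp_inj i x j * dp_inj i y j)%g.
have [<-|ij] := eqVneq i j; first by rewrite !dp_inj_id.
by rewrite !dp_inj_neq // mulg1.
Qed.

Lemma dp_inj_comm i j a b : i != j ->
  (dp_inj i a * dp_inj j b = dp_inj j b * dp_inj i a)%g.
Proof.
move=> ij; apply: functional_extensionality_dep => l.
rewrite -[LHS]/(dp_inj i a l * dp_inj j b l)%g.
rewrite -[RHS]/(dp_inj j b l * dp_inj i a l)%g.
have [il|il] := eqVneq i l; last by rewrite (dp_inj_neq _ il) mul1g mulg1.
by rewrite (dp_inj_neq b (j := l)) ?mul1g ?mulg1 // -il eq_sym.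
Qed.

Lemma dp_prod_inj (x : P) : (\prod_(i <- enum 'I_n) dp_inj i (x i))%g = x.
Proof.
apply: functional_extensionality_dep => j.
suff prodE r : uniq r -> (\prod_(i <- r) dp_inj i (x i))%g j =
    if j \in r then x j else 1%g.
  by rewrite prodE ?enum_uniq // mem_enum.
elim: r => [|i r IH] /=; first by rewrite big_nil.
move=> /andP[ir /IH rE]; rewrite big_cons.
rewrite -[LHS]/(dp_inj i (x i) j * (\prod_(i <- r) dp_inj i (x i))%g j)%g rE.
rewrite inE; have [->|ji] := eqVneq j i.
  by rewrite (negPf ir) dp_inj_id mulg1.
by rewrite dp_inj_neq 1?eq_sym // mul1g.
Qed.

Variable A : forall i, filtered_group_algebra k (G i).
Variable B : filtered_group_algebra k P.
Let f : {rmorphism k -> k} := idfun.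

(** The images in the completion for the product of the expansions of distinct
    factors commute, so their product is multiplicative. *)
Lemma direct_product_Taylor :
  (forall i, exists E, Taylor_along (B := A i) id E) ->
  exists E, Taylor_along (B := B) id E.
Proof.
move=> /fin_all_exists[E EP].
pose e i (x : P) := completed_map f (dp_inj i) B (E i (x i)).
have eP i := Taylor_along_map f (@dp_injM i) B (EP i).
have eC i j x y : i != j -> GRing.comm (e i x) (e j y).
  move=> ij; apply: completed_map_comm; try exact: dp_injM.
  by move=> a b; apply: dp_inj_comm.
pose Er r x := \prod_(i <- r) e i x.
have ErS i r x : Er (i :: r) x = e i x * Er r x by rewrite /Er big_cons.
have ErM r : uniq r -> {morph Er r : x y / (x * y)%g >-> x * y}.
  elim: r => [_|i r IH /= /andP[ir /IH rM]] x y; rewrite /Er.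
    by rewrite !big_nil mulr1.
  rewrite !big_cons -!/(Er r _) rM; have [_ eM _ _ _] := eP i.
  have -> : e i (x * y)%g = e i x * e i y by apply: eM.
  have comm : GRing.comm (e i y) (Er r x).
    rewrite /Er big_seq; apply: commr_prod => j jr; apply: eC.
    by apply: contraNneq ir => ->.
  by rewrite -!mulrA; congr (_ * _); rewrite !mulrA comm.
have Er0 r x : Er r x 0%N = gr_class (fga_fil B) 0 1.
  rewrite /Er; elim: r => [|i r IH]; first by rewrite big_nil.
  rewrite big_cons; apply: cgraM0 => //.
  by have [_ _ ez _ _] := eP i; apply: ez.
exists (Er (enum 'I_n)); split=> [|||x|x].
- rewrite /Er big1 // => i _; have [e1 _ _ _ _] := eP i; exact: e1.
- by apply: ErM; apply: enum_uniq.
- exact: Er0.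
- rewrite -{2}[x]dp_prod_inj; elim: (enum 'I_n) => [|i r IH].
    by rewrite big_nil gel_class1_1 /Er big_nil.
  rewrite big_cons gel_class1M -IH ErS cgraM1 ?Er0 //.
    by congr (_ + _); have [_ _ _ ed _] := eP i; apply: ed.
  by have [_ _ ez _ _] := eP i; apply: ez.
- rewrite /Er; apply: big_ind => [||i _].
  - exact: grouplike1.
  - exact: grouplikeM.
  - by have [_ _ _ _ eg] := eP i; apply: eg.
Qed.

End DirectProductExpansion.

Section FreeProductExpansion.
Local Open Scope ring_scope.
Local Open Scope quotient_scope.
Variables (k : fieldType) (J : finType) (G : J -> groupType).
Local Notation P := (free_product G).
Variable A : forall i, filtered_group_algebra k (G i).
Variable B : filtered_group_algebra k P.
Let f : {rmorphism k -> k} := idfun.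

Lemma fp_injM i : {morph @fp_inj J G i : x y / (x * y)%g}.
Proof.
move=> x y; rewrite -[RHS]/(fp_mul (fp_inj x) (fp_inj y)) fp_pi_mul.
by apply/fp_pi_eq; apply: word_sym; apply: word_mul.
Qed.

(** The product of the expansions of the letters of a word only depends on its
    class, by multiplicativity in each factor. *)
Lemma free_product_Taylor :
  (forall i, exists E, Taylor_along (B := A i) id E) ->
  exists E, Taylor_along (B := B) id E.
Proof.
move=> /fin_all_exists[E EP].
pose e i (a : G i) := completed_map f (@fp_inj J G i) B (E i a).
have eP i : Taylor_along (@fp_inj J G i) (e i).
  by apply: Taylor_along_map; [apply: fp_injM|apply: EP].
pose Ew (u : word G) := \prod_(l <- u) e (tag l) (tagged l).
have EwS l u : Ew (l :: u) = e (tag l) (tagged l) * Ew u by rewrite /Ew big_cons.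
have Ew_equiv u v : word_equiv u v -> Ew u = Ew v.
  elim=> {u v} [//|//|u v w _ -> _ -> //|u u' v v' _ uE _ vE|i|i a b].
  - by rewrite /Ew !big_cat -!/(Ew _) uE vE.
  - by rewrite /Ew big_nil big_seq1; have [e1 _ _ _ _] := eP i.
  - rewrite /Ew !big_cons !big_nil !mulr1 /=.
    by have [_ eM _ _ _] := eP i; rewrite eM.
pose Ef (x : P) := Ew (repr x).
have EfE u : Ef (\pi_P u) = Ew u by apply/Ew_equiv/fp_reprP.
have Ew0 u : Ew u 0%N = gr_class (fga_fil B) 0 1.
  rewrite /Ew; elim: u => [|l u IH]; first by rewrite big_nil.
  rewrite big_cons; apply: cgraM0 => //.
  by have [_ _ ez _ _] := eP (tag l); apply: ez.
exists Ef; split=> [|x y|x|x|x].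
- by rewrite -[1%g]/(\pi_P [::]) EfE /Ew big_nil.
- by rewrite -[(x * y)%g]/(\pi_P (repr x ++ repr y)) EfE /Ew big_cat.
- exact: Ew0.
- rewrite -{2}[x]reprK /Ef; elim: (repr x) => [|l u IH].
    by rewrite /Ew big_nil -[\pi_P [::]]/(1%g : P) gel_class1_1.
  have -> : \pi_P (l :: u) = (fp_inj (tagged l) * \pi_P u)%g.
    rewrite -[RHS]/(fp_mul _ _) fp_pi_mul /=; congr (\pi_P (_ :: _)).
    by case: l.
  rewrite gel_class1M -IH EwS cgraM1 ?Ew0 //.
    by congr (_ + _); have [_ _ _ ed _] := eP (tag l); apply: ed.
  by have [_ _ ez _ _] := eP (tag l); apply: ez.
- rewrite /Ef /Ew; apply: big_ind => [||l _].
  - exact: grouplike1.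
  - exact: grouplikeM.
  - by have [_ _ _ _ eg] := eP (tag l); apply: eg.
Qed.

End FreeProductExpansion.

(** * The antipode *)

Lemma commutator_sub1 (R : pzRingType) (a b : R) :
  ((a - 1) * (b - 1) - (b - 1) * (a - 1) = a * b - b * a)%R.
Proof.
have E (x y : R) : ((x - 1) * (y - 1) = x * y - (x + (y - 1)))%R.
  by rewrite [in RHS]opprD [in RHS]addrA mulrBl mul1r mulrBr mulr1.
by rewrite !E [(b + (a - 1))%R]addrCA opprB subrKA.
Qed.

Section Antipode.
Local Open Scope ring_scope.
Local Open Scope classical_set_scope.
Variables (k : fieldType) (G : groupType) (A : filtered_group_algebra k G).
Local Notation I := (fga_fil A).
Local Notation T := (tfil I I).
Local Notation gel := (gel A).

Definition antipode : {linear A -> A} := gext A (fun g => gel g^-1%g).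
Local Notation S := antipode.

Lemma antipode_gel g : S (gel g) = gel g^-1%g.
Proof. exact: gextE. Qed.

Lemma antipodeM a b : S (a * b) = S b * S a.
Proof.
move: b; apply: fga_ind => [|b c bE cE|c b bE|g].
- by rewrite mulr0 (linear0 S) mul0r.
- by rewrite mulrDr !(linearD S) bE cE mulrDl.
- by rewrite -scalerAr !(linearZ_LR S) /= bE scalerAl.
move: a; apply: fga_ind => [|b c bE cE|c b bE|h].
- by rewrite mul0r (linear0 S) mulr0.
- by rewrite mulrDl !(linearD S) bE cE mulrDr.
- by rewrite -scalerAl !(linearZ_LR S) /= bE scalerAr.
by rewrite gelM !antipode_gel gelM invgM.
Qed.

Lemma antipode1 : S 1 = 1.
Proof. by rewrite -(gel1 A) antipode_gel invg1. Qed.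

Lemma antipode_fil n a : a \in I n -> S a \in I n.
Proof.
elim: n a => [|n IH] a; first by move=> _; apply: fil0.
move: a; apply: fga_fil_ind => [|a b aI bI|c a aI|a g aI].
- by rewrite (linear0 S) rpred0.
- by rewrite (linearD S) rpredD.
- by rewrite (linearZ_LR S) rpredZ.
rewrite antipodeM (linearB S) antipode1 antipode_gel.
by apply: (@afilM _ _ I 1 n); [apply: gel_sub1|apply: IH].
Qed.

Lemma antipode_gel_sub1 g : S (gel g - 1) + (gel g - 1) \in I 2.
Proof.
have -> : S (gel g - 1) + (gel g - 1) = - 1 *: ((gel g - 1) * (gel g^-1%g - 1)).
  rewrite (linearB S) antipode1 antipode_gel mulrBr mulrBl gelM mulgV gel1.
  by rewrite mulr1 mul1r scaleN1r opprB addrC opprB.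
by rewrite rpredZ //; apply: (@afilM _ _ I 1 1); apply: gel_sub1.
Qed.

Let mul_l (w : A) : linear (fun v : A => v * w).
Proof. by move=> c v v'; rewrite mulrDl scalerAl. Qed.
Let mul_r (v : A) : linear (fun w : A => v * w).
Proof. by move=> c w w'; rewrite mulrDr scalerAr. Qed.
Definition mul_map := tensor_map (BilinearMap mul_l mul_r).
HB.instance Definition _ := GRing.Linear.on mul_map.

Lemma mul_map_tens v w : mul_map (tens v w) = v * w.
Proof. exact: tensor_mapE. Qed.

(** The counit, with values in the scalar multiples of 1. *)
Definition unit_counit : {linear A -> A} := gext A (fun=> 1).

Lemma unit_counit_gel g : unit_counit (gel g) = 1.
Proof. exact: gextE. Qed.

Lemma unit_counit_fil1 n a : a \in I n.+1 -> unit_counit a = 0.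
Proof.
move: a; apply: fga_fil_ind => [|b c b0 c0|c b b0|b g _].
- exact: linear0.
- by rewrite linearD b0 c0 addr0.
- by rewrite linearZ_LR b0 scaler0.
rewrite mulrBr mulr1 linearB; apply/eqP; rewrite subr_eq0; apply/eqP.
pose f : {linear A -> A} := unit_counit \o rmul (gel g).
rewrite -[LHS]/(f b); move: b; apply: fga_ext => h.
by rewrite -[LHS]/(unit_counit (gel h * gel g)) gelM !unit_counit_gel.
Qed.

Definition antipode_left : {linear tensor A A -> A} :=
  mul_map \o tensor_hom antipode idfun.
Definition antipode_right : {linear tensor A A -> A} :=
  mul_map \o tensor_hom idfun antipode.

Lemma antipode_left_tens v w : antipode_left (tens v w) = S v * w.
Proof.
by rewrite -[LHS]/(mul_map (tensor_hom S idfun (tens v w))) tensor_homE mul_map_tens.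
Qed.

Lemma antipode_right_tens v w : antipode_right (tens v w) = v * S w.
Proof.
by rewrite -[LHS]/(mul_map (tensor_hom idfun S (tens v w))) tensor_homE mul_map_tens.
Qed.

Lemma antipode_left_Delta a : antipode_left (Delta A a) = unit_counit a.
Proof.
pose f : {linear A -> A} := antipode_left \o Delta A.
rewrite -[LHS]/(f a); move: a; apply: fga_ext => g.
rewrite -[LHS]/(antipode_left (Delta A (gel g))) Delta_gel antipode_left_tens.
by rewrite antipode_gel gelM mulVg gel1 unit_counit_gel.
Qed.

Lemma antipode_right_Delta a : antipode_right (Delta A a) = unit_counit a.
Proof.
pose f : {linear A -> A} := antipode_right \o Delta A.
rewrite -[LHS]/(f a); move: a; apply: fga_ext => g.
rewrite -[LHS]/(antipode_right (Delta A (gel g))) Delta_gel antipode_right_tens.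
by rewrite antipode_gel gelM mulgV gel1 unit_counit_gel.
Qed.

Lemma antipode_right_fil n t : t \in T n -> antipode_right t \in I n.
Proof.
apply: tfil_map => i j v w <- vI wI.
rewrite -[X in X \in _]/(antipode_right (tens v w)) antipode_right_tens.
by apply: afilM => //; apply: antipode_fil.
Qed.

End Antipode.

(** * The Dynkin operator *)

Section DynkinOperator.
Local Open Scope ring_scope.
Local Open Scope classical_set_scope.
Variables (k : fieldType) (G : groupType) (A : filtered_group_algebra k G).
Local Notation I := (fga_fil A).
Local Notation T := (tfil I I).
Local Notation gel := (gel A).
Local Notation S := (antipode A).
Local Notation r i := (retraction (I i)).

Let psi_raw n (v w : A) : A :=
  \sum_(i < n.+1) (n - i)%:R *: (S (r i v) * r (n - i)%N w).
Fact psi_l n w : linear ((psi_raw n)^~ w).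
Proof.
move=> c v v'; rewrite /psi_raw scaler_sumr -big_split; apply: eq_bigr => i _ /=.
rewrite (linearP (retraction _)) (linearP S) mulrDl -scalerAl scalerDr !scalerA.
by rewrite [c * _]mulrC.
Qed.
Fact psi_r n v : linear (psi_raw n v).
Proof.
move=> c w w'; rewrite /psi_raw scaler_sumr -big_split; apply: eq_bigr => i _ /=.
rewrite (linearP (retraction _)) mulrDr -scalerAr scalerDr !scalerA.
by rewrite [c * _]mulrC.
Qed.

(** On leading terms this is the map that sends u (x) v, for u and v of degrees
    i and j with i + j = n, to j S(u) v. The group algebra has no grading, and
    the retractions onto the pieces of its filtration replace the projections
    to the homogeneous components. *)
Definition psi n := tensor_map (BilinearMap (psi_l n) (psi_r n)).
HB.instance Definition _ n := GRing.Linear.on (psi n).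

Let psi_tens n v w : psi n (tens v w) =
  \sum_(i < n.+1) (n - i)%:R *: (S (r i v) * r (n - i)%N w).
Proof. exact: tensor_mapE. Qed.

Let retraction_max i a v : v \in I a -> r i v \in I (maxn i a).
Proof.
move=> vI; have [leia|ltai] := leqP i a; last exact: retraction_in.
by rewrite retraction_id // (fil_le leia).
Qed.

Let psi_term i j a b v w : v \in I a -> w \in I b ->
  S (r i v) * r j w \in I (maxn i a + maxn j b)%N.
Proof.
by move=> vI wI; apply: afilM; [apply: antipode_fil|]; apply: retraction_max.
Qed.

Lemma psi_next n t : t \in T n.+1 -> psi n t \in I n.+1.
Proof.
apply: tfil_map => a b v w abn vI wI.
rewrite -[X in X \in _]/(psi n (tens v w)) psi_tens; apply: rpred_sum => i _.
rewrite rpredZ //; apply: (fil_le _ (psi_term _ _ vI wI)).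
apply: (@leq_trans (a + b)); first by rewrite abn.
by apply: leq_add; apply: leq_maxr.
Qed.

Lemma psi_congr n a b v w : (a + b = n)%N -> v \in I a -> w \in I b ->
  psi n (tens v w) - b%:R *: (S v * w) \in I n.+1.
Proof.
move=> abn vI wI; have lta : (a < n.+1)%N by rewrite ltnS -abn leq_addr.
have nab : (n - a)%N = b by rewrite -abn addKn.
rewrite psi_tens (bigD1 (Ordinal lta)) //= nab (retraction_id vI) (retraction_id wI).
rewrite addrAC subrr add0r; apply: rpred_sum => i nia.
have {}nia : (i != a :> nat) by rewrite -val_eqE in nia.
move: (leq_ord i) nia; move: (nat_of_ord i) => {}i lein nia.
rewrite rpredZ //; apply: (fil_le _ (psi_term _ _ vI wI)).
have [ltia|ltai|ia] := ltngtP i a; last by rewrite ia eqxx in nia.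
  apply: (@leq_trans (a + (n - i))).
    by rewrite -{1}(subnKC lein) -addSn leq_add2r.
  by rewrite leq_add2l leq_maxl.
apply: (@leq_trans (i + b)); first by rewrite -abn -addSn leq_add2r.
by rewrite leq_add2l leq_maxr.
Qed.

(** Since [g, h] - 1 = g^-1 h^-1 (gh - hg), and g^-1 h^-1 is congruent to 1. *)
Lemma commutator_gel_sub1 n m g h : gel g - 1 \in I n -> gel h - 1 \in I m ->
  gel [~ g, h]%g - 1 \in I (n + m)%N /\
  (gel g - 1) * (gel h - 1) - (gel h - 1) * (gel g - 1) - (gel [~ g, h]%g - 1)
    \in I (n + m)%N.+1.
Proof.
move=> gI hI; set c := _ * _ - _ * _.
have cI : c \in I (n + m)%N.
  by apply: filB; [apply: afilM|rewrite addnC; apply: afilM].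
have E : gel [~ g, h]%g - 1 = gel (g^-1 * h^-1)%g * c.
  have -> : c = gel (g * h)%g - gel (h * g)%g.
    by rewrite /c commutator_sub1 !gelM.
  rewrite mulrBr !gelM; congr (gel _ - _); first by rewrite commgEl conjgE !mulgA.
  by rewrite -(gel1 A); congr gel; rewrite -!mulgA mulKg mulVg.
have gE : gel (g^-1 * h^-1)%g * c \in I (n + m)%N.
  by rewrite -[(n + m)%N]add0n; apply: (@afilM _ _ I 0 (n + m)) => //; apply: fil0.
rewrite E; split=> //; apply: fil_sym.
rewrite -{2}[c]mul1r -mulrBl; apply: (@afilM _ _ I 1 (n + m)) => //; exact: gel_sub1.
Qed.


Lemma dimension_subgroup n : is_subgroup [set g | gel g - 1 \in I n].
Proof.
split=> [|g h /= gI hI]; first by rewrite /= gel1 subrr rpred0.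
have -> : gel (g * h^-1)%g - 1 = (gel g - 1) * gel h^-1%g -
    (gel h - 1) * gel h^-1%g.
  by rewrite -mulrBl opprB addrA subrK mulrBl !gelM mulgV gel1.
apply: filB; rewrite -[n]addn0; apply: (@afilM _ _ I n 0) => //; exact: fil0.
Qed.

Lemma lower_central_fil n (g : G) : lower_central_series n g -> gel g - 1 \in I n.
Proof.
case: n => [|n]; first by move=> _; apply: fil0.
elim: n g => [|n IH] g; first by move=> _; apply: gel_sub1.
move=> /(_ _ (dimension_subgroup n.+2)); apply=> _ [x xG [y _ <-]] /=.
rewrite -addn1; have [] // := @commutator_gel_sub1 n.+1 1 x y.
  exact: IH.
exact: gel_sub1.
Qed.

(** The next piece of the filtration is added to make membership a property of
    the class in degree n. *)
Definition class_span (P : set G) n :=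
  span ([set gel y - 1 | y in P] `|` [set` I n.+1]).

Lemma class_span_congr P n x y : y \in class_span P n -> x - y \in I n.+1 ->
  x \in class_span P n.
Proof.
by move=> yP xy; rewrite -(subrK y x) rpredD //; apply: sub_span; right.
Qed.

Lemma class_span_next P n x : x \in I n.+1 -> x \in class_span P n.
Proof. by move=> xI; apply: sub_span; right. Qed.

Local Notation Gamma := (@lower_central_series G).

Let class_span_bracket n x g : (0 < n)%N -> x \in class_span (Gamma n) n ->
  x * (gel g - 1) - (gel g - 1) * x \in class_span (Gamma n.+1) n.+1.
Proof.
case: n => // n _; set v := gel g - 1.
have vI : v \in I 1%N by apply: gel_sub1.
move: x; apply: span_ind => [|x y xP yP|c x xP|x [[y yG <-]|xI]].
- by rewrite mul0r mulr0 subr0 rpred0.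
- by rewrite mulrDl (mulrDr v) opprD addrACA rpredD.
- by rewrite -scalerAl -scalerAr -scalerBr rpredZ.
- have [_] := commutator_gel_sub1 (lower_central_fil yG) vI.
  rewrite addn1; apply: class_span_congr; apply: sub_span; left.
  exists [~ y, g]%g => //; apply: sub_generated.
  by exists y => //; exists g.
- apply: class_span_next; apply: filB.
    by rewrite -addn1; apply: (@afilM _ _ I n.+2 1).
  by rewrite -add1n; apply: (@afilM _ _ I 1 n.+2).
Qed.

(** For t = a (x) b with a, b of degrees i, j, the tensor on the left is
    av (x) b + a (x) bv up to higher terms, and S(av) is congruent to - v S(a);
    so its image is - j v S(a) b + (j + 1) S(a) b v, which is the bracket of
    j S(a) b with v, plus S(a) b v. *)
Let psi_step n t g (v := gel g - 1) : t \in T n ->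
  psi n.+1 (tmul t (tens (gel g) (gel g)) - t) -
    (psi n t * v - v * psi n t + antipode_left A t * v) \in I n.+2.
Proof.
move=> tT; have vI : v \in I 1%N by apply: gel_sub1.
pose L1 : {linear tensor A A -> A} :=
  psi n.+1 \o (tensor_hom (rmul (gel g)) (rmul (gel g)) \- idfun).
pose L2 : {linear tensor A A -> A} :=
  ((rmul v \o psi n) \- (lmul v \o psi n)) \+ (rmul v \o antipode_left A).
pose L : {linear tensor A A -> A} := L1 \- L2.
rewrite tmul_tens -[X in X \in _]/(L t); move: t tT.
apply: tfil_map => i j a b ijn aI bI.
rewrite -[X in X \in _]/(psi n.+1 (tensor_hom (rmul (gel g)) (rmul (gel g))
  (tens a b) - tens a b) - (psi n (tens a b) * v - v * psi n (tens a b) +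
  antipode_left A (tens a b) * v)).
have ga : rmul (gel g) a = a + a * v by rewrite /rmul mulrBr mulr1 addrC subrK.
have gb : rmul (gel g) b = b + b * v by rewrite /rmul mulrBr mulr1 addrC subrK.
have avI : a * v \in I i.+1 by rewrite -addn1; apply: (@afilM _ _ I i 1).
have bvI : b * v \in I j.+1 by rewrite -addn1; apply: (@afilM _ _ I j 1).
have gE : tensor_hom (rmul (gel g)) (rmul (gel g)) (tens a b) - tens a b =
    tens (a * v) b + (tens a (b * v) + tens (a * v) (b * v)).
  apply: etrans (congr1 (fun t => t - tens a b) (tensor_homE _ _ _ _)) _.
  rewrite -[LHS]/(tens (rmul (gel g) a) (rmul (gel g) b) - tens a b) ga gb.
  have cancel4 (V : zmodType) (p q s u : V) : p + q + (s + u) - p = q + (s + u).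
    by rewrite addrC !addrA addNr add0r.
  by rewrite tensDr !tensDl cancel4.
rewrite gE antipode_left_tens !(linearD (psi n.+1)).
set w := S a * b.
have wE : S (a * v) * b - (- (v * w)) \in I n.+2.
  rewrite opprK antipodeM -mulrA -mulrDl -ijn -add2n; apply: (@afilM _ _ I 2 (i + j)).
    exact: antipode_gel_sub1.
  by apply: (@afilM _ _ I i j) => //; apply: antipode_fil.
pose y := j%:R *: (- (v * w)) + (j.+1%:R *: (w * v) + 0).
apply: (@fil_trans _ _ _ _ _ y); last first.
  have -> : y = j%:R *: (w * v) - j%:R *: (v * w) + w * v.
    rewrite /y mulrS scalerDl scale1r addr0 scalerN addrCA [RHS]addrC.
    by congr (_ + _); apply: addrC.
  have pE : j%:R *: w - psi n (tens a b) \in I n.+1.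
    exact: fil_sym (psi_congr ijn aI bI).
  apply: filD_congr; last by rewrite subrr rpred0.
  apply: filB_congr.
    by rewrite scalerAl -mulrBl -[n.+2]addn1; apply: (@afilM _ _ I n.+1 1).
  by rewrite scalerAr -mulrBr -[n.+2]add1n; apply: (@afilM _ _ I 1 n.+1).
have psi3 : psi n.+1 (tens (a * v) (b * v)) \in I n.+2.
  by apply: psi_next; rewrite -ijn -addnS -addSn; apply: tens_fil.
have psi1 : psi n.+1 (tens (a * v) b) - j%:R *: (S (a * v) * b) \in I n.+2.
  by apply: (@psi_congr _ i.+1 j) => //; rewrite addSn ijn.
have psi2 : psi n.+1 (tens a (b * v)) - j.+1%:R *: (w * v) \in I n.+2.
  by rewrite /w -mulrA; apply: (@psi_congr _ i j.+1) => //; rewrite addnS ijn.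
apply: filD_congr; last by apply: filD_congr; rewrite ?subr0.
apply: fil_trans psi1 _; rewrite -scalerBr.
exact: rpredZ.
Qed.

(** By [psi_step] the operator [psi n \o Delta] sends v_1 ... v_n, where
    v_i = g_i - 1, to the iterated bracket [[v_1, v_2], ..., v_n] up to terms of
    higher degree, and this bracket is congruent to the iterated commutator of
    the g_i minus 1. *)
Lemma Dynkin n x : x \in I n -> psi n (Delta A x) \in class_span (Gamma n) n.
Proof.
have psi0 t : psi 0 t = 0.
  pose z : {linear tensor A A -> A} := \0.
  rewrite -[RHS]/(z t); move: t; apply: tensor_ext => v w.
  by rewrite -[LHS]/(psi 0 (tens v w)) psi_tens big_ord1 scale0r.
elim: n x => [|n IH] x xI; first by rewrite psi0 rpred0.
move: x xI; apply: fga_fil_ind => [|x y xP yP|c x xP|x g xI].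
- by rewrite (linear0 (Delta A)) (linear0 (psi _)) rpred0.
- by rewrite (linearD (Delta A)) (linearD (psi _)) rpredD.
- by rewrite (linearZ_LR (Delta A)) (linearZ_LR (psi _)) rpredZ.
have step := psi_step g (Delta_fil xI).
have -> : Delta A (x * (gel g - 1)) =
    tmul (Delta A x) (tens (gel g) (gel g)) - Delta A x.
  by rewrite mulrBr mulr1 (linearB (Delta A)) DeltaM Delta_gel.
apply: class_span_congr step; rewrite antipode_left_Delta.
case: n IH xI => [_ _|n IH xI]; last first.
  rewrite (unit_counit_fil1 xI) mul0r addr0.
  by apply: class_span_bracket => //; apply: IH.
rewrite psi0 mul0r mulr0 subrr add0r; move: x; apply: fga_ind.
- by rewrite (linear0 (unit_counit A)) mul0r rpred0.
- by move=> x y xP yP; rewrite (linearD (unit_counit A)) mulrDl rpredD.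
- by move=> c x xP; rewrite (linearZ_LR (unit_counit A)) -scalerAl rpredZ.
move=> h; rewrite unit_counit_gel mul1r; apply: sub_span; left.
by exists g.
Qed.

End DynkinOperator.
Arguments class_span {k G} A P n.
Arguments psi {k G} A n.

(** * Logarithmic derivatives of group-like series *)

Section EulerDerivation.
Local Open Scope ring_scope.
Variables (k : fieldType) (A : algType k) (F : alg_filtration A).
Local Notation R := (cgra F).
Implicit Types (x y : R).

Lemma liftsB X Y x y : lifts X x -> lifts Y y ->
  lifts (fun n => X n - Y n) (x - y).
Proof.
move=> Xx Yy n; have := liftsD Xx (liftsZ (-1) Yy) n.
by rewrite !scaleN1r.
Qed.

Definition euler x : R := fun n => n%:R *: x n.

Lemma euler_lifts X x : lifts X x -> lifts (fun n => n%:R *: X n) (euler x).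
Proof.
by move=> Xx n; have [XF xE] := Xx n; rewrite rpredZ // /euler xE gr_classZ.
Qed.

Lemma eulerM x y : euler (x * y) = euler x * y + x * euler y.
Proof.
have [Xx Yy] := (gr_lift_lifts x, gr_lift_lifts y).
apply: (lifts_inj (euler_lifts (lifts_mul Xx Yy)) (liftsD
  (lifts_mul (euler_lifts Xx) Yy) (lifts_mul Xx (euler_lifts Yy)))) => n.
rewrite /convolution -big_split scaler_sumr -sumrB rpred_sum // => i _ /=.
rewrite -scalerAl -scalerAr -scalerDl -natrD subnKC ?leq_ord //.
by rewrite subrr rpred0.
Qed.

Lemma euler1 : euler 1 = 0.
Proof. by apply: cgrP => -[|n]; rewrite /euler ?scale0r ?cgra1ES ?scaler0. Qed.

Lemma euler_cfil n x : x \in cfil F n -> euler x \in cfil F n.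
Proof.
move=> /cfilP x0; apply/cfilP => j /x0; rewrite /euler => ->.
exact: scaler0.
Qed.

Hypothesis char0 : [pchar k] =i pred0.

Lemma natr_neq0 n : n.+1%:R != 0 :> k.
Proof. by rewrite ((pcharf0P k).1 char0). Qed.

Lemma euler_eq0 x : x 0%N = (1 : R) 0%N -> euler x = 0 -> x = 1.
Proof.
move=> x0 Yx; apply: cgrP => -[//|n].
have := congr1 (fun z : R => z n.+1) Yx; rewrite /euler => /eqP.
by rewrite scaler_eq0 (negPf (natr_neq0 n)) => /eqP.
Qed.

End EulerDerivation.

Section LogarithmicDerivative.
Local Open Scope ring_scope.
Local Open Scope classical_set_scope.
Variables (k : fieldType) (Q : groupType) (B : filtered_group_algebra k Q).
Local Notation I := (fga_fil B).
Local Notation R := (cgra I).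
Local Notation gel := (gel B).
Implicit Types (P : nat -> set Q).

Definition gr_span (P : set Q) n (u : gr I n) := gr_lift u \in class_span B P n.

Lemma gr_span0 (P : set Q) n : gr_span P (0 : gr I n).
Proof. by apply: class_span_next; apply: gr_lift0. Qed.

Lemma gr_spanZD (P : set Q) n c (u v : gr I n) :
  gr_span P u -> gr_span P v -> gr_span P (c *: u + v).
Proof.
move=> uP vP; apply: class_span_congr (gr_liftZD _ _ _).
by rewrite rpredD ?rpredZ.
Qed.

Lemma gr_spanZ (P : set Q) n c (u : gr I n) : gr_span P u -> gr_span P (c *: u).
Proof. by move=> uP; rewrite -[_ *: _]addr0; apply: gr_spanZD (gr_span0 _ _). Qed.

Lemma gr_spanD (P : set Q) n (u v : gr I n) :
  gr_span P u -> gr_span P v -> gr_span P (u + v).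
Proof. by move=> uP vP; rewrite -[u]scale1r; apply: gr_spanZD. Qed.

Lemma gr_spanS (P P' : set Q) n (u : gr I n) :
  P `<=` P' -> gr_span P u -> gr_span P' u.
Proof.
move=> PP'; apply: span_sub => a [[y yP <-]|aI]; apply: sub_span.
  by left; exists y => //; apply: PP'.
by right.
Qed.

Lemma gr_span_eq0 (P : set Q) n (u : gr I n) :
  (forall y, P y -> gel y - 1 \in I n.+1) -> gr_span P u -> u = 0.
Proof.
move=> PI uP; rewrite -[u]gr_liftK; apply: gr_class_next; move: uP.
by apply: span_sub => a [[y yP <-]|//]; apply: PI.
Qed.

(** When P is a filtration by subgroups with [P n, P m] contained in P (n + m),
    this is the image of its completed graded Lie algebra. *)
Definition hat P (x : R) := forall n, gr_span (P n) (x n).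

Lemma hat_lifts P X (x : R) : lifts X x -> (forall n, X n \in class_span B (P n) n) ->
  hat P x.
Proof. by move=> Xx XP n; apply: class_span_congr (XP n) (lifts_congr n Xx). Qed.

Lemma hatD P (x y : R) : hat P x -> hat P y -> hat P (x + y).
Proof. by move=> xP yP n; apply: gr_spanD. Qed.
Lemma hatZ P c (x : R) : hat P x -> hat P (c *: x).
Proof. by move=> xP n; apply: gr_spanZ. Qed.
Lemma hatN P (x : R) : hat P x -> hat P (- x).
Proof. by move=> xP; rewrite -scaleN1r; apply: hatZ. Qed.
Lemma hatB P (x y : R) : hat P x -> hat P y -> hat P (x - y).
Proof. by move=> xP yP; apply: hatD (hatN _). Qed.
Lemma hat0 P : hat P (0 : R).
Proof. by move=> n; apply: gr_span0. Qed.

Lemma hatS P P' (x : R) : (forall n, P n `<=` P' n) -> hat P x -> hat P' x.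
Proof. by move=> PP' xP n; apply: gr_spanS (PP' n) (xP n). Qed.

Local Notation Gamma := (@lower_central_series Q).

(** For a group-like x the series x^-1 Y(x), with Y the Euler derivation, is a
    Lie series: if S is the antipode it is the image of x under the convolution
    S * Y, which is the Dynkin operator. *)
Lemma log_derivative (x : R) : grouplike x -> x 0%N = gr_class I 0 1 ->
  exists x', x * x' = 1 /\ hat Gamma (x' * euler x).
Proof.
move=> gx x0; pose X n := gr_lift (x n); have Xx : lifts X x by apply: gr_lift_lifts.
pose x' : R := fun n => gr_class I n (antipode B (X n)).
have Sx : lifts (fun n => antipode B (X n)) x'.
  by move=> n; split=> //; apply: antipode_fil; apply: gr_lift_fil.
exists x'; split.
  apply: (lifts_inj (lifts_mul Xx Sx) (@lifts1 _ _ _)) => n.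
  have := antipode_right_fil (gx n).
  rewrite (linearB_sum (antipode_right B)) antipode_right_Delta.
  under eq_bigr do rewrite antipode_right_tens.
  move=> /fil_sym; case: n => [|n]; last by rewrite (unit_counit_fil1 (gr_lift_fil _)).
  suff -> : unit_counit B (gr_lift (x 0%N)) = 1 by [].
  have := gr_classK (fil0 I 1); rewrite -x0 => /unit_counit_fil1 /eqP.
  rewrite (linearB (unit_counit B)) subr_eq0 => /eqP ->.
  by rewrite -(gel1 B) unit_counit_gel gel1.
move=> n; have := Dynkin (gr_lift_fil (x n)); rewrite -/(X n) => DX.
apply: class_span_congr DX _.
apply: fil_trans (lifts_congr n (lifts_mul Sx (euler_lifts Xx))) _.
pose L : {linear tensor B B -> B} := psi B n.
have : L (Delta B (X n)) - \sum_(i < n.+1) L (tens (X i) (X (n - i)%N)) \in I n.+1.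
  by rewrite -(linearB_sum L); apply: psi_next; apply: gx.
move=> LX; apply: fil_sym; apply: fil_trans LX _.
rewrite /convolution -sumrB; apply: rpred_sum => i _; rewrite -scalerAr.
exact: (psi_congr (subnKC (leq_ord i)) (gr_lift_fil (x i)) (gr_lift_fil _)).
Qed.

Lemma class_span_bracket2 P P' i j a b :
  (forall n y, P n y -> gel y - 1 \in I n) ->
  (forall n m y z, P n y -> P m z -> P' (n + m)%N [~ y, z]%g) ->
  a \in class_span B (P i) i -> b \in class_span B (P j) j ->
  a * b - b * a \in class_span B (P' (i + j)%N) (i + j).
Proof.
move=> PI PP' aP bP.
have spanI n c : c \in class_span B (P n) n -> c \in I n.
  by apply: span_sub => _ [[y yP <-]|/filS //]; apply: PI.
have bI := spanI _ _ bP; move: a aP.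
apply: span_ind => [|a a' aP a'P|c a aP|a [[y yP <-]|aI]].
- by rewrite mul0r mulr0 subr0 rpred0.
- by rewrite mulrDl mulrDr opprD addrACA rpredD.
- by rewrite -scalerAl -scalerAr -scalerBr rpredZ.
- set v := gel y - 1; move: b bP {bI}.
  apply: span_ind => [|b b' bP b'P|c b bP|b [[z zP <-]|bI]].
  + by rewrite mul0r mulr0 subr0 rpred0.
  + by rewrite (mulrDl b) (mulrDr v) opprD addrACA rpredD.
  + by rewrite -scalerAl -scalerAr -scalerBr rpredZ.
  + have [_] := commutator_gel_sub1 (PI _ _ yP) (PI _ _ zP).
    apply: class_span_congr; apply: sub_span; left.
    by exists [~ y, z]%g => //; apply: PP'.
  + apply: class_span_next; apply: filB.
      by rewrite -addnS; apply: (@afilM _ _ I i j.+1) => //; apply: PI.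
    by rewrite -addnS addnC; apply: (@afilM _ _ I j.+1 i) => //; apply: PI.
- apply: class_span_next; apply: filB.
    by rewrite -addSn; apply: (@afilM _ _ I i.+1 j).
  by rewrite -addSn addnC; apply: (@afilM _ _ I j i.+1).
Qed.

Lemma hat_bracket P P' (x y : R) :
  (forall n y, P n y -> gel y - 1 \in I n) ->
  (forall n m y z, P n y -> P m z -> P' (n + m)%N [~ y, z]%g) ->
  hat P x -> hat P y -> hat P' (x * y - y * x).
Proof.
move=> PI PP' xP yP; have [Xx Yy] := (gr_lift_lifts x, gr_lift_lifts y).
apply: (hat_lifts (liftsB (lifts_mul Xx Yy) (lifts_mul Yy Xx))) => n.
rewrite /convolution [X in _ - X](reindex_inj rev_ord_inj) -sumrB.
apply: rpred_sum => i _ /=; rewrite subSS subKn ?leq_ord //.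
have := class_span_bracket2 PI PP' (xP i) (yP (n - i)%N).
by rewrite subnKC ?leq_ord.
Qed.

Hypothesis char0 : [pchar k] =i pred0.

Section Conjugation.
Variables P P' : nat -> set Q.
Hypothesis PI : forall n y, P n y -> gel y - 1 \in I n.
Hypothesis PP' : forall n m y z, P n y -> P m z -> P' (n + m)%N [~ y, z]%g.
Hypothesis P'P : forall n, P' n `<=` P n.
Variables h h' d : R.
Hypotheses (h'h : h' * h = 1) (hh' : h * h' = 1).
Hypothesis h0 : h 0%N = gr_class I 0 1.
Hypotheses (Yh : euler h = h * d) (dP : hat P d).

Let d_fil1 : d \in cfil I 1.
Proof.
apply/cfilP => -[|//] _; apply: gr_span_eq0 (dP 0%N) => y _.
exact: gel_sub1.
Qed.

Let Yh' : euler h' = - (d * h').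
Proof.
have := eulerM h' h; rewrite h'h euler1 Yh mulrA h'h mul1r => /esym/eqP.
rewrite addr_eq0 => /eqP YE; rewrite -[LHS]mulr1 -hh' mulrA YE.
by rewrite mulNr.
Qed.

(** Differentiating b = h' a h, for a homogeneous of degree m, gives
    (n - m) b_n = (b d - d b)_n, where the right-hand side only involves the
    components of b in degrees less than n. *)
Let conj_homogeneous m a : hat P a -> (forall n, n != m -> a n = 0) ->
  hat P' (h' * a * h - a).
Proof.
move=> aP am; set b := h' * a * h.
have aF : a \in cfil I m.
  by apply/cfilP => j ltjm; apply: am; rewrite neq_ltn ltjm.
have h1F : h - 1 \in cfil I 1.
  by apply/cfilP => -[|//] _; rewrite cgraDE cgraNE h0 subrr.
have baF : b - a \in cfil I m.+1.
  have -> : b - a = h' * (a * (h - 1) - (h - 1) * a).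
    have -> : a * (h - 1) - (h - 1) * a = a * h - h * a.
      by rewrite mulrBr mulr1 mulrBl mul1r opprB addrA subrK.
    by rewrite mulrBr /b !mulrA h'h mul1r.
  have cF : a * (h - 1) - (h - 1) * a \in cfil I m.+1.
    apply: filB; first by rewrite -addn1; case: (cfilM aF h1F).
    by rewrite -add1n; case: (cfilM h1F aF).
  exact: cfilMl.
have Yb : euler b - m%:R *: b = b * d - d * b.
  have Ya : euler a = m%:R *: a.
    apply: cgrP => n; rewrite /euler cgraZE.
    by have [->//|nm] := eqVneq n m; rewrite am ?scaler0.
  rewrite /b !eulerM Yh' Ya Yh mulrDl mulNr -scalerAr -scalerAl !mulNr !mulrA.
  by rewrite addrAC addrK addrC.
elim/ltn_ind => n IH; have [lenm|ltmn] := leqP n m.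
  by have /cfilP -> := baF; rewrite ?ltnS //; apply: gr_span0.
have an : a n = 0 by apply: am; rewrite neq_ltn ltmn orbT.
rewrite cgraDE cgraNE an subr0.
(* As d has no constant term, the component of degree n of [b, d] does not
   change when b is truncated below degree n. *)
pose t : R := fun i => if (i < n)%N then b i else 0.
have tP : hat P t.
  move=> i; rewrite /t; case: ifP => [ltin|_]; last exact: gr_span0.
  have -> : b i = (b - a) i + a i by rewrite cgraDE cgraNE subrK.
  by apply: gr_spanD (aP i); apply: gr_spanS (@P'P i) (IH i ltin).
have btF : b - t \in cfil I n.
  by apply/cfilP => j ltjn; rewrite cgraDE cgraNE /t ltjn subrr.
have bdE : (b * d - d * b) n = (t * d - d * t) n.
  apply/eqP; rewrite -subr_eq0 -cgraNE -cgraDE; apply/eqP.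
  have -> : b * d - d * b - (t * d - d * t) = (b - t) * d - d * (b - t).
    by rewrite mulrBl mulrBr !opprD !opprK addrACA.
  suff /cfilP -> : (b - t) * d - d * (b - t) \in cfil I n.+1 by [].
  apply: filB; first by rewrite -addn1; case: (cfilM btF d_fil1).
  by rewrite -add1n; case: (cfilM d_fil1 btF).
have := hat_bracket PI PP' tP dP n; rewrite -bdE -Yb cgraDE cgraNE cgraZE.
rewrite /euler -scalerBl -natrB ?(ltnW ltmn) //.
have : (n - m)%:R != 0 :> k.
  by rewrite ((pcharf0P k).1 char0) -lt0n subn_gt0.
move=> nm0 /(gr_spanZ ((n - m)%:R)^-1).
by rewrite scalerA mulVf // scale1r.
Qed.

(** The general case follows by linearity: in a given degree only finitely many
    homogeneous components of a matter. *)
Lemma conj_congr a : hat P a -> hat P' (h' * a * h - a).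
Proof.
move=> aP n; suff aPn r : forall a, hat P a -> a \in cfil I (n.+1 - r)%N ->
    gr_span (P' n) ((h' * a * h - a) n).
  by apply: (aPn n.+1 a aP); rewrite subnn; apply: fil0.
elim: r => [|r IH] {aP}a aP aF.
  suff /cfilP -> : h' * a * h - a \in cfil I n.+1 by [|apply: gr_span0].
  rewrite subn0 in aF; apply: filB => //.
  by apply: cfilMr; apply: cfilMl.
set m := (n.+1 - r.+1)%N in aF.
pose am : R := fun i => if i == m then a i else 0.
have amP : hat P am.
  by move=> i; rewrite /am; case: ifP => _; [apply: aP|apply: gr_span0].
have -> : h' * a * h - a =
    (h' * am * h - am) + (h' * (a - am) * h - (a - am)).
  by rewrite addrACA -mulrDl -mulrDr -opprD [am + _]addrC subrK.
apply: gr_spanD.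
  by apply: (conj_homogeneous (m := m)) => // i /negPf im; rewrite /am im.
apply: IH; first exact: hatB.
have aF' : a - am \in cfil I m.+1.
  apply/cfilP => j; rewrite ltnS leq_eqVlt cgraDE cgraNE /am => /predU1P[->|ltjm].
    by rewrite eqxx subrr.
  have /cfilP -> // := aF; rewrite ifF ?subrr //.
  by apply/negbTE; rewrite neq_ltn ltjm.
apply: fil_le aF'; rewrite /m subSS; case: (leqP r n) => [lern|ltnr].
  by rewrite subSn.
by rewrite (eqP (_ : n.+1 - r == 0)%N) // subn_eq0.
Qed.

End Conjugation.

(** * Kernels of group-like representations *)

Section MultiplicativeMaps.
Variables (G : groupType) (h : G -> Q) (e : G -> R).
Hypothesis eT : Taylor_along h e.

Let e1 : e 1%g = 1. Proof. by case: eT. Qed.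
Let eM x y : e (x * y)%g = e x * e y. Proof. by case: eT => _ eM _ _ _; apply: eM. Qed.
Let e0 x : e x 0%N = gr_class I 0 1. Proof. by case: eT => _ _ e0 _ _; apply: e0. Qed.
Let eV x : e x^-1%g * e x = 1. Proof. by rewrite -eM mulVg. Qed.
Let eVr x : e x * e x^-1%g = 1. Proof. by rewrite -eM mulgV. Qed.

Definition dlog (x : G) : R := e x^-1%g * euler (e x).

Let dlogE x : euler (e x) = e x * dlog x.
Proof. by rewrite /dlog mulrA eVr mul1r. Qed.

Lemma dlog_Lie x : hat Gamma (dlog x).
Proof.
have [_ _ _ _ eg] := eT; have [x' [xx' dP]] := log_derivative (eg x) (e0 x).
suff -> : dlog x = x' * euler (e x) by [].
by rewrite /dlog -[X in X * _]mulr1 -xx' mulrA eV mul1r.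
Qed.

Lemma dlog_eq0 x : dlog x = 0 -> e x = 1.
Proof.
move=> dx; apply: (euler_eq0 char0); first exact: e0.
by rewrite dlogE dx mulr0.
Qed.

(** Since e [y, z] - 1 = e (y^-1 z^-1) [e y - 1, e z - 1]. *)
Lemma lower_central_cfil n x :
  lower_central_series n x -> e x - 1 \in cfil I n.
Proof.
case: n => [|n]; first by move=> _; apply: fil0.
have sub1 y : e y - 1 \in cfil I 1.
  by apply/cfilP => -[|//] _; rewrite cgraDE cgraNE e0 subrr.
elim: n x => [|n IH] x; first by move=> _; apply: sub1.
have sD : is_subgroup [set y | e y - 1 \in cfil I n.+2].
  split=> [|y z /= yI zI]; first by rewrite /= e1 subrr rpred0.
  have -> : e (y * z^-1)%g - 1 = ((e y - 1) - (e z - 1)) * e z^-1%g.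
    by rewrite opprB addrA subrK mulrBl -eM eVr.
  by apply: cfilMr; apply: (@filB _ _ (cfil I) n.+2).
move=> /(_ _ sD); apply=> _ [y yG [z _ <-]] /=.
have -> : e [~ y, z]%g - 1 =
    e (y^-1 * z^-1)%g * ((e y - 1) * (e z - 1) - (e z - 1) * (e y - 1)).
  rewrite commutator_sub1 mulrBr -!eM; congr (e _ - _).
    by rewrite commgEl conjgE !mulgA.
  by rewrite -mulgA mulKg mulVg e1.
have cI : (e y - 1) * (e z - 1) - (e z - 1) * (e y - 1) \in cfil I n.+2.
  apply: filB; first by rewrite -addn1; case: (cfilM (IH _ yG) (sub1 z)).
  by rewrite -add1n; case: (cfilM (sub1 z) (IH _ yG)).
exact: cfilMl.
Qed.

(** The Lie series [dlog x] has no component in degrees at least i because the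
    terms of the lower central series are trivial there, and none in lower
    degrees because e x - 1 has none. *)
Lemma nilpotent_kernel i x : (forall n y, (i <= n)%N -> Gamma n y -> y = 1%g) ->
  lower_central_series i x -> e x = 1.
Proof.
move=> G1 xG; apply: dlog_eq0; apply: cgrP => n.
have [ltni|lein] := ltnP n i; last first.
  apply: gr_span_eq0 (dlog_Lie x n) => y /(G1 _ _ lein) ->.
  by rewrite gel1 subrr rpred0.
have YF : euler (e x) \in cfil I i.
  have -> : euler (e x) = euler (e x - 1).
    apply: cgrP => -[|j]; rewrite /euler ?scale0r // cgraDE cgraNE cgra1ES.
    by rewrite subr0.
  exact/euler_cfil/lower_central_cfil.
have /cfilP := cfilMl (e x^-1%g) YF.
exact.
Qed.

(** The defect of additivity is dlog x conjugated by e y, minus dlog x. *)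
Lemma dlogM P P' x y :
  (forall n y, P n y -> gel y - 1 \in I n) ->
  (forall n m y z, P n y -> P m z -> P' (n + m)%N [~ y, z]%g) ->
  (forall n, P' n `<=` P n) -> hat P (dlog x) -> hat P (dlog y) ->
  hat P' (dlog (x * y)%g - (dlog x + dlog y)).
Proof.
move=> PI PP' P'P xP yP.
have -> : dlog (x * y)%g - (dlog x + dlog y) =
    e y^-1%g * dlog x * e y - dlog x.
  have -> : dlog (x * y)%g = e y^-1%g * dlog x * e y + dlog y.
    rewrite /dlog invgM !eM eulerM mulrDr; congr (_ + _); first by rewrite !mulrA.
    by rewrite -mulrA (mulrA (e x^-1%g)) eV mul1r.
  by rewrite opprD addrACA subrr addr0.
exact: (conj_congr PI PP' P'P (eV y) (eVr y) (e0 y) (dlogE y) yP).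
Qed.

(** By [dlogM] the logarithmic derivative on K is a homomorphism to an abelian
    group modulo the series of [hat P'], so it kills commutators modulo them. *)
Lemma dlog_commutator P P' (K : set G) :
  (forall n y, P n y -> gel y - 1 \in I n) ->
  (forall n m y z, P n y -> P m z -> P' (n + m)%N [~ y, z]%g) ->
  (forall n, P' n `<=` P n) -> is_subgroup K ->
  (forall x, K x -> hat P (dlog x)) ->
  forall x, commutator_subgroup K K x -> hat P' (dlog x).
Proof.
move=> PI PP' P'P sK KP.
have dM x y : K x -> K y -> hat P' (dlog (x * y)%g - (dlog x + dlog y)).
  by move=> /KP xP /KP yP; apply: (dlogM PI PP' P'P).
have dV x : K x -> hat P' (dlog x^-1%g + dlog x).
  move=> xK; have := dM _ _ (subgroup_inv sK xK) xK.
  rewrite mulVg {1}/dlog e1 euler1 mulr0 sub0r => /hatN.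
  by rewrite opprK.
pose D := [set x | K x /\ hat P' (dlog x)].
suff sD : is_subgroup D.
  move=> x /(_ D sD) xD; suff [] : D x by [].
  apply: xD => _ [y yK [z zK <-]]; have cK : K [~ y, z]%g.
    rewrite commgEl conjgE; do !apply: (subgroup_mul sK) => //; exact: subgroup_inv.
  split=> //.
  have A1 := dM _ _ yK zK; have A2 := dM _ _ zK yK.
  have A3 := dM _ _ (subgroup_mul sK zK yK) cK.
  have := hatB (hatB A1 A2) A3; rewrite -commgC.
  have zE (V : zmodType) (a b c p q : V) :
      a - (p + q) - (b - (q + p)) - (a - (b + c)) = c.
    by rewrite (addrC q p) opprB subrKA opprB addrC subrKA (addrC b) addrK.
  by rewrite zE.
have K1 := sK.1; split=> [|x y [xK xP] [yK yP]].
  by split=> //; rewrite /dlog e1 euler1 mulr0; apply: hat0.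
have yVK := subgroup_inv sK yK; split; first exact: sK.2.
have -> : dlog (x * y^-1)%g = dlog (x * y^-1)%g - (dlog x + dlog y^-1%g) +
    (dlog x + (dlog y^-1%g + dlog y)) - dlog y.
  by rewrite (addrA (dlog x)) (addrA _ (_ + _)) subrK addrK.
by apply: hatB yP; apply: hatD (hatD xP (dV _ yK)); apply: dM.
Qed.

Lemma derived_seriesS (K : groupType) j :
  @derived_series K j.+1 `<=` derived_series j.
Proof.
have [sD _] := derived_series_normal K j.
move=> x /(_ _ sD); apply=> _ [y yD [z zD <-]]; rewrite commgEl conjgE.
do !apply: (subgroup_mul sD) => //; exact: subgroup_inv.
Qed.

(** The derived series is intersected with the subgroups of the y such that
    y - 1 lies in I n, because [commutator_gel_sub1] shows at once that
    commutators add their degrees. *)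
Lemma dlog_derived j x : derived_series j x ->
  hat (fun n => derived_series j `&` [set y : Q | gel y - 1 \in I n]) (dlog x).
Proof.
elim: j x => [|j IH] x xD.
  apply: hatS (dlog_Lie x) => n y yG; split=> //; exact: lower_central_fil.
apply: (dlog_commutator _ _ _ _ IH xD) => [n y []//|n m y z [yD yI] [zD zI]|n y|].
- split; last by case: (commutator_gel_sub1 yI zI).
  by apply: sub_generated; exists y => //; exists z.
- by move=> [/derived_seriesS yD yI].
- by case: (derived_series_normal G j).
Qed.

Lemma solvable_kernel j x : (forall y : Q, derived_series j y -> y = 1%g) ->
  derived_series j x -> e x = 1.
Proof.
move=> D1 xD; apply: dlog_eq0; apply: cgrP => n.
apply: gr_span_eq0 (dlog_derived xD n) => y [/D1 -> _].
by rewrite gel1 subrr rpred0.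
Qed.

End MultiplicativeMaps.

End LogarithmicDerivative.

(** * Quotient groups *)

Section TaylorAlongComposition.
Variables (k : fieldType) (G G' H : groupType) (h : G -> H) (i : G' -> G).
Hypothesis iM : {morph i : x y / (x * y)%g}.
Variable B : filtered_group_algebra k H.

Lemma Taylor_along_comp (E : G -> cgra (fga_fil B)) :
  Taylor_along h E -> Taylor_along (h \o i) (E \o i).
Proof.
move=> [E1 EM E0 E1d Eg]; split=> [|x y|x|x|x] /=; rewrite ?iM //.
suff -> : i 1%g = 1%g by [].
by apply: (mulIg (i 1%g)); rewrite -iM !mul1g.
Qed.

End TaylorAlongComposition.

Section QuotientExpansion.
Local Open Scope classical_set_scope.
Local Open Scope quotient_scope.
Variables (G : groupType) (N : normal_subgroup G).
Local Notation Q := (quotient_group N).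

Definition quotient_map (x : G) : Q := \pi_Q x.

Lemma quotient_mapM : {morph quotient_map : x y / (x * y)%g}.
Proof. by move=> x y; rewrite /quotient_map -qg_pi_mul. Qed.

Lemma quotient_map1P x : quotient_map x = 1%g <-> normal_set N x.
Proof.
have [sN _] := normal_setP N; rewrite -[1%g]/(\pi_Q 1%g) qg_pi_eq mulg1.
by split=> [/(subgroup_inv sN)|/(subgroup_inv sN)]; rewrite ?invgK.
Qed.

Lemma quotient_map_repr (q : Q) : quotient_map (repr q) = q.
Proof. exact: reprK. Qed.

Lemma quotient_commutator (H K : set G) (H' K' : set Q) :
  H' `<=` quotient_map @` H -> K' `<=` quotient_map @` K ->
  commutator_subgroup H' K' `<=` quotient_map @` commutator_subgroup H K.
Proof.
have qV x : quotient_map x^-1%g = (quotient_map x)^-1%g.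
  apply: (mulIg (quotient_map x)); rewrite -quotient_mapM !mulVg.
  by apply/quotient_map1P; case: (normal_setP N) => -[].
move=> H'H K'K y; set S := _ @` _.
have sS : is_subgroup S.
  have [C1 CM] := generated_subgroup [set [~ x, y]%g | x in H & y in K].
  split=> [|_ _ [x xC <-] [z zC <-]].
    by exists 1%g => //; apply/quotient_map1P; case: (normal_setP N) => -[].
  by exists (x * z^-1)%g; [apply: CM|rewrite quotient_mapM qV].
move=> /(_ S sS); apply=> _ [a /H'H[x xH <-] [b /K'K[z zK <-] <-]].
exists [~ x, z]%g; first by apply: sub_generated; exists x => //; exists z.
by rewrite !commgEl !conjgE !quotient_mapM !qV.
Qed.

Lemma quotient_lower_central n :
  @lower_central_series Q n `<=` quotient_map @` lower_central_series n.
Proof.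
have surj : [set: Q] `<=` quotient_map @` [set: G].
  by move=> q _; exists (repr q) => //; apply: quotient_map_repr.
rewrite /lower_central_series; elim: n.-1 => [//|m IH] /=.
exact: quotient_commutator.
Qed.

Lemma quotient_derived n :
  @derived_series Q n `<=` quotient_map @` derived_series n.
Proof.
elim: n => [|n IH] /=; last exact: quotient_commutator.
by move=> q _; exists (repr q) => //; apply: quotient_map_repr.
Qed.

Variables (k : fieldType) (A : filtered_group_algebra k G).
Variable B : filtered_group_algebra k Q.

(** Composing an expansion with the functorial map of the projection gives a
    map on G; it is constant on the cosets of N as soon as it is trivial on N. *)
Lemma quotient_Taylor :
  (forall e : G -> cgra (fga_fil B), Taylor_along quotient_map e ->
     forall x, normal_set N x -> e x = 1%R) ->
  (exists E, Taylor_along (B := A) id E) ->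
  exists E, Taylor_along (B := B) id E.
Proof.
move=> ker [E ET].
pose e x := completed_map idfun quotient_map B (E x).
have eT : Taylor_along quotient_map e.
  by apply: Taylor_along_map ET; apply: quotient_mapM.
have [e1 eM e0 e1d eg] := eT.
have ee x y : quotient_map x = quotient_map y -> e x = e y.
  move=> /qg_pi_eq /(ker e eT) exy.
  by rewrite -[y](mulVKg x) eM exy mulr1.
exists (fun q => e (repr q)); split=> [|p q|q|q|q] //.
- by rewrite -e1; apply: ee; apply: quotient_map_repr.
- rewrite -eM; apply: ee; rewrite quotient_mapM.
  by rewrite !quotient_map_repr.
- by rewrite e1d quotient_map_repr.
Qed.

End QuotientExpansion.

Lemma lower_central_trivial (Q : groupType) i n :
  (1 <= i <= n)%N ->
  (forall y : Q, lower_central_series i y -> y = 1%g) ->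
  forall y : Q, lower_central_series n y -> y = 1%g.
Proof.
case/andP; case: i => // i _ /subnKC <- Q1.
elim: (n - i.+1)%N => [|d IH] y; first by rewrite addn0; apply: Q1.
rewrite addnS /lower_central_series /= => /(_ [set 1%g]%classic).
apply; first by split=> [//|x z -> ->]; rewrite invg1 mulg1.
move=> _ [x xQ [z _ <-]]; rewrite (IH x) ?comm1g //.
Qed.

(** * The group algebra of a group *)

Section StandardModel.
Local Open Scope ring_scope.
Variables (k : fieldType) (G : groupType).
Local Notation A := (group_algebra k G).
Local Notation I := (augmentation_filtration k G).

Let el (g : G) : A := << g >>.

Let elM g h : el g * el h = el (g * h)%g.
Proof.
rewrite -[LHS]/(linext (fun g : G => linext (fun h : G => << (g * h)%g >>)
  (el h)) (el g)).
by rewrite !linextU.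
Qed.

Let el_ind (P : A -> Prop) :
  P 0 -> (forall a b, P a -> P b -> P (a + b)) ->
  (forall c a, P a -> P (c *: a)) -> (forall g, P (el g)) -> forall a, P a.
Proof.
move=> P0 PD PZ PG a.
suff /asboolP : a \in @closed_pred k {malg k[G]} P P0 PD PZ by [].
by move: a; apply: malg_span => g; apply/asboolP/PG.
Qed.

Let el_ext (X : lmodType k) (f : G -> X) : {linear A -> X} := linext f.

Let el_extE (X : lmodType k) (f : G -> X) g : el_ext f (el g) = f g.
Proof. exact: linextU. Qed.

Let augmentation_el g : augmentation (el g) = 1 :> k.
Proof. exact: (@linextU k G k^o (fun=> 1) g). Qed.

Let augmentationZD c (a b : A) :
  augmentation (c *: a + b) = c * augmentation a + augmentation b :> k.
Proof. exact: (linearP (linext (fun _ : G => 1 : k^o))). Qed.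

Let augmentation0 : augmentation (0 : A) = 0 :> k.
Proof. exact: (linear0 (linext (fun _ : G => 1 : k^o))). Qed.

Let el_sub1 g : el g - 1 \in I 1%N.
Proof.
apply: sub_span; exists 1; first exact: augmentation_power_fil0.
exists (el g - 1); rewrite ?mul1r //; apply/eqP.
rewrite addrC -scaleN1r; apply: etrans (augmentationZD _ _ _) _.
by rewrite augmentation_el [X in _ * X]augmentation1 mulr1 addNr.
Qed.

Let augmentation_span (a : A) :
  a - (augmentation a : k) *: (1 : A) \in span [set el g - 1 | g in [set: G]]%classic.
Proof.
move: a; apply: el_ind => [|a b aS bS|c a aS|g].
- by rewrite augmentation0 scale0r subr0 rpred0.
- rewrite -[a]scale1r augmentationZD mul1r scalerDl opprD addrACA scale1r.
  exact: (@rpredD A (span _)).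
- rewrite -[c *: a]addr0 augmentationZD augmentation0 !addr0 -scalerA -scalerBr.
  exact: (rpredZ (s := span _)).
- by rewrite augmentation_el scale1r; apply: sub_span; exists g.
Qed.

Let el_fil_ind n (P : A -> Prop) :
  P 0 -> (forall a b, P a -> P b -> P (a + b)) ->
  (forall c a, P a -> P (c *: a)) ->
  (forall a g, a \in I n -> P (a * (el g - 1))) ->
  forall a, a \in I n.+1 -> P a.
Proof.
move=> P0 PD PZ PG; apply: span_ind => // _ [a aI [b /eqP b0 <-]].
have := augmentation_span b; rewrite b0 scale0r subr0.
move: b {b0}; apply: span_ind => [|b c bP cP|c b bP|_ [g _ <-]].
- by rewrite mulr0.
- by rewrite mulrDr; apply: PD.
- by rewrite -scalerAr; apply: PZ.
- exact: PG.
Qed.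

Definition standard_group_algebra : filtered_group_algebra k G :=
  @FilteredGroupAlgebra k G A I el (erefl _) elM (@el_ext) el_extE el_ind
    el_sub1 el_fil_ind.

Lemma has_Taylor_expansionP : has_Taylor_expansion k G <->
  exists E, Taylor_along (B := standard_group_algebra) id E.
Proof.
split=> -[E].
  move=> [/(@expansion_degree_le1 k G standard_group_algebra E)[E1 EM E0 E1d] Eg].
  exists E; split=> // g.
  exact: (@grouplikeE k G standard_group_algebra (E g)).1 (Eg g).
move=> [E1 EM E0 E1d Eg]; exists E; split.
  exact: (@expansion_degree_le1 k G standard_group_algebra E).2 (And4 E1 EM E0 E1d).
move=> g; exact: (@grouplikeE k G standard_group_algebra (E g)).2 (Eg g).
Qed.

End StandardModel.

(** * Preservation of Taylor expansions *)

Theorem proposition1p2 (k : fieldType) (char0 : [pchar k]%R =i pred0) :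
  [/\ forall (G : groupType), finitely_generated G ->
        has_Taylor_expansion k G ->
        forall (K : fieldType) (f : {rmorphism k -> K}),
          has_Taylor_expansion K G,
      forall (n : nat) (G : 'I_n -> groupType),
        (forall i, finitely_generated (G i)) ->
        (forall i, has_Taylor_expansion k (G i)) ->
        has_Taylor_expansion k (direct_product G) /\
        has_Taylor_expansion k (free_product G),
      forall (G : groupType), finitely_generated G ->
        has_Taylor_expansion k G ->
        forall (K : groupType) (iota : {multiplicative K -> G})
          (rho : {multiplicative G -> K}),
          cancel iota rho -> has_Taylor_expansion k K,
      forall (G : groupType), finitely_generated G ->
        has_Taylor_expansion k G ->
        forall i : nat, 1 <= i ->
          has_Taylor_expansion k (quotient_group (lower_central_subgroup G i))
    & forall (G : groupType), finitely_generated G ->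
        has_Taylor_expansion k G ->
        forall i : nat, 1 <= i ->
          has_Taylor_expansion k (quotient_group (derived_subgroup G i))].
Proof.
split=> [G _ GT K f|n G _ GT|G _ GT K iota rho iotaK|G _ GT i i_gt0|G _ GT i _].
- have [E ET] := (has_Taylor_expansionP k G).1 GT.
  apply/has_Taylor_expansionP.
  by exists (fun g => completed_map f id (standard_group_algebra K G) (E g));
    apply: Taylor_along_map ET.
- have {}GT j := (has_Taylor_expansionP k (G j)).1 (GT j).
  split; apply/has_Taylor_expansionP.
    exact: direct_product_Taylor GT.
  exact: free_product_Taylor GT.
- have [E ET] := (has_Taylor_expansionP k G).1 GT.
  have eT := Taylor_along_map idfun (gmulfM (s := rho)) (standard_group_algebra k K) ET.
  have := Taylor_along_comp (gmulfM (s := iota)) eT.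
  move=> [e1 eM e0 e1d eg]; apply/has_Taylor_expansionP.
  exists ((fun g => completed_map idfun rho (standard_group_algebra k K) (E g)) \o iota).
  by split=> // g; rewrite e1d /= iotaK.
- have {}GT := (has_Taylor_expansionP k G).1 GT.
  apply/has_Taylor_expansionP; apply: quotient_Taylor GT => e eT x xG.
  apply: (nilpotent_kernel char0 eT (i := i)) xG => m y leim; move: y.
  apply: (@lower_central_trivial _ i); first by rewrite i_gt0.
  by move=> z /quotient_lower_central[w wG <-]; apply/quotient_map1P.
- have {}GT := (has_Taylor_expansionP k G).1 GT.
  apply/has_Taylor_expansionP; apply: quotient_Taylor GT => e eT x xG.
  apply: (solvable_kernel char0 eT (j := i)) xG.
  by move=> z /quotient_derived[w wG <-]; apply/quotient_map1P.
Qed.
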